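(* The parameterized problem Short$_{\text{Dominator}}$ MB Dom Game is $\mathrm{W}[2]$-complete.
   Context: All graphs are finite, simple and undirected. The Maker-Breaker domination game on a graph $G$ is played by two players, Dominator and Staller, who alternately claim one unclaimed vertex of $G$. Dominator wins if the vertices she claims contain a dominating set of $G$ (a set $D$ such that every vertex is in $D$ or adjacent to a vertex of $D$); otherwise Staller wins. Short$_{\text{Dominator}}$ MB Dom Game is the following parameterized problem. Input: a graph $G$, the first player (Dominator or Staller), and an integer $k$. Parameter: $k$. Question: does Dominator have a strategy that claims a dominating set of $G$ in at most $k$ moves (i.e. using at most $k$ of her own moves), against every play of Staller? Completeness is with respect to FPT (parameterized) reductions. *)

(* Defs.v *)
From mathcomp Require Import all_boot.

Set Implicit Arguments.
Unset Strict Implicit.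
Unset Printing Implicit Defensive.

(** * Computation model

   Jones's WHILE language over binary trees, restricted to one variable (his
   language I); a conditional is added.  Trees play the role of words over a
   finite alphabet.  Every assignment or test is charged the size of the trees
   it reads and writes, so that sharing of subtrees is never free and running
   times agree, up to a polynomial, with those of Turing machines. *)

Inductive tree := Leaf | Node of tree & tree.

Fixpoint tsize (x : tree) : nat :=
  if x is Node a b then (tsize a + tsize b).+1 else 1.

Definition thd (x : tree) : tree := if x is Node a _ then a else Leaf.
Definition ttl (x : tree) : tree := if x is Node _ b then b else Leaf.

Inductive expr :=
| EVar
| ELeaf
| ENode of expr & expr
| EHd of expr
| ETl of expr.

Fixpoint eval (e : expr) (x : tree) : tree :=
  match e with
  | EVar => x
  | ELeaf => Leaf
  | ENode e1 e2 => Node (eval e1 x) (eval e2 x)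
  | EHd e1 => thd (eval e1 x)
  | ETl e1 => ttl (eval e1 x)
  end.

Inductive prog :=
| Assign of expr
| Seq of prog & prog
| If of expr & prog & prog
| While of expr & prog.

(* [exec p x y t]: started on [x], program [p] halts with [y] after time [t].
   [Leaf] is false and every other tree is true. *)
Inductive exec : prog -> tree -> tree -> nat -> Prop :=
| exec_assign e x :
    exec (Assign e) x (eval e x) (tsize x + tsize (eval e x))
| exec_seq p q x y z s t :
    exec p x y s -> exec q y z t -> exec (Seq p q) x z (s + t)
| exec_if_true e p q x y t :
    eval e x <> Leaf -> exec p x y t -> exec (If e p q) x y (tsize x + t)
| exec_if_false e p q x y t :
    eval e x = Leaf -> exec q x y t -> exec (If e p q) x y (tsize x + t)
| exec_while_stop e p x :
    eval e x = Leaf -> exec (While e p) x x (tsize x)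
| exec_while_step e p x y z s t :
    eval e x <> Leaf -> exec p x y s -> exec (While e p) y z t ->
    exec (While e p) x z (tsize x + s + t).

(** * Encodings

   Numbers are written in unary.  This is immaterial for the parameter; the
   other numbers that occur below count or index vertices or circuit nodes
   that are part of the instance. *)

Definition enc_nat (n : nat) : tree := iter n (Node Leaf) Leaf.

Definition enc_bool (b : bool) : tree := if b then Node Leaf Leaf else Leaf.

Definition enc_seq (A : Type) (enc : A -> tree) (s : seq A) : tree :=
  foldr (fun a x => Node (enc a) x) Leaf s.

(** * Parameterized problems and FPT reductions *)

(* [P x k]: [x] with parameter value [k] is a yes-instance. *)
Definition parameterized_problem := tree -> nat -> Prop.

Definition computable (f : nat -> nat) : Prop :=
  exists p : prog, forall n, exists t, exec p (enc_nat n) (enc_nat (f n)) t.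

(* Since [exec] is deterministic, [t] is the running time. *)
Definition fpt_reduces (P Q : parameterized_problem) : Prop :=
  exists (p : prog) (f g : nat -> nat) (c : nat),
    computable f /\ computable g /\
    forall (x : tree) (k : nat), exists (x' : tree) (k' t : nat),
      exec p (Node x (enc_nat k)) (Node x' (enc_nat k')) t /\
      t <= f k * tsize x ^ c /\
      k' <= g k /\
      (P x k <-> Q x' k').

(** * Boolean circuits and the W-hierarchy

   The directed acyclic graph is given in topological order: node [i] is the
   [i]-th input if [i < inputs C], and node [inputs C + j] is the [j]-th entry
   of [gates C].  A gate lists its predecessors.  The empty conjunction and the
   empty disjunction are the constants. *)

Inductive gate :=
| Not of nat
| And of seq nat
| Or of seq nat.

Definition preds (g : gate) : seq nat :=
  match g with Not i => [:: i] | And s => s | Or s => s end.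

Record circuit := Circuit { inputs : nat; gates : seq gate; output : nat }.

Definition circuit_wf (C : circuit) : bool :=
  all (fun j => all (fun i => i < inputs C + j)
                    (preds (nth (Not 0) (gates C) j)))
      (iota 0 (size (gates C)))
  && (output C < inputs C + size (gates C)).

(* The labels of all nodes, given the labels of the inputs and the way the
   label of a gate is obtained from the labels of the preceding nodes. *)
Definition node_labels (A : Type) (step : seq A -> gate -> A)
    (ins : seq A) (gs : seq gate) : seq A :=
  foldl (fun vs g => rcons vs (step vs g)) ins gs.

Definition gate_value (vs : seq bool) (g : gate) : bool :=
  match g with
  | Not i => ~~ nth false vs i
  | And s => all (nth false vs) s
  | Or s => has (nth false vs) s
  end.

Definition circuit_value (C : circuit) (a : seq bool) : bool :=
  nth false (node_labels gate_value a (gates C)) (output C).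

(* The maximal weight of a path ending in the output node, where [w] is the
   weight of a gate and inputs have weight 0. *)
Definition max_path_weight (w : gate -> nat) (C : circuit) : nat :=
  nth 0 (node_labels (fun vs g => w g + \max_(i <- preds g) nth 0 vs i)
                     (nseq (inputs C) 0) (gates C))
        (output C).

Definition depth : circuit -> nat := max_path_weight (fun=> 1).

Definition large (g : gate) : bool := 2 < size (preds g).

Definition weft : circuit -> nat := max_path_weight (fun g => large g : nat).

Definition enc_gate (g : gate) : tree :=
  match g with
  | Not i => Node (enc_nat 0) (enc_nat i)
  | And s => Node (enc_nat 1) (enc_seq enc_nat s)
  | Or s => Node (enc_nat 2) (enc_seq enc_nat s)
  end.

Definition enc_circuit (C : circuit) : tree :=
  Node (enc_nat (inputs C))
       (Node (enc_seq enc_gate (gates C)) (enc_nat (output C))).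

(* Weighted circuit satisfiability for circuits of weft at most [t] and depth
   at most [d]: is there a satisfying assignment with exactly [k] ones? *)
Definition weighted_circuit_sat (t d : nat) : parameterized_problem :=
  fun x k => exists C : circuit,
    x = enc_circuit C /\ circuit_wf C /\ weft C <= t /\ depth C <= d /\
    exists a : seq bool,
      size a = inputs C /\ count id a = k /\ circuit_value C a.

Definition in_W (t : nat) (P : parameterized_problem) : Prop :=
  exists d : nat, fpt_reduces P (weighted_circuit_sat t d).

Definition W_hard (t : nat) (P : parameterized_problem) : Prop :=
  forall Q : parameterized_problem, in_W t Q -> fpt_reduces Q P.

Definition W_complete (t : nat) (P : parameterized_problem) : Prop :=
  in_W t P /\ W_hard t P.

(** * The Maker-Breaker domination game *)

Variant player := Dominator | Staller.

Section Game.

Variables (T : finType) (e : rel T) (first : player).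

Definition dominating (D : {set T}) : bool :=
  [forall v, (v \in D) || [exists u in D, e u v]].

(* The move number [i], counted from 0, is Dominator's. *)
Definition dominator_turn (i : nat) : bool :=
  if first is Dominator then ~~ odd i else odd i.

(* A history is the sequence of the vertices claimed so far, by both players,
   in order.  A strategy has no move to offer once the board is full. *)
Definition strategy := seq T -> option T.

Definition legal_strategy (sigma : strategy) : Prop :=
  forall h : seq T, uniq h -> size h < #|T| ->
    exists2 v, sigma h = Some v & v \notin h.

(* A play goes on until all vertices are claimed. *)
Definition is_play (p : seq T) : Prop := uniq p /\ size p = #|T|.

Definition follows (sigma : strategy) (p : seq T) : Prop :=
  forall i, i < size p -> dominator_turn i -> onth p i = sigma (take i p).

Definition dominator_moves (p : seq T) : seq T :=
  mask (mkseq dominator_turn (size p)) p.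

Definition dominator_wins_within (k : nat) : Prop :=
  exists sigma : strategy, legal_strategy sigma /\
    forall p, is_play p -> follows sigma p ->
      dominating [set v in take k (dominator_moves p)].

End Game.

(* The adjacency matrix of a graph on the vertices 0, ..., n-1. *)
Definition enc_graph (n : nat) (e : rel 'I_n) : tree :=
  enc_seq (enc_seq enc_bool)
    [seq [seq e i j | j <- enum 'I_n] | i <- enum 'I_n].

Definition enc_player (a : player) : tree :=
  enc_bool (if a is Dominator then true else false).

Definition short_dominator_mb_dom_game : parameterized_problem :=
  fun x k => exists (n : nat) (e : rel 'I_n) (first : player),
    symmetric e /\ irreflexive e /\
    x = Node (enc_graph e) (enc_player first) /\
    dominator_wins_within e first k.

(* Main.v *)
(* Membership.  Staller's move matters to Dominator only if it claims a vertex that she intends to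
   use.  A winning strategy is therefore given by boundedly many vertices: for [r] moves, a first
   move, a default strategy for [r - 1] moves and, for each of its vertices [v], a strategy for
   [r - 1] moves avoiding [v].  That a choice of vertices is a winning strategy is a conjunction of
   clauses, so it is expressed by a circuit of weft 2 and depth 3.

   Hardness.  For a fixed depth, a circuit of weft 2 is equivalent to an OR of ANDs of ORs of
   conjunctions of boundedly many literals, computable in polynomial time.  Write an assignment of
   weight [k] as the increasing sequence of its ones and cut the inputs into [k + 1] segments
   between consecutive ones; then a literal, positive or negative, is certified by the segment that
   contains its variable.  The assignment together with the choice of a disjunct thus becomes a set
   of [(k + 2) ^ c] elements, one for each [c]-tuple of segment indices, and all constraints say
   that certain sets of elements are hit.  A hitting set of size [K] is turned into a dominating set
   by joining the elements into a clique, and taking [2 K] copies of every element prevents Staller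
   from interfering with the [K] moves of Dominator. *)

From mathcomp Require Import all_boot zify.
Require Import Defs.

Set Implicit Arguments.
Unset Strict Implicit.
Unset Printing Implicit Defensive.

(** * Polynomial bounds *)

(** Both reductions are explicit programs, so functions computed in polynomial time are first shown
    closed under pairing, folds and list operations. Numbers are unary, and powers with a fixed
    exponent stay polynomial. Strategies are the exception: the number of slots follows s -> s^2 + s
    + 1, doubly exponential in k. It depends on k alone and comes from iterating a polynomial-time
    step, so its cost is a computable function of the parameter. The hardness reduction is
    polynomial in the instance and k together, because the exponent c = 2^d + 2 depends on the depth
    d only. An innermost conjunction has at most 2^d literals, as each level at most doubles it, and
    c >= 2 lets one tuple contain two consecutive segments. Tuples are used because a hitting
    constraint looks at one element at a time: a conjunction is certified only by an element that
    contains all segments involved. The budget K is exactly the number of index tuples, so asking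
    for one element per tuple leaves no room for a second one; only then can constraints of the form
    [some element is chosen] express agreement between elements. *)

Definition poly_bounded (A : Type) (m t : A -> nat) : Prop :=
  exists c, forall a, t a <= (m a).+2 ^ c.

Section PolyBounds.

Variables (A : Type) (m : A -> nat).

Lemma pbd_le (t u : A -> nat) : (forall a, t a <= u a) -> poly_bounded m u -> poly_bounded m t.
Proof. by move=> le_tu [c Hc]; exists c => a; apply: leq_trans (Hc a). Qed.

Lemma pbd_const n : poly_bounded m (fun=> n).
Proof.
(* The base of the bound is at least 2, so the exponent can absorb constants and sums. *)
exists n => a; apply: leq_trans (ltnW (ltn_expl n (leqnn 2))) _.
by case: n => // n; rewrite leq_exp2r.
Qed.

Lemma pbd_id : poly_bounded m m.
Proof. by exists 1 => a; rewrite expn1; lia. Qed.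

Lemma pbd_add (t u : A -> nat) :
  poly_bounded m t -> poly_bounded m u -> poly_bounded m (fun a => t a + u a).
Proof.
move=> [c Hc] [d Hd]; exists (c + d).+1 => a.
have Hcd x : x <= c + d -> (m a).+2 ^ x <= (m a).+2 ^ (c + d).
  by move=> le_x; rewrite leq_pexp2l.
have := Hcd c (leq_addr _ _); have := Hcd d (leq_addl _ _).
rewrite expnS; have := Hc a; have := Hd a; nia.
Qed.

Lemma pbd_mul (t u : A -> nat) :
  poly_bounded m t -> poly_bounded m u -> poly_bounded m (fun a => t a * u a).
Proof.
by move=> [c Hc] [d Hd]; exists (c + d) => a; rewrite expnD leq_mul.
Qed.

Lemma pbd_exp (t : A -> nat) n : poly_bounded m t -> poly_bounded m (fun a => t a ^ n).
Proof.
by move=> [c Hc]; exists (c * n) => a; rewrite expnM; case: n => // n;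
   rewrite leq_exp2r.
Qed.

Lemma pbd_comp (B : Type) (mB : B -> nat) (f : A -> B) (t : B -> nat) :
  poly_bounded m (fun a => mB (f a)) -> poly_bounded mB t -> poly_bounded m (fun a => t (f a)).
Proof.
move=> mf [c Hc].
apply: (@pbd_le _ (fun a => (mB (f a) + 2) ^ c)) => [a|].
  by rewrite addn2.
by apply/pbd_exp/pbd_add => //; apply: pbd_const.
Qed.

End PolyBounds.

(** * Programs *)

(** The code is inferred from the type, so that running times can be stated for functions between
    ordinary types. *)
Class encodable (A : Type) := enc : A -> tree.

#[local] Instance encodable_tree : encodable tree := id.
#[local] Instance encodable_nat : encodable nat := enc_nat.
#[local] Instance encodable_bool : encodable bool := enc_bool.
#[local] Instance encodable_seq A (e : encodable A) : encodable (seq A) := enc_seq e.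
#[local] Instance encodable_prod A B (eA : encodable A) (eB : encodable B) :
  encodable (A * B) := fun x => Node (enc x.1) (enc x.2).
#[local] Instance encodable_gate : encodable gate := enc_gate.
#[local] Instance encodable_circuit : encodable circuit := enc_circuit.

Definition esize {A : Type} {eA : encodable A} (a : A) : nat := tsize (enc a).

Lemma tsize_gt0 x : 0 < tsize x.
Proof. by case: x. Qed.

Lemma exec_size p x y t : exec p x y t -> tsize x <= t /\ tsize y <= t.
Proof. by elim=> {p x y t} *; lia. Qed.
Definition runs (A B : Type) {eA : encodable A} {eB : encodable B}
    (p : prog) (f : A -> B) (t : A -> nat) : Prop :=
  forall a, exists2 s, exec p (enc a) (enc (f a)) s & s <= t a.

Lemma runs_comp (A B C : Type) {eA : encodable A} {eB : encodable B} {eC : encodable C}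
    p q (f : A -> B) (g : B -> C) t u :
  runs p f t -> runs q g u ->
  runs (Seq p q) (fun a => g (f a)) (fun a => t a + u (f a)).
Proof.
move=> pf qg a; have [s Hs le_s] := pf a; have [r Hr le_r] := qg (f a).
by exists (s + r); [apply: exec_seq Hs Hr | apply: leq_add].
Qed.

(* [onhd p] runs [p] on the head of the store and leaves the tail alone. *)
Fixpoint expr_onhd (e : expr) : expr :=
  match e with
  | EVar => EHd EVar
  | ELeaf => ELeaf
  | ENode e1 e2 => ENode (expr_onhd e1) (expr_onhd e2)
  | EHd e1 => EHd (expr_onhd e1)
  | ETl e1 => ETl (expr_onhd e1)
  end.

Fixpoint onhd (p : prog) : prog :=
  match p with
  | Assign e => Assign (ENode (expr_onhd e) (ETl EVar))
  | Seq p q => Seq (onhd p) (onhd q)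
  | If e p q => If (expr_onhd e) (onhd p) (onhd q)
  | While e p => While (expr_onhd e) (onhd p)
  end.

Lemma eval_onhd e x z : eval (expr_onhd e) (Node x z) = eval e x.
Proof. by elim: e => //= [e1 -> e2 ->|e ->|e ->]. Qed.

(** Every step costs at least one unit, so carrying [z] along multiplies the time by a factor linear
    in [tsize z]. *)
Lemma exec_onhd p x y z t :
  exec p x y t ->
  exists2 s, exec (onhd p) (Node x z) (Node y z) s & s <= t * (2 * tsize z + 3).
Proof.
elim=> {p x y t} /=.
- move=> e x.
  have:= exec_assign (ENode (expr_onhd e) (ETl EVar)) (Node x z).
  rewrite /= eval_onhd => H; eexists; first exact: H.
  by rewrite /=; have:= tsize_gt0 x; have:= tsize_gt0 (eval e x); nia.
- move=> p q x y w s t _ [s' Hs le_s] _ [t' Ht le_t].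
  by exists (s' + t'); [apply: exec_seq Hs Ht | rewrite mulnDl leq_add].
- move=> e p q x y t Ne _ [s Hs le_s]; exists (tsize (Node x z) + s).
    by apply: exec_if_true => //; rewrite eval_onhd.
  by rewrite /=; have:= tsize_gt0 x; nia.
- move=> e p q x y t Ne _ [s Hs le_s]; exists (tsize (Node x z) + s).
    by apply: exec_if_false => //; rewrite eval_onhd.
  by rewrite /=; have:= tsize_gt0 x; nia.
- move=> e p x E; exists (tsize (Node x z)).
    by apply: exec_while_stop; rewrite eval_onhd.
  by rewrite /=; have:= tsize_gt0 x; nia.
- move=> e p x y w s t Ne _ [s' Hs le_s] _ [t' Ht le_t].
  exists (tsize (Node x z) + s' + t').
    by apply: exec_while_step Hs Ht; rewrite eval_onhd.
  by rewrite /=; have:= tsize_gt0 x; nia.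
Qed.

Lemma runs_esize (A B : Type) {eA : encodable A} {eB : encodable B}
  p (f : A -> B) t a : runs p f t -> esize a <= t a /\ esize (f a) <= t a.
Proof. by move=> /(_ a)[s /exec_size[? ?] ?]; rewrite /esize; lia. Qed.

(** With a single variable the store is doubled, one copy is processed, the halves are swapped, the
    other copy is processed, and a last swap restores the order. The product in the bound is the
    price of carrying the idle half. *)
Lemma runs_pair (A B C : Type) {eA : encodable A} {eB : encodable B} {eC : encodable C}
    p q (f : A -> B) (g : A -> C) t u :
  runs p f t -> runs q g u ->
  exists r, runs r (fun a => (f a, g a))
    (fun a => 20 * ((t a + u a) * (esize a + t a + u a))).
Proof.
move=> pf qg.
pose dup := Assign (ENode EVar EVar).
pose swap := Assign (ENode (ETl EVar) (EHd EVar)).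
exists (Seq dup (Seq (onhd p) (Seq swap (Seq (onhd q) swap)))) => a.
have [s Hs le_s] := pf a; have [r Hr le_r] := qg a.
have [s' Hs' le_s'] := exec_onhd (enc a) Hs.
have [r' Hr' le_r'] := exec_onhd (enc (f a)) Hr.
eexists.
  apply: exec_seq; first exact: exec_assign.
  apply: exec_seq Hs' _.
  apply: exec_seq; first exact: exec_assign.
  by apply: exec_seq Hr' _; exact: exec_assign.
rewrite /= -!/(esize _) in le_s' le_r' *.
have: 0 < esize a by exact: tsize_gt0.
have: 0 < esize (f a) by exact: tsize_gt0.
have: 0 < esize (g a) by exact: tsize_gt0.
have [] := exec_size Hs; have [] := exec_size Hr; rewrite -!/(esize _).
move: (esize a) (esize (f a)) (esize (g a)) (t a) (u a) le_s le_r le_s' le_r'.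
clear; move=> x y z v w le_s le_r le_s' le_r' rz rx sy sx z0 y0 x0.
have E1 : s' <= v * (2 * x + 3) by apply: leq_trans le_s' _; rewrite leq_mul2r le_s orbT.
have E2 : r' <= w * (2 * y + 3) by apply: leq_trans le_r' _; rewrite leq_mul2r le_r orbT.
have E3 : w * y <= w * v by rewrite leq_mul2l; lia.
have E4 : v <= v * v by rewrite leq_pmulr //; lia.
have E5 : w <= w * w by rewrite leq_pmulr //; lia.
rewrite !mulnDr !mulnDl; rewrite !mulnDr in E1 E2.
move: E1 E2 E3 E4 E5; rewrite !(mulnC w v).
move: (v * v) (v * w) (v * x) (w * x) (w * w) (w * y).
lia.
Qed.

Lemma enc_consE (A : Type) {eA : encodable A} a (s : seq A) :
  enc (a :: s) = Node (enc a) (enc s).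
Proof. by []. Qed.

Lemma esize_cons (A : Type) {eA : encodable A} a (s : seq A) :
  esize (a :: s) = (esize a + esize s).+1.
Proof. by []. Qed.

Lemma esize_pair (A B : Type) {eA : encodable A} {eB : encodable B} (x : A * B) :
  esize x = (esize x.1 + esize x.2).+1.
Proof. by []. Qed.

Lemma size_le_esize (A : Type) {eA : encodable A} (s : seq A) : size s < esize s.
Proof. by elim: s => // a s; rewrite esize_cons /=; lia. Qed.

Lemma esize_drop (A : Type) {eA : encodable A} n (s : seq A) : esize (drop n s) <= esize s.
Proof.
elim: s n => [|a s IHs] [|n] //; rewrite esize_cons.
by have:= IHs n; rewrite drop_cons; lia.
Qed.

(** The store is [(l, (b, e))]: the rest of the list, the accumulator and a fixed environment. A
    round puts [(e, (b, a))] in the head for [p], where [a] is the next entry, and keeps the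
    shortened list and [e] in the tail. *)
Definition loop (p : prog) : prog :=
  let v := EVar in
  While (EHd v)
   (Seq (Assign (ENode (ENode (ETl (ETl v)) (ENode (EHd (ETl v)) (EHd (EHd v))))
                       (ENode (ETl (EHd v)) (ETl (ETl v)))))
   (Seq (onhd p)
        (Assign (ENode (EHd (ETl v)) (ENode (EHd v) (ETl (ETl v))))))).

Lemma exec_loop (A B E : Type) {eA : encodable A} {eB : encodable B} {eE : encodable E}
    p (st : E * (B * A) -> B) t (l : seq A) (b : B) (e : E) (M : nat) :
  runs p st t -> esize b <= M ->
  (forall l1 a l2, l = l1 ++ a :: l2 ->
     t (e, (foldl (fun b a => st (e, (b, a))) b l1, a)) <= M) ->
  exists2 s, exec (loop p) (enc (l, (b, e)))
     (enc ([::] : seq A, (foldl (fun b a => st (e, (b, a))) b l, e))) s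
     & s <= (size l).+1 * (esize l + esize e + M + 2) ^ 5.
Proof.
move=> pst; elim: l b => [|a l IHl] b Hb Hl.
  eexists; first exact: exec_while_stop.
  rewrite -/(esize _) !esize_pair /= mul1n.
  set Y := (esize _ + esize e + M + 2).
  have: Y <= Y ^ 5 by rewrite -{1}[Y]expn1 leq_pexp2l // /Y; lia.
  rewrite /Y /=; lia.
have HM := Hl [::] a l erefl; rewrite /= in HM.
have [Ha' Hb'] := runs_esize (e, (b, a)) pst.
have [] := IHl (st (e, (b, a))).
- exact: leq_trans HM.
- by move=> l1 a' l2 El; apply: (Hl (a :: l1) a' l2); rewrite El.
move=> s Hs le_s.
have [r Hr le_r] := pst (e, (b, a)).
have [r' Hr' le_r'] := exec_onhd (Node (enc l) (enc e)) Hr.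
eexists.
  apply: exec_while_step => //.
    apply: exec_seq; first exact: exec_assign.
    by apply: exec_seq Hr' _; exact: exec_assign.
  exact: Hs.
have {le_r' le_r}le_r' : r' <= M * (2 * (esize l + esize e).+1 + 3).
  apply: leq_trans le_r' _; rewrite leq_mul2r; apply/orP; right.
  exact: leq_trans HM.
rewrite /= -!/(esize _) esize_cons.
set X := (esize a + esize l).+1 + esize e + M + 2.
have {}le_s : s <= (size l).+1 * X ^ 5.
  apply: leq_trans le_s _; rewrite leq_mul2l leq_exp2r // /X; lia.
(* One round costs at most 64 X^2, and X >= 4 lets the fifth power absorb the constant. *)
have X4 : 4 * 4 * 4 * (X * X) <= X ^ 5.
  have a0: 0 < esize a by exact: tsize_gt0.
  have X4: 4 <= X by rewrite /X; lia.
  have -> : X ^ 5 = X * X * X * (X * X) by rewrite !expnS expn0 muln1 !mulnA.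
  by rewrite leq_mul // leq_mul // leq_mul.
rewrite [(size l).+2 * _]mulSn -[(_ + s)]/(_ + s).
apply: leq_add le_s; apply: leq_trans X4.
rewrite /= -!/(esize _) in Ha' Hb' *.
have Hb2 : esize (st (e, (b, a))) <= M by apply: leq_trans HM.
move: HM Ha'; rewrite !esize_pair /= => HM Ha'.
by rewrite /X; clear - le_r' Hb Hb2; nia.
Qed.
Definition polytime (A B : Type) {eA : encodable A} {eB : encodable B} (f : A -> B) : Prop :=
  exists p t, runs p f t /\ poly_bounded esize t.

(** A time bound without any restriction, for functions of the parameter alone. *)
Definition halting (A B : Type) {eA : encodable A} {eB : encodable B} (f : A -> B) : Prop :=
  exists p t, runs p f t.

Lemma pbd_esize (A B : Type) {eA : encodable A} {eB : encodable B} (f : A -> B) :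
  polytime f -> poly_bounded esize (fun a => esize (f a)).
Proof.
move=> [p [t [Hp [c Hc]]]]; exists c => a; apply: leq_trans (Hc a).
by have [] := runs_esize a Hp.
Qed.

Section Closure.

Context (A B C : Type) {eA : encodable A} {eB : encodable B} {eC : encodable C}.

Lemma pt_ext (f g : A -> B) : (forall a, f a = g a) -> polytime g -> polytime f.
Proof.
move=> fg [p [t [Hp Ht]]]; exists p, t; split=> // a; rewrite fg; exact: Hp.
Qed.

(** Programs see codes only, so the type of a result may be changed: a number has the code of a list
    of leaves, a nonempty list that of a pair. *)
Lemma pt_conv (f : A -> B) (g : A -> C) :
  (forall a, enc (f a) = enc (g a)) -> polytime g -> polytime f.
Proof.
move=> fg [p [t [Hp Ht]]]; exists p, t; split=> // a; rewrite fg; exact: Hp.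
Qed.

Fixpoint expr_size (e : expr) : nat :=
  match e with
  | ENode e1 e2 => (expr_size e1 + expr_size e2).+1
  | EHd e1 | ETl e1 => expr_size e1
  | _ => 1
  end.

Lemma tsize_eval e x : tsize (eval e x) <= expr_size e * tsize x.
Proof.
elim: e => /= [||e1 H1 e2 H2|e|e]; rewrite ?mul1n ?tsize_gt0 //.
- by have := tsize_gt0 x; lia.
- by case: (eval e x) => //= y z; lia.
- by case: (eval e x) => //= y z; lia.
Qed.

Lemma pt_expr (e : expr) (f : A -> B) :
  (forall a, eval e (enc a) = enc (f a)) -> polytime f.
Proof.
move=> Hf; exists (Assign e), (fun a => esize a + expr_size e * esize a); split=> [a|].
  exists (esize a + esize (f a)); first by rewrite /esize -Hf; apply: exec_assign.
  by rewrite leq_add2l /esize -Hf tsize_eval.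
by apply: pbd_add; [apply: pbd_id | apply: pbd_mul; [apply: pbd_const | apply: pbd_id]].
Qed.

End Closure.

Lemma pt_id (A : Type) {eA : encodable A} : polytime (fun a : A => a).
Proof. by apply: (pt_expr (e := EVar)). Qed.

Fixpoint quote (x : tree) : expr := if x is Node a b then ENode (quote a) (quote b) else ELeaf.

Lemma eval_quote x y : eval (quote x) y = x.
Proof. by elim: x => //= a -> b ->. Qed.

Lemma pt_const (A B : Type) {eA : encodable A} {eB : encodable B} (b : B) : polytime (fun _ : A => b).
Proof. by apply: (pt_expr (e := quote (enc b))) => a; apply: eval_quote. Qed.

Lemma pt_comp (A B C : Type) {eA : encodable A} {eB : encodable B} {eC : encodable C}
    (f : B -> C) (g : A -> B) : polytime g -> polytime f -> polytime (fun a => f (g a)).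
Proof.
move=> Pg [p [t [Hp Ht]]]; have Bg := pbd_esize Pg; move: Pg => [q [u [Hq Hu]]].
exists (Seq q p), (fun a => u a + t (g a)); split; first exact: runs_comp Hp.
by apply: pbd_add => //; apply: pbd_comp Ht.
Qed.

Lemma pt_pair (A B C : Type) {eA : encodable A} {eB : encodable B} {eC : encodable C}
    (f : A -> B) (g : A -> C) : polytime f -> polytime g -> polytime (fun a => (f a, g a)).
Proof.
move=> [p [t [Hp Ht]]] [q [u [Hq Hu]]].
have [r Hr] := runs_pair Hp Hq; exists r; eexists; split; first exact: Hr.
apply: pbd_mul; first exact: pbd_const.
by apply: pbd_mul; do ?apply: pbd_add => //; apply: pbd_id.
Qed.

Lemma pt_fst (A B C : Type) {eA : encodable A} {eB : encodable B} {eC : encodable C}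
    (f : A -> B * C) : polytime f -> polytime (fun a => (f a).1).
Proof. by move=> Pf; apply: (pt_comp Pf); apply: (pt_expr (e := EHd EVar)). Qed.

Lemma pt_snd (A B C : Type) {eA : encodable A} {eB : encodable B} {eC : encodable C}
    (f : A -> B * C) : polytime f -> polytime (fun a => (f a).2).
Proof. by move=> Pf; apply: (pt_comp Pf); apply: (pt_expr (e := ETl EVar)). Qed.

Lemma pt_if_pair (A B : Type) {eA : encodable A} {eB : encodable B} (f g : A -> B) :
  polytime f -> polytime g -> polytime (fun x : bool * A => if x.1 then f x.2 else g x.2).
Proof.
move=> [p [t [Hp Ht]]] [q [u [Hq Hu]]].
exists (If (EHd EVar) (Seq (Assign (ETl EVar)) p) (Seq (Assign (ETl EVar)) q)).
exists (fun x => esize x + (esize x + esize x.2 + (t x.2 + u x.2))); split=> [[[] a]|].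
- have [s Hs le_s] := Hp a; eexists.
    by apply: exec_if_true => //; apply: exec_seq; [apply: exec_assign | exact: Hs].
  by do 2 apply: leq_add => //; apply: leq_trans (leq_addr _ _).
- have [s Hs le_s] := Hq a; eexists.
    by apply: exec_if_false => //; apply: exec_seq; [apply: exec_assign | exact: Hs].
  by do 2 apply: leq_add => //; apply: leq_trans (leq_addl _ _).
have B2 : poly_bounded esize (fun x : bool * A => esize x.2).
  exact/pbd_esize/pt_snd/pt_id.
by do !apply: pbd_add; try exact: pbd_id; try exact: B2; apply: pbd_comp B2 _.
Qed.

Lemma pt_if (A B : Type) {eA : encodable A} {eB : encodable B} (b : A -> bool) (f g : A -> B) :
  polytime b -> polytime f -> polytime g -> polytime (fun a => if b a then f a else g a).
Proof.
by move=> Pb Pf Pg; apply: (pt_comp (pt_pair Pb (pt_id (A := A))) (pt_if_pair Pf Pg)).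
Qed.

Lemma esize_cat (A : Type) {eA : encodable A} (s t : seq A) :
  esize (s ++ t) = esize s + esize t - 1.
Proof.
elim: s => [|a s IHs]; first by rewrite add1n subn1.
have t0 : 0 < esize t by exact: tsize_gt0.
have s0 : 0 < esize s by exact: tsize_gt0.
by rewrite cat_cons !esize_cons IHs; lia.
Qed.

(** A polynomial-time step may square the accumulator each time, so a polynomial bound [m] on all
    accumulators that really occur has to be supplied. *)
Lemma pt_foldl (A B E : Type) {eA : encodable A} {eB : encodable B} {eE : encodable E}
    (st : E -> B -> A -> B) (l : E -> seq A) (b : E -> B) (m : E -> nat) :
  polytime (fun x : E * (B * A) => st x.1 x.2.1 x.2.2) -> polytime l -> polytime b -> poly_bounded esize m ->
  (forall e l1 l2, l e = l1 ++ l2 -> esize (foldl (st e) (b e) l1) <= m e) ->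
  polytime (fun e => foldl (st e) (b e) (l e)).
Proof.
move=> [p [t [Hp [c Hc]]]] Pl Pb Bm Hm.
have P0 := pt_pair Pl (pt_pair Pb (pt_id (A := E))).
have Bl := pbd_esize Pl.
pose st' := fun x : E * (B * A) => st x.1 x.2.1 x.2.2.
pose (M := fun e : E => m e + (esize e + m e + esize (l e) + 4) ^ c).
have BM : poly_bounded esize M.
  apply: pbd_add => //; apply/pbd_exp; do !apply: pbd_add => //; try exact: pbd_id.
  exact: pbd_const.
have [r [u [Hr Hu]]] := P0.
exists (Seq r (Seq (loop p) (Assign (EHd (ETl EVar))))).
exists (fun e => u e + 5 * ((u e).+1 * (u e + M e + 2) ^ 5)); split; last first.
  apply: pbd_add => //; apply: pbd_mul; first exact: pbd_const.
  apply: pbd_mul; first by apply: (pbd_add (pbd_const _ 1)).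
  by apply: pbd_exp; do !apply: pbd_add => //; apply: pbd_const.
move=> e; have [s Hs le_s] := Hr e.
have Hb : esize (b e) <= M e by apply: leq_trans (leq_addr _ _); apply: (Hm e [::] (l e)).
have [||w Hw le_w] := @exec_loop _ _ _ _ _ _ p st' t (l e) (b e) e (M e) Hp => //.
  move=> l1 a l2 El; apply: leq_trans (Hc _) _.
  apply: leq_trans (leq_addl _ _).
  have H1 : esize (foldl (fun b a => st' (e, (b, a))) (b e) l1) <= m e := Hm e l1 _ El.
  case: c {M BM Hc Hb} => // c; rewrite leq_exp2r //.
  rewrite !esize_pair /= El esize_cat esize_cons; lia.
have Eu := leq_trans (proj2 (exec_size Hs)) le_s.
eexists.
  apply: exec_seq; first exact: Hs.
  by apply: exec_seq; [exact: Hw | exact: exec_assign].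
rewrite /= -!/(esize _) in le_w *.
move: Eu; rewrite -/(esize _) !esize_pair /= => Eu.
have {}le_w : w <= (u e).+1 * (u e + M e + 2) ^ 5.
  apply: leq_trans le_w _; rewrite leq_mul //.
    have lt_l : size (l e) < esize (l e) by exact: size_le_esize.
    by lia.
  by rewrite leq_exp2r //; lia.
have Hw' : esize ([::] : seq A, (foldl (fun b a => st' (e, (b, a))) (b e) (l e), e)) <= w by have [] := exec_size Hw.
by move: le_w Hw'; move: (_ * _ ^ 5); rewrite !esize_pair /=; lia.
Qed.
(** * Polynomial-time operations on lists and numbers *)

Lemma enc_nseq_Leaf n : enc (nseq n Leaf) = enc n.
Proof. by elim: n => //= n IHn; rewrite enc_consE IHn. Qed.

(* Every tree is the code of a list of trees. *)
Fixpoint tree_seq (x : tree) : seq tree := if x is Node a b then a :: tree_seq b else [::].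

Lemma tree_seqK : cancel tree_seq enc.
Proof. by elim=> //= a _ b IHb; rewrite enc_consE IHb. Qed.

Section Basic.

Context (E A B : Type) {eE : encodable E} {eA : encodable A} {eB : encodable B}.

Lemma pt_cons (a : E -> A) (s : E -> seq A) : polytime a -> polytime s -> polytime (fun e => a e :: s e).
Proof. by move=> Pa Ps; apply: pt_conv (pt_pair Pa Ps). Qed.

Lemma pt_behead (s : E -> seq A) : polytime s -> polytime (fun e => behead (s e)).
Proof.
by move=> Ps; apply: (pt_comp Ps); apply: (pt_expr (e := ETl EVar)) => -[].
Qed.

Lemma pt_nat (f : E -> nat) (g : E -> seq tree) :
  (forall e, g e = nseq (f e) Leaf) -> polytime g -> polytime f.
Proof. by move=> fg Pg; apply: pt_conv Pg => e; rewrite fg enc_nseq_Leaf. Qed.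

Lemma pt_units (f : E -> nat) : polytime f -> polytime (fun e => nseq (f e) Leaf).
Proof. by move=> Pf; apply: pt_conv Pf => e; rewrite enc_nseq_Leaf. Qed.

Lemma pt_tree_seq (f : E -> tree) : polytime f -> polytime (fun e => tree_seq (f e)).
Proof. by move=> Pf; apply: pt_conv Pf => e; rewrite tree_seqK. Qed.

Lemma pt_thd (f : E -> tree) : polytime f -> polytime (fun e => thd (f e)).
Proof. by move=> Pf; apply: (pt_comp Pf); apply: (pt_expr (e := EHd EVar)). Qed.

Lemma pt_ttl (f : E -> tree) : polytime f -> polytime (fun e => ttl (f e)).
Proof. by move=> Pf; apply: (pt_comp Pf); apply: (pt_expr (e := ETl EVar)). Qed.

Lemma pt_succn (f : E -> nat) : polytime f -> polytime (fun e => (f e).+1).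
Proof.
by move=> Pf; apply: (pt_conv (g := fun e => (Leaf, f e))) => //; apply: pt_pair => //;
  apply: pt_const.
Qed.

Lemma pt_andb (b c : E -> bool) : polytime b -> polytime c -> polytime (fun e => b e && c e).
Proof. by move=> Pb Pc; apply: pt_if => //; apply: pt_const. Qed.

Lemma pt_orb (b c : E -> bool) : polytime b -> polytime c -> polytime (fun e => b e || c e).
Proof. by move=> Pb Pc; apply: pt_if => //; apply: pt_const. Qed.

Lemma pt_implyb (b c : E -> bool) : polytime b -> polytime c -> polytime (fun e => b e ==> c e).
Proof. by move=> Pb Pc; apply: pt_if => //; apply: pt_const. Qed.

Lemma pt_negb (b : E -> bool) : polytime b -> polytime (fun e => ~~ b e).
Proof. by move=> Pb; apply: pt_if => //; apply: pt_const. Qed.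

End Basic.

Definition is_node (x : tree) : bool := if x is Node _ _ then true else false.

Lemma pt_is_node E {eE : encodable E} (f : E -> tree) : polytime f -> polytime (fun e => is_node (f e)).
Proof.
move=> Pf; apply: (pt_comp Pf).
exists (If EVar (Assign (ENode ELeaf ELeaf)) (Assign ELeaf)), (fun x => 2 * esize x + 3).
split=> [x|]; last first.
  apply: (pbd_add _ (pbd_const _ 3)).
  by apply: pbd_mul; [exact: pbd_const | exact: pbd_id].
case: x => [|x y].
  by eexists; [apply: exec_if_false => //; apply: exec_assign | ].
by eexists; [apply: exec_if_true => //; apply: exec_assign | rewrite /esize /=; lia].
Qed.

Lemma foldl_consE (A B : Type) (F : A -> B) (b : seq B) (s : seq A) :
  foldl (fun b a => F a :: b) b s = rev (map F s) ++ b.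
Proof. by elim: s b => //= a s IHs b; rewrite IHs rev_cons cat_rcons. Qed.

Section Lists.

Context (E A B : Type) {eE : encodable E} {eA : encodable A} {eB : encodable B}.

Lemma pt_nilp (s : E -> seq A) : polytime s -> polytime (fun e => nilp (s e)).
Proof.
move=> Ps; apply: (pt_ext (g := fun e => ~~ is_node (enc (s e)))).
  by move=> e; case: (s e).
by apply/pt_negb/pt_is_node; apply: pt_conv Ps.
Qed.

Lemma pt_head (a : E -> A) (s : E -> seq A) :
  polytime a -> polytime s -> polytime (fun e => head (a e) (s e)).
Proof.
move=> Pa Ps.
pose (f := fun e => if nilp (s e) then enc (a e) else thd (enc (s e))).
apply: (pt_conv (g := f)).
  by move=> e; rewrite /f; case: (s e).
apply: pt_if; first exact: pt_nilp.
  exact: pt_conv Pa.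
by apply: pt_thd; apply: pt_conv Ps.
Qed.

Lemma esize_rev (s : seq A) : esize (rev s) = esize s.
Proof.
elim: s => // a s IHs; rewrite rev_cons -cats1 esize_cat IHs.
have s0 : 0 < esize s by exact: tsize_gt0.
by rewrite !esize_cons /esize /=; lia.
Qed.

Lemma pt_rev (s : E -> seq A) : polytime s -> polytime (fun e => rev (s e)).
Proof.
move=> Ps.
apply: (pt_ext (g := fun e => foldl (fun b a => a :: b) [::] (s e))).
  by move=> e; rewrite (foldl_consE id) map_id cats0.
apply: (pt_foldl (m := fun e => esize (s e))) => //.
- by apply: pt_cons; apply/pt_snd/pt_snd/pt_id || apply/pt_fst/pt_snd/pt_id.
- exact: pt_const.
- exact: pbd_esize.
move=> e l1 l2 ->; rewrite (foldl_consE id) map_id cats0 esize_rev.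
have s0 : 0 < esize l2 by exact: tsize_gt0.
by rewrite esize_cat; lia.
Qed.

Lemma pt_cat (s t : E -> seq A) : polytime s -> polytime t -> polytime (fun e => s e ++ t e).
Proof.
move=> Ps Pt.
apply: (pt_ext (g := fun e => foldl (fun b a => a :: b) (t e) (rev (s e)))).
  by move=> e; rewrite (foldl_consE id) map_id revK.
apply: (pt_foldl (m := fun e => esize (s e) + esize (t e))) => //.
- by apply: pt_cons; apply/pt_snd/pt_snd/pt_id || apply/pt_fst/pt_snd/pt_id.
- exact: pt_rev.
- by apply: pbd_add; exact: pbd_esize.
move=> e l1 l2 El; rewrite (foldl_consE id) map_id -(esize_rev (s e)) El !esize_cat esize_rev.
have s0 : 0 < esize l2 by exact: tsize_gt0.
lia.
Qed.

End Lists.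

Lemma esize_map A B {eA : encodable A} {eB : encodable B} (f : A -> B) (m : nat) (s : seq A) :
  (forall s1 a s2, s = s1 ++ a :: s2 -> esize (f a) <= m) ->
  esize (map f s) <= size s * m.+1 + 1.
Proof.
elim: s => [|a s IHs] Hm //=; rewrite esize_cons.
have H1 := Hm [::] a s erefl.
have {IHs}: esize (map f s) <= size s * m.+1 + 1.
  by apply: IHs => s1 b s2 Es; apply: (Hm (a :: s1) b s2); rewrite Es.
by rewrite mulSn; lia.
Qed.

Lemma pt_map E A B {eE : encodable E} {eA : encodable A} {eB : encodable B}
    (f : E -> A -> B) (s : E -> seq A) :
  polytime (fun x : E * A => f x.1 x.2) -> polytime s -> polytime (fun e => [seq f e a | a <- s e]).
Proof.
move=> Pf Ps.
apply: (pt_ext (g := fun e => rev (foldl (fun b a => f e a :: b) [::] (s e)))).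
  by move=> e; rewrite foldl_consE cats0 revK.
apply: pt_rev; have [c Hc] := pbd_esize Pf; have Bs := pbd_esize Ps.
apply: (pt_foldl (st := fun e b a => f e a :: b)
  (m := fun e => esize (s e) * ((esize e + esize (s e) + 3) ^ c).+1 + 1)) => //.
- apply: pt_cons; last exact/pt_fst/pt_snd/pt_id.
  apply: (pt_comp (g := fun x : E * (seq B * A) => (x.1, x.2.2))) Pf.
  by apply: pt_pair; [apply/pt_fst/pt_id | apply/pt_snd/pt_snd/pt_id].
- exact: pt_const.
- apply: (pbd_add _ (pbd_const _ 1)); apply: pbd_mul => //.
  apply: (pbd_add (pbd_const _ 1)).
  apply: pbd_exp; do !apply: pbd_add => //; last exact: pbd_const.
  exact: pbd_id.
move=> e l1 l2 El; rewrite foldl_consE cats0 esize_rev.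
have s0 : size l1 < esize l1 by exact: size_le_esize.
have s2 : 0 < esize l2 by exact: tsize_gt0.
apply: leq_trans (esize_map (m := (esize e + esize (s e) + 3) ^ c) _) _.
  move=> t1 a t2 El1; apply: leq_trans (Hc (e, a)) _.
  case: c {Hc} => // c; rewrite leq_exp2r // esize_pair /= El El1.
  rewrite !esize_cat esize_cons.
  by have s3 : 0 < esize t2; [exact: tsize_gt0 | lia].
by rewrite leq_add2r leq_mul2r El esize_cat; apply/orP; right; lia.
Qed.
Lemma nseq_catl (A : Type) n (a : A) s1 s2 : nseq n a = s1 ++ s2 -> s1 = nseq (size s1) a.
Proof. by elim: s1 n => [|b s1 IHs] [|n] //= [<- /IHs <-]. Qed.

Lemma foldl_catE (A : Type) (b : seq A) (ss : seq (seq A)) : foldl cat b ss = b ++ flatten ss.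
Proof. by elim: ss b => [|s ss IHs] b /=; rewrite ?cats0 // IHs catA. Qed.

Lemma esize_flatten A {eA : encodable A} (ss : seq (seq A)) : esize (flatten ss) <= esize ss.
Proof.
elim: ss => //= s ss IHs; rewrite esize_cat esize_cons; lia.
Qed.

Section MoreLists.

Context (E A : Type) {eE : encodable E} {eA : encodable A}.

Lemma pt_flatten (s : E -> seq (seq A)) : polytime s -> polytime (fun e => flatten (s e)).
Proof.
move=> Ps; apply: (pt_ext (g := fun e => foldl cat [::] (s e))).
  by move=> e; rewrite foldl_catE.
apply: (pt_foldl (m := fun e => esize (s e))) => //.
- by apply: pt_cat; [apply/pt_fst/pt_snd/pt_id | apply/pt_snd/pt_snd/pt_id].
- exact: pt_const.
- exact: pbd_esize.
move=> e l1 l2 ->; rewrite foldl_catE cat0s; apply: leq_trans (esize_flatten _) _.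
have s0 : 0 < esize l2 by exact: tsize_gt0.
by rewrite esize_cat; lia.
Qed.

Lemma pt_filter (p : E -> A -> bool) (s : E -> seq A) :
  polytime (fun x : E * A => p x.1 x.2) -> polytime s -> polytime (fun e => [seq a <- s e | p e a]).
Proof.
move=> Pp Ps.
apply: (pt_ext (g := fun e => flatten [seq (if p e a then [:: a] else [::]) | a <- s e])).
  by move=> e; elim: (s e) => //= a l ->; case: (p e a).
apply/pt_flatten/pt_map => //; apply: pt_if => //; last exact: pt_const.
by apply: pt_cons; [apply/pt_snd/pt_id | apply: pt_const].
Qed.

Lemma pt_has (p : E -> A -> bool) (s : E -> seq A) :
  polytime (fun x : E * A => p x.1 x.2) -> polytime s -> polytime (fun e => has (p e) (s e)).
Proof.
move=> Pp Ps; apply: (pt_ext (g := fun e => ~~ nilp [seq a <- s e | p e a])).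
  by move=> e; elim: (s e) => //= a l ->; case: (p e a).
by apply/pt_negb/pt_nilp/pt_filter.
Qed.

Lemma pt_all (p : E -> A -> bool) (s : E -> seq A) :
  polytime (fun x : E * A => p x.1 x.2) -> polytime s -> polytime (fun e => all (p e) (s e)).
Proof.
move=> Pp Ps; apply: (pt_ext (g := fun e => ~~ has (fun a => ~~ p e a) (s e))).
  by move=> e; rewrite has_predC negbK.
by apply/pt_negb/pt_has => //; apply: pt_negb.
Qed.

Lemma pt_size (s : E -> seq A) : polytime s -> polytime (fun e => size (s e)).
Proof.
move=> Ps; apply: (pt_nat (g := fun e => [seq Leaf | a <- s e])).
  by move=> e; elim: (s e) => //= a l ->.
by apply: pt_map => //; apply: pt_const.
Qed.

Lemma pt_nseq (n : E -> nat) (a : E -> A) : polytime n -> polytime a -> polytime (fun e => nseq (n e) (a e)).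
Proof.
move=> Pn Pa; apply: (pt_ext (g := fun e => [seq a e | x <- nseq (n e) Leaf])).
  by move=> e; elim: (n e) => //= m ->.
by apply: pt_map; [apply: pt_comp Pa; apply/pt_fst/pt_id | exact: pt_units].
Qed.

Lemma pt_drop (n : E -> nat) (s : E -> seq A) : polytime n -> polytime s -> polytime (fun e => drop (n e) (s e)).
Proof.
move=> Pn Ps.
have foldlE m (l : seq A) : foldl (fun b _ => behead b) l (nseq m Leaf) = drop m l.
  by elim: m l => [|m IHm] l /=; [rewrite drop0 | rewrite IHm; case: l].
apply: (pt_ext (g := fun e => foldl (fun b _ => behead b) (s e) (nseq (n e) Leaf))).
  by move=> e; rewrite foldlE.
apply: (pt_foldl (m := fun e => esize (s e))).
- exact/pt_behead/pt_fst/pt_snd/pt_id.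
- exact: pt_units.
- exact: Ps.
- exact: pbd_esize.
move=> e l1 l2 El.
rewrite (nseq_catl El).
rewrite foldlE; exact: esize_drop.
Qed.

Lemma pt_nth (d : E -> A) (s : E -> seq A) (i : E -> nat) :
  polytime d -> polytime s -> polytime i -> polytime (fun e => nth (d e) (s e) (i e)).
Proof.
move=> Pd Ps Pi; apply: (pt_ext (g := fun e => head (d e) (drop (i e) (s e)))).
  by move=> e; rewrite -nth0 nth_drop addn0.
by apply: pt_head => //; apply: pt_drop.
Qed.

End MoreLists.

Lemma esize_nat (n : nat) : esize n = n.*2.+1.
Proof. by elim: n => // n IHn; rewrite doubleS -IHn. Qed.

Section Numbers.

Context (E : Type) {eE : encodable E}.

Lemma pt_addn (m n : E -> nat) : polytime m -> polytime n -> polytime (fun e => m e + n e).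
Proof.
move=> Pm Pn; apply: (pt_nat (g := fun e => nseq (m e) Leaf ++ nseq (n e) Leaf)).
  by move=> e; rewrite nseqD.
by apply: pt_cat; apply: pt_units.
Qed.

Lemma pt_muln (m n : E -> nat) : polytime m -> polytime n -> polytime (fun e => m e * n e).
Proof.
move=> Pm Pn.
apply: (pt_nat (g := fun e => flatten [seq nseq (n e) Leaf | x <- nseq (m e) Leaf])).
  by move=> e; elim: (m e) => //= k ->; rewrite mulSn nseqD.
apply/pt_flatten/pt_map; last exact: pt_units.
by apply: pt_units; apply: pt_comp Pn; apply/pt_fst/pt_id.
Qed.

Lemma pt_subn (m n : E -> nat) : polytime m -> polytime n -> polytime (fun e => m e - n e).
Proof.
move=> Pm Pn; apply: (pt_nat (g := fun e => drop (n e) (nseq (m e) Leaf))).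
  by move=> e; rewrite drop_nseq.
by apply: pt_drop => //; apply: pt_units.
Qed.

Lemma pt_leq (m n : E -> nat) : polytime m -> polytime n -> polytime (fun e => m e <= n e).
Proof.
move=> Pm Pn; apply: (pt_ext (g := fun e => nilp (nseq (m e - n e) Leaf))).
  by move=> e; rewrite /nilp size_nseq.
by apply/pt_nilp/pt_units/pt_subn.
Qed.

Lemma pt_eqn (m n : E -> nat) : polytime m -> polytime n -> polytime (fun e => m e == n e).
Proof.
move=> Pm Pn; apply: (pt_ext (g := fun e => (m e <= n e) && (n e <= m e))).
  by move=> e; rewrite eqn_leq.
by apply: pt_andb; apply: pt_leq.
Qed.

(** The accumulator lists the numbers produced so far, so its length is the next one. *)
Lemma pt_iota0 (n : E -> nat) : polytime n -> polytime (fun e => iota 0 (n e)).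
Proof.
move=> Pn.
have foldlE k m :
    foldl (fun b _ => size b :: b) (rev (iota 0 k)) (nseq m Leaf) = rev (iota 0 (k + m)).
  elim: m k => [|m IHm] k; first by rewrite addn0.
  by rewrite /= size_rev size_iota -rev_rcons -cats1 -(iotaD 0 k 1) addn1 IHm addSnnS.
apply: (pt_ext (g := fun e => rev (foldl (fun b _ => size b :: b) [::] (nseq (n e) Leaf)))).
  by move=> e; rewrite (foldlE 0) revK.
apply: pt_rev.
apply: (pt_foldl (st := fun=> fun (b : seq nat) _ => size b :: b)
   (m := fun e => esize (n e) * (esize (n e)).+1 + 1)).
- by apply: pt_cons; [apply/pt_size|]; apply/pt_fst/pt_snd/pt_id.
- exact: pt_units.
- exact: pt_const.
- apply: (pbd_add _ (pbd_const _ 1)); apply: pbd_mul; first exact: pbd_esize.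
  by apply: (pbd_add (pbd_const _ 1)); exact: pbd_esize.
move=> e l1 l2 El.
have le_l1 : size l1 <= n e by rewrite -(size_nseq (n e) Leaf) El size_cat leq_addr.
rewrite (nseq_catl El).
rewrite (foldlE 0) add0n esize_rev -[iota _ _]map_id.
apply: leq_trans (esize_map (m := esize (n e)) _) _.
  move=> s1 k s2 Es; have: k \in iota 0 (size l1) by rewrite Es mem_cat mem_head orbT.
  by rewrite mem_iota add0n !esize_nat; lia.
by rewrite size_iota leq_add2r leq_mul2r esize_nat; apply/orP; right; lia.
Qed.

Lemma pt_eq_bool (b c : E -> bool) : polytime b -> polytime c -> polytime (fun e => b e == c e).
Proof.
move=> Pb Pc; apply: (pt_ext (g := fun e => if b e then c e else ~~ c e)).
  by move=> e; case: (b e); case: (c e).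
by apply: pt_if => //; apply: pt_negb.
Qed.

End Numbers.

Lemma pt_allpairs E A B C {eE : encodable E} {eA : encodable A} {eB : encodable B}
    {eC : encodable C} (f : E -> A -> B -> C) (s : E -> seq A) (t : E -> A -> seq B) :
  polytime (fun x : (E * A) * B => f x.1.1 x.1.2 x.2) -> polytime s ->
  polytime (fun x : E * A => t x.1 x.2) ->
  polytime (fun e => [seq f e a b | a <- s e, b <- t e a]).
Proof.
by move=> Pf Ps Pt; apply/pt_flatten/(@pt_map _ _ _ _ _ _ (fun e a => [seq f e a b | b <- t e a]))
  => //; apply: pt_map.
Qed.

Lemma pt_eq_seqn E {eE : encodable E} (s t : E -> seq nat) :
  polytime s -> polytime t -> polytime (fun e => s e == t e).
Proof.
move=> Ps Pt.
apply: (pt_ext (g := fun e => (size (s e) == size (t e)) &&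
   all (fun i => nth 0 (s e) i == nth 0 (t e) i) (iota 0 (size (s e))))).
  move=> e; apply/eqP/andP => [-> | [/eqP Est /allP H]].
    by split=> //; apply/allP=> i _.
  apply: (eq_from_nth (x0 := 0)) => // i lt_i; apply/eqP/H.
  by rewrite mem_iota.
apply: pt_andb; first by apply: pt_eqn; apply: pt_size.
apply: pt_all; last by apply/pt_iota0/pt_size.
by apply: pt_eqn; apply: pt_nth; try exact: pt_const; try exact/pt_snd/pt_id;
  [apply: pt_comp Ps | apply: pt_comp Pt]; apply/pt_fst/pt_id.
Qed.

(** * Automation: polynomial time by recursion on the form of the function *)

Ltac pt_user := fail.

(* Ltac has no second-order pattern for [if], hence the detour. *)
Ltac pt_if_step :=
  lazymatch goal with
  | |- polytime (fun e : ?T => @?h e) =>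
    let b := constr:(fun e : T => ltac:(let z := eval cbv beta in (h e) in
      match z with match ?u with true => ?v | false => ?w end => exact u end)) in
    let f := constr:(fun e : T => ltac:(let z := eval cbv beta in (h e) in
      match z with match ?u with true => ?v | false => ?w end => exact v end)) in
    let g := constr:(fun e : T => ltac:(let z := eval cbv beta in (h e) in
      match z with match ?u with true => ?v | false => ?w end => exact w end)) in
    apply (pt_if (b := b) (f := f) (g := g))
  end.

Ltac pt_hyp :=
  match goal with
  | H : polytime ?f |- polytime ?f => exact H
  | H : polytime ?f |- polytime (fun e => ?f (@?g e)) => apply (pt_comp (f := f) (g := g)); [|exact H]
  end.

Ltac pt_step :=
  cbv beta zeta;
  lazymatch goal with
  | |- polytime (fun e => e) => apply pt_id
  | |- polytime (fun e => (@?f e, @?g e)) => apply (pt_pair (f := f) (g := g))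
  | |- polytime fst => apply (pt_fst (f := fun e => e)); apply pt_id
  | |- polytime snd => apply (pt_snd (f := fun e => e)); apply pt_id
  | |- polytime (fun e => fst (@?f e)) => apply (pt_fst (f := f))
  | |- polytime (fun e => snd (@?f e)) => apply (pt_snd (f := f))
  | |- polytime (fun e => cons (@?f e) (@?g e)) => apply (pt_cons (a := f) (s := g))
  | |- polytime (fun e => cat (@?f e) (@?g e)) => apply (pt_cat (s := f) (t := g))
  | |- polytime (fun e => rev (@?f e)) => apply (pt_rev (s := f))
  | |- polytime (fun e => map (@?f e) (@?s e)) => apply (pt_map (f := f) (s := s))
  | |- polytime (fun e => filter (@?f e) (@?s e)) => apply (pt_filter (p := f) (s := s))
  | |- polytime (fun e => has (@?f e) (@?s e)) => apply (pt_has (p := f) (s := s))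
  | |- polytime (fun e => all (@?f e) (@?s e)) => apply (pt_all (p := f) (s := s))
  | |- polytime (fun e => flatten (@?s e)) => apply (pt_flatten (s := s))
  | |- polytime (fun e => allpairs_dep (@?f e) (@?s e) (@?t e)) =>
      apply (pt_allpairs (f := f) (s := s) (t := t))
  | |- polytime (fun e => nilp (@?s e)) => apply (pt_nilp (s := s))
  | |- polytime (fun e => size (@?s e)) => apply (pt_size (s := s))
  | |- polytime (fun e => nseq (@?n e) (@?s e)) => apply (pt_nseq (n := n) (a := s))
  | |- polytime (fun e => nth (@?d e) (@?s e) (@?i e)) => apply (pt_nth (d := d) (s := s) (i := i))
  | |- polytime (fun e => head (@?d e) (@?s e)) => apply (pt_head (a := d) (s := s))
  | |- polytime (fun e => drop (@?n e) (@?s e)) => apply (pt_drop (n := n) (s := s))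
  | |- polytime (fun e => iota 0 (@?n e)) => apply (pt_iota0 (n := n))
  | |- polytime (fun e => S (@?n e)) => apply (pt_succn (f := n))
  | |- polytime (fun e => addn (@?m e) (@?n e)) => apply (pt_addn (m := m) (n := n))
  | |- polytime (fun e => muln (@?m e) (@?n e)) => apply (pt_muln (m := m) (n := n))
  | |- polytime (fun e => subn (@?m e) (@?n e)) => apply (pt_subn (m := m) (n := n))
  | |- polytime (fun e => leq (@?m e) (@?n e)) => apply (pt_leq (m := m) (n := n))
  | |- polytime (fun e => @eq_op Datatypes_nat__canonical__eqtype_Equality (@?m e) (@?n e)) =>
      apply (pt_eqn (m := m) (n := n))
  | |- polytime (fun e => @eq_op Datatypes_bool__canonical__eqtype_Equality (@?m e) (@?n e)) =>
      apply (pt_eq_bool (b := m) (c := n))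
  | |- polytime (fun e => andb (@?m e) (@?n e)) => apply (pt_andb (b := m) (c := n))
  | |- polytime (fun e => orb (@?m e) (@?n e)) => apply (pt_orb (b := m) (c := n))
  | |- polytime (fun e => implb (@?m e) (@?n e)) => apply (pt_implyb (b := m) (c := n))
  | |- polytime (fun e => negb (@?m e)) => apply (pt_negb (b := m))
  | |- polytime (fun e => thd (@?m e)) => apply (pt_thd (f := m))
  | |- polytime (fun e => ttl (@?m e)) => apply (pt_ttl (f := m))
  | |- polytime (fun e => is_node (@?m e)) => apply (pt_is_node (f := m))
  | |- polytime (fun e => tree_seq (@?m e)) => apply (pt_tree_seq (f := m))
  | _ => first [simple apply pt_const | pt_hyp | pt_if_step | pt_user]
  end.

Ltac pt := repeat pt_step.

Definition seg := (nat * (nat * nat))%type.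

Lemma pt_eq_seg E {eE : encodable E} (s t : E -> seg) :
  polytime s -> polytime t -> polytime (fun e => s e == t e).
Proof.
move=> Ps Pt.
apply: (pt_ext (g := fun e => [&& (s e).1 == (t e).1, (s e).2.1 == (t e).2.1
                              & (s e).2.2 == (t e).2.2])).
  by move=> e; case: (s e) => a [b c]; case: (t e).
by pt.
Qed.

Lemma pt_mem_seg E {eE : encodable E} (s : E -> seg) (t : E -> seq seg) :
  polytime s -> polytime t -> polytime (fun e => s e \in t e).
Proof.
move=> Ps Pt.
apply: (pt_ext (g := fun e => has (fun x : seg => x == s e) (t e))).
  by move=> e; rewrite has_pred1.
by pt; apply: pt_eq_seg; pt.
Qed.

Fixpoint words (A : Type) (c : nat) (s : seq A) : seq (seq A) :=
  if c is c'.+1 then [seq a :: w | a <- s, w <- words c' s] else [:: [::]].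

(** The induction on [c] takes place outside the program: [c] is fixed, so the list of all words has
    polynomial size. *)
Lemma pt_words E A {eE : encodable E} {eA : encodable A} c (s : E -> seq A) :
  polytime s -> polytime (fun e => words c (s e)).
Proof.
elim: c E eE s => [|c IHc] E eE s Ps /=; first by pt.
by pt; apply: IHc; pt.
Qed.

Ltac pt_eqs :=
  lazymatch goal with
  | |- polytime (fun e => @eq_op _ (@?m e) (@?n e)) =>
      first [apply (pt_eq_seg (s := m) (t := n)) | apply (pt_eq_seqn (s := m) (t := n))]
  | |- polytime (fun e => (@?m e) \in (@?n e)) => apply (pt_mem_seg (s := m) (t := n))
  | |- polytime (fun e => words ?c (@?n e)) => apply (pt_words c (s := n))
  end.

Ltac pt_user ::= pt_eqs.
(** * Parameterized reductions *)

Lemma computable_comp (f F : nat -> nat) :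
  computable f -> polytime F -> computable (fun n => F (f n)).
Proof.
move=> [p Hp] [q [t [Hq _]]]; exists (Seq p q) => n.
have [s Hs] := Hp n; have [r Hr _] := Hq (f n).
by exists (s + r); apply: exec_seq Hs Hr.
Qed.

Lemma computable_halting (f : nat -> nat) : halting f -> computable f.
Proof. by move=> [p [t Hp]]; exists p => n; have [s Hs _] := Hp n; exists s. Qed.

Lemma halting_comp2 (f : nat -> nat) (G : nat * nat -> nat) :
  halting f -> polytime G -> halting (fun n => G (n, f n)).
Proof.
move=> [p [t Hp]] [q [u [Hq _]]]; have [i [v [Hi _]]] := pt_id (A := nat).
have [r Hr] := runs_pair Hi Hp.
by eexists; eexists; apply: (runs_comp Hr Hq).
Qed.

(** The code of [k] is also that of a list of [k] zeros, so iteration is a fold that ignores the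
    entries. The time is polynomial in [k + M k], hence computable as soon as [M] is. *)
Lemma runs_iter (A : Type) {eA : encodable A} p (st : A -> A) t (a0 : A) (M : nat -> nat) :
  runs p st t -> (forall k i, i <= k -> esize (iter i st a0) <= M k) ->
  (forall k i, i < k -> t (iter i st a0) <= M k) ->
  exists P c, runs P (fun k : nat => iter k st a0) (fun k => (k + M k).+2 ^ c).
Proof.
move=> Hp HM1 HM2.
pose (st' := fun x : tree * (A * nat) => st x.2.1).
pose (t' := fun x : tree * (A * nat) => esize x + esize x.2.1 + t x.2.1).
have Hp' : runs (Seq (Assign (EHd (ETl EVar))) p) st' t'.
  move=> x; have [s Hs le_s] := Hp x.2.1.
  eexists; first by apply: exec_seq; [apply: exec_assign | exact: Hs].
  by rewrite leq_add2l.
have foldlE (l : seq nat) (b : A) :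
    foldl (fun b a => st' (Leaf, (b, a))) b l = iter (size l) st b.
  by elim: l b => //= a l IHl b; rewrite IHl -iterSr.
pose (P := Seq (Assign (ENode EVar (ENode (quote (enc a0)) ELeaf)))
               (Seq (loop (Seq (Assign (EHd (ETl EVar))) p)) (Assign (EHd (ETl EVar))))).
pose (T := fun k => 100 * ((k + M k + 1) * (2 * k + 3 * M k + 8) ^ 5)).
have esize_Leaf : esize Leaf = 1 by [].
suff [c Hc] : poly_bounded (fun k => k + M k) T.
  exists P, c => k; have esize_k : esize (nseq k 0) = k.*2.+1.
    by elim: (k) => // n IHn; rewrite esize_cons IHn doubleS.
  have [|l1 a l2 El|s] := exec_loop (l := nseq k 0) (b := a0) (e := Leaf)
    (M := 3 * M k + 4) Hp'.
  - by apply: leq_trans (HM1 k 0 isT) _; lia.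
  - have lt_l1 : size l1 < k by rewrite -(size_nseq k 0) El size_cat /= addnS ltnS leq_addr.
    rewrite foldlE /t' /= !esize_pair /=.
    have := HM1 k _ (ltnW lt_l1); have := HM2 k _ lt_l1.
    have /nseqP[-> _] : a \in nseq k 0 by rewrite El mem_cat mem_head orbT.
    by rewrite esize_Leaf esize_nat; lia.
  rewrite foldlE size_nseq esize_k esize_Leaf => Hs le_s.
  have E1 : enc (nseq k 0) = enc k by elim: (k) => // n IHn; rewrite /= enc_consE IHn.
  eexists.
    apply: exec_seq; first exact: exec_assign.
    rewrite /= eval_quote -E1; apply: exec_seq; first exact: Hs.
    exact: exec_assign.
  apply: leq_trans (Hc k); rewrite /T /= eval_quote -!/(esize _) esize_nat.
  have := HM1 k k (leqnn k); have := HM1 k 0 isT => /=.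
  have : k + M k + 1 <= (k + M k + 1) * (2 * k + 3 * M k + 8) ^ 5.
    by rewrite leq_pmulr // expn_gt0 addnS.
  have : s <= (k + M k + 1) * (2 * k + 3 * M k + 8) ^ 5.
    apply: leq_trans le_s _; rewrite leq_mul //; first by lia.
    by rewrite leq_exp2r //; lia.
  by move: (_ * _ ^ 5); lia.
apply: pbd_mul; first exact: pbd_const.
apply: pbd_mul; first by apply: (pbd_add _ (pbd_const _ 1)); exact: pbd_id.
apply: pbd_exp; apply: (pbd_le (u := fun k => 3 * (k + M k) + 8)) => [k|]; first by lia.
apply: (pbd_add _ (pbd_const _ 8)); apply: pbd_mul; last exact: pbd_id.
exact: pbd_const.
Qed.

Lemma halting_iter (A : Type) {eA : encodable A} (st : A -> A) (a0 : A) :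
  halting st -> halting (fun k : nat => iter k st a0).
Proof.
move=> [p [t Hp]].
pose (M := fun k => \sum_(i < k.+1) (esize (iter i st a0) + t (iter i st a0))).
have HM k i : i <= k -> esize (iter i st a0) + t (iter i st a0) <= M k.
  move=> le_ik; rewrite /M (bigD1 (Ordinal (le_ik : i < k.+1))) //=; exact: leq_addr.
have [||P [c HP]] := runs_iter (a0 := a0) (M := M) Hp.
- by move=> k i /HM; apply: leq_trans (leq_addr _ _).
- by move=> k i /ltnW/HM; apply: leq_trans (leq_addl _ _).
by exists P; eexists; exact: HP.
Qed.

Lemma halting_pt (A B : Type) {eA : encodable A} {eB : encodable B} (f : A -> B) :
  polytime f -> halting f.
Proof. by move=> [p [t [Hp _]]]; exists p, t. Qed.

Lemma pt_expn E {eE : encodable E} (n : E -> nat) c : polytime n -> polytime (fun e => n e ^ c).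
Proof.
by move=> Pn; elim: c => [|c IHc]; [apply: pt_const | apply: (pt_ext _ (pt_muln Pn IHc)) => e;
   rewrite expnS].
Qed.

(** An FPT reduction needs a computable time bound. If one step takes time at most (s + 2)^c on size
    s, then iterating s -> (s + 2)^(c + 1) on numbers bounds all sizes and times, and this iteration
    is itself a program. *)
Lemma pt_iter_bound (A : Type) {eA : encodable A} (st : A -> A) (a0 : A) :
  polytime st ->
  exists P T, halting T /\ runs P (fun k : nat => iter k st a0) T.
Proof.
move=> [p [t [Hp [c Hc]]]].
pose (S := fun k => iter k (fun s => s.+2 ^ c.+1) (esize a0)).
have leS i k : i <= k -> S i <= S k.
  elim: k => [|k IHk]; first by case: i.
  rewrite leq_eqVlt => /predU1P[-> // | /IHk le_ik].
  apply: leq_trans le_ik _; rewrite /S /= -/(S k).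
  have : (S k).+2 ^ 1 <= (S k).+2 ^ c.+1 by rewrite leq_pexp2l.
  by rewrite expn1; lia.
have tS k : esize (iter k st a0) <= S k -> t (iter k st a0) <= S k.+1.
  move=> le_k; apply: leq_trans (Hc _) _; rewrite /S /= -/(S k).
  apply: (@leq_trans ((esize (iter k st a0)).+2 ^ c.+1)); first by rewrite leq_pexp2l.
  by rewrite leq_exp2r.
have sS k : esize (iter k st a0) <= S k.
  elim: k => // k /tS; apply: leq_trans.
  by case: (runs_esize (iter k st a0) Hp).
have [||P [d HP]] := runs_iter (a0 := a0) (M := S) Hp.
- by move=> k i le_ik; apply: leq_trans (sS i) (leS _ _ le_ik).
- by move=> k i lt_ik; apply: leq_trans (tS i (sS i)) (leS _ _ lt_ik).
exists P; eexists; split; last exact: HP.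
apply: (halting_comp2 (f := S) (G := fun x => (x.1 + x.2).+2 ^ d)) => //.
  apply: halting_iter; apply: halting_pt; apply: pt_expn; pt.
by apply: pt_expn; pt.
Qed.

(** For reductions whose only superpolynomial part is an iterate that depends on the parameter
    alone: [R] is polynomial in the instance and the iterate, and the new parameter is bounded in
    terms of the iterate. *)
Lemma fpt_reduces_iter (A : Type) {eA : encodable A} (P Q : parameterized_problem)
    (st : A -> A) (a0 : A) (R : tree * nat * A -> tree * nat) (m : A -> nat) :
  polytime st -> polytime R -> poly_bounded esize m -> (forall z, (R z).2 <= m z.2) ->
  (forall x k, P x k <-> Q (R (x, k, iter k st a0)).1 (R (x, k, iter k st a0)).2) ->
  fpt_reduces P Q.
Proof.
move=> Pst [q [u [Hq Hu]]] [d Hd] Rm PQ.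
have [p [t [Ht Hp]]] := pt_iter_bound a0 Pst.
have Hp' : runs (Seq (Assign (ETl EVar)) p)
    (fun z : tree * nat => iter z.2 st a0) (fun z => esize z + esize z.2 + t z.2).
  move=> z; have [s Hs le_s] := Hp z.2.
  by eexists; [apply: exec_seq; [apply: exec_assign | exact: Hs] | rewrite leq_add2l].
have [i [v [Hi Hv]]] := pt_id (A := (tree * nat)%type).
have [r Hr] := runs_pair Hi Hp'.
have {Hi Hr Hp'}Hall := runs_comp Hr Hq.
lazymatch type of Hall with runs _ _ ?t => set T := t in Hall end.
have [c Hc] : poly_bounded (fun z : tree * nat => esize z + t z.2) T.
  have B1 : poly_bounded (fun z : tree * nat => esize z + t z.2) (fun z => esize z).
    by apply: (pbd_le (u := fun z : tree * nat => esize z + t z.2)) (pbd_id _) => z;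
      apply: leq_addr.
  have B2 : poly_bounded (fun z : tree * nat => esize z + t z.2) (fun z => t z.2).
    by apply: (pbd_le (u := fun z : tree * nat => esize z + t z.2)) (pbd_id _) => z;
      apply: leq_addl.
  have B3 : poly_bounded (fun z : tree * nat => esize z + t z.2) (fun z => esize z.2).
    by apply: pbd_le B1 => z; rewrite esize_pair; lia.
  have Bv : poly_bounded (fun z : tree * nat => esize z + t z.2) v by apply: pbd_comp Hv.
  apply: pbd_add.
    apply: pbd_mul; first exact: pbd_const.
    by apply: pbd_mul; do !apply: pbd_add.
  apply: pbd_comp Hu; apply: (pbd_le (u := fun z => esize z + t z.2 + 1)).
    move=> z; rewrite esize_pair /=; have [_] := runs_esize z.2 Hp; lia.
  by apply: pbd_add (pbd_const _ 1); apply: pbd_add.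
(* The code of [(x, k)] has size tsize x + 2 k + 2, and tsize x + 2 k + t k + 4 <= (2 k + t k + 5)
   tsize x because tsize x >= 1. *)
exists (Seq r q), (fun k => (2 * k + t k + 5) ^ c), (fun k => (t k).+2 ^ d), c.
split.
  apply: computable_halting.
  by apply: (halting_comp2 (G := fun x => (2 * x.1 + x.2 + 5) ^ c)) => //; apply: pt_expn; pt.
split.
  apply: computable_halting.
  by apply: (halting_comp2 (G := fun x => x.2.+2 ^ d)) => //; apply: pt_expn; pt.
move=> x k; have [s Hs le_s] := Hall (x, k).
exists (R (x, k, iter k st a0)).1, (R (x, k, iter k st a0)).2, s; split; last split; last split.
- by move: Hs; rewrite /=; case: (R _).
- apply: leq_trans le_s _; apply: leq_trans (Hc _) _.
  rewrite -expnMn; case: c {Hc} => // c; rewrite leq_exp2r //.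
  rewrite esize_pair /= esize_nat; have := tsize_gt0 x.
  rewrite -/(esize x) mulnDl => x0.
  have : 2 * k + t k <= (2 * k + t k) * esize x by rewrite leq_pmulr.
  move: ((2 * k + t k) * esize x) x0; move: (esize x); lia.
- apply: leq_trans (Rm _) _; apply: leq_trans (Hd _) _ => /=.
  by case: d {Hd} => // d; rewrite leq_exp2r // !ltnS; have [_] := runs_esize k Hp.
- exact: PQ.
Qed.

(** The given polynomial-time reduction is appended to an arbitrary FPT reduction, whose output is
    no larger than its running time. Monotonicity of [m] turns k' <= g k into the bound m (g k). *)
Lemma W_hard_pt (t : nat) (P : parameterized_problem) :
  (forall d, exists (R : tree * nat -> tree * nat) (m : nat -> nat),
     [/\ polytime R, polytime m, (forall k l, k <= l -> m k <= m l), (forall x k, (R (x, k)).2 <= m k) &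
     forall x k, weighted_circuit_sat t d x k <-> P (R (x, k)).1 (R (x, k)).2]) ->
  W_hard t P.
Proof.
move=> HR Q [d [p [f [g [c [Cf [Cg Hp]]]]]]].
have [R [m [[q [u [Hq [e Hu]]]] Pm m_mono Rm HQ]]] := HR d.
exists (Seq p q), (fun k => f k + (f k).+2 ^ e), (fun k => m (g k)), (c + c * e); split.
  by apply: (computable_comp (F := fun n => n + n.+2 ^ e)) => //; pt; apply: pt_expn; pt.
split; first exact: computable_comp.
move=> x k; have [x' [k' [s [Hs [le_s [le_k' HQx]]]]]] := Hp x k.
have [r Hr le_r] := Hq (x', k').
exists (R (x', k')).1, (R (x', k')).2, (s + r); split; last split; last split.
- by apply: exec_seq; [exact: Hs | move: Hr; case: (R _)].
- have le_x' : esize (x', k') <= f k * tsize x ^ c.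
    by apply: leq_trans le_s; have [] := exec_size Hs.
  have x0 := tsize_gt0 x.
  rewrite mulnDl; apply: leq_add.
    by apply: leq_trans le_s _; rewrite leq_mul2l leq_pexp2l ?leq_addr ?orbT.
  apply: leq_trans le_r _; apply: leq_trans (Hu _) _.
  apply: (@leq_trans (((f k).+2 * tsize x ^ c) ^ e)).
    case: e {Hu} => // e; rewrite leq_exp2r //.
    have : 0 < tsize x ^ c by rewrite expn_gt0 x0.
    move: le_x'; move: (tsize x ^ c) => X; nia.
  by rewrite expnMn -expnM leq_mul2l leq_pexp2l ?leq_addl ?orbT.
- by apply: leq_trans (Rm _ _) _; apply: m_mono.
- by rewrite HQx.
Qed.
(** * The domination game *)

(* A strategy for [r] moves of Dominator is a tree with labelled slots, whose number depends on [r]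
   only.  The root holds the next move.  Below it, block 0 is a strategy for the remaining moves,
   and block [i.+1] is the one to switch to when Staller claims the label of slot [i] of block 0,
   so that none of its labels may equal that one.  A shape consists of the number of slots, the
   pairs of slots that must be labelled differently and the lists of slots whose labels, the moves
   of a complete play, must dominate. *)
Definition shape := (nat * (seq (nat * nat) * seq (seq nat)))%type.

(** The form of a strategy when Staller is to move. Slot [q] of block [b] has number [b * s + q], so
    the slots of block 0 keep their numbers. *)
Definition branching (sh : shape) : shape :=
  let s := sh.1 in
  (s + s * s,
   (flatten [seq [seq (b * s + p.1, b * s + p.2) | p <- sh.2.1] | b <- iota 0 s.+1]
    ++ [seq (i, i.+1 * s + j) | i <- iota 0 s, j <- iota 0 s],
    [seq [seq b * s + q | q <- w] | b <- iota 0 s.+1, w <- sh.2.2])).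

Definition next_shape (sh : shape) : shape :=
  let sh' := branching sh in
  (sh'.1.+1, ([seq (p.1.+1, p.2.+1) | p <- sh'.2.1],
              [seq 0 :: [seq q.+1 | q <- w] | w <- sh'.2.2])).

Definition empty_shape : shape := (0, ([::], [:: [::]])).

Definition strategy_shape (r : nat) : shape := iter r next_shape empty_shape.

Definition shape_wf (sh : shape) : Prop :=
  [/\ forall p, p \in sh.2.1 -> p.1 < sh.1 /\ p.2 < sh.1,
      forall w, w \in sh.2.2 -> {in w, forall q, q < sh.1} & sh.2.2 != [::]].

Lemma branching_wf sh : shape_wf sh -> shape_wf (branching sh).
Proof.
case: sh => s [E P] [/= HE HP P0].
have lt_blk b q : b < s.+1 -> q < s -> b * s + q < s + s * s.
  move=> le_b lt_q; have : b * s <= s * s by rewrite leq_mul2r -ltnS le_b orbT.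
  by lia.
(* The list of block numbers is made abstract below, so that simplification does not unfold it. *)
have mem_r b : (b \in iota 0 s.+1) = (b < s.+1) by rewrite mem_iota.
rewrite /branching -[(s, _).1]/s; move: (iota 0 s.+1) mem_r => r mem_r; split=> /=.
- move=> p; rewrite mem_cat => /orP[/flattenP[_ /mapP[b lt_b ->]] | /allpairsP[[i j] /=]].
    by rewrite mem_r in lt_b; case/mapP=> q /HE[q1 q2] -> /=; split; apply: lt_blk.
  rewrite !mem_iota !add0n => -[lt_i lt_j ->] /=; split; last exact: lt_blk.
  by apply: ltn_addr.
- move=> w /allpairsP[[b v] /= []]; rewrite mem_r => lt_b /HP Hv -> q.
  by case/mapP=> q' /Hv lt_q' ->; apply: lt_blk.
by case: P P0 HP => // w P _ _; case: r mem_r => // /(_ 0).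
Qed.

Lemma next_shape_wf sh : shape_wf sh -> shape_wf (next_shape sh).
Proof.
move/branching_wf; rewrite /next_shape; case: (branching sh) => s [E P] [/= HE HP P0].
split=> /=.
- by move=> p /mapP[q /HE[q1 q2] ->].
- move=> w /mapP[v /HP Hv ->] q; rewrite inE => /predU1P[-> // | /mapP[q' /Hv lt_q' ->]].
  by rewrite ltnS.
by case: P P0 {HP}.
Qed.

Lemma strategy_shape_wf r : shape_wf (strategy_shape r).
Proof.
elim: r => [|r IHr]; last exact: next_shape_wf.
by split=> // w; rewrite inE => /eqP->.
Qed.

Section GameAnalysis.

Variables (T : finType) (e : rel T) (first : player) (k : nat).

Notation turn := (dominator_turn first).
Notation dmoves := (@dominator_moves T first).
Notation dset h := [set v in dmoves h].

Lemma dmoves_rcons h v :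
  dmoves (rcons h v) = if turn (size h) then rcons (dmoves h) v else dmoves h.
Proof.
rewrite /dominator_moves size_rcons mkseqS -!cats1 mask_cat ?size_mkseq //=.
by case: (turn _); rewrite ?cats1 ?cats0.
Qed.

Lemma free_vertex (h : seq T) : uniq h -> size h < #|T| -> exists v, v \notin h.
Proof.
move=> Uh lt_h; have /existsP[v hv] : [exists v, v \notin h]; last by exists v.
rewrite -negb_forall; apply: contraTN lt_h => /forallP h_full.
rewrite -leqNgt -(card_uniqP Uh); apply/subset_leq_card/subsetP => v _; exact: h_full.
Qed.

Lemma full_board (h : seq T) v : uniq h -> size h = #|T| -> v \in h.
Proof.
move=> /card_uniqP Uh sz_h; apply: contraT => hv.
have: #|h| < #|T| by rewrite -cardsT -(cardsE (mem h)) proper_card // properEneq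
  subsetT andbT; apply: contraNneq hv => /setP/(_ v); rewrite !inE.
by rewrite Uh sz_h ltnn.
Qed.

(** Backward induction over the [m] moves left. The play runs until the board is full, but only the
    first [k] moves of Dominator count. *)
Fixpoint win (m : nat) (h : seq T) : bool :=
  if m is m'.+1 then
    if turn (size h) then [exists v, (v \notin h) && win m' (rcons h v)]
    else [forall v, (v \notin h) ==> win m' (rcons h v)]
  else dominating e [set v in take k (dmoves h)].

Lemma wins_within_win : dominator_wins_within e first k <-> win #|T| [::].
Proof.
split=> [[sigma [Lsigma Hsigma]] | win0].
  have {Hsigma}H m h : uniq h -> size h + m = #|T| -> follows first sigma h -> win m h.
    have follows_rcons h' v : follows first sigma h' -> (turn (size h') -> sigma h' = Some v) ->
        follows first sigma (rcons h' v).
      move=> Fh Hv i; rewrite size_rcons ltnS leq_eqVlt => /predU1P[-> | lt_i] Ti.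
        by rewrite -cats1 take_size_cat // Hv // onthE map_cat nth_cat size_map ltnn subnn.
      rewrite -cats1 takel_cat ?(ltnW lt_i) // -Fh //.
      by rewrite !onthE map_cat nth_cat size_map lt_i.
    elim: m h => [|m IHm] h Uh Sh Fh /=; first by apply: Hsigma => //; split=> //; rewrite -Sh addn0.
    have lt_h : size h < #|T| by rewrite -Sh addnS ltnS leq_addr.
    have Sh' v : size (rcons h v) + m = #|T| by rewrite size_rcons addSnnS.
    case: ifP => Th; last first.
      apply/forallP=> v; apply/implyP=> hv; apply: IHm => //; first by rewrite rcons_uniq hv.
      by apply: follows_rcons => //; rewrite Th.
    have [v Ev hv] := Lsigma h Uh lt_h; apply/existsP; exists v; rewrite hv /=.
    by apply: IHm => //; [rewrite rcons_uniq hv | apply: follows_rcons].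
  exact: H.
(* The second choice keeps the strategy legal in positions that are not winning. *)
pose sigma (h : seq T) := if [pick v | (v \notin h) && win (#|T| - (size h).+1) (rcons h v)] is Some v
  then Some v else [pick v | v \notin h].
exists sigma; split=> [h Uh lt_h | p [Up Sp] Fp].
  rewrite /sigma; case: pickP => [v /andP[hv _] | _]; first by exists v.
  case: pickP => [v hv | h_full]; first by exists v.
  by have [v] := free_vertex Uh lt_h; rewrite h_full.
suff H i : i <= #|T| -> win (#|T| - i) (take i p).
  by have := H #|T| (leqnn _); rewrite subnn -Sp take_size.
elim: i => [|i IHi] lt_i; first by rewrite subn0 take0.
have szi : size (take i p) = i by rewrite size_takel // Sp ltnW.
have [v Ev] : exists v, onth p i = Some v.
  by rewrite onthE; case: p Sp {Fp IHi szi Up} lt_i => [<- //|x p <- lt_i];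
   exists (nth x (x :: p) i); rewrite (nth_map x).
have Ep : take i.+1 p = rcons (take i p) v.
  case: p Ev {IHi szi Up Fp} Sp lt_i => [_ <- //|x p Ev <- lt_i].
  by rewrite (take_nth x) //; congr rcons; apply: Some_inj; rewrite -Ev onthE (nth_map x).
have pv : v \notin take i p.
  by have := take_uniq i.+1 Up; rewrite Ep rcons_uniq => /andP[].
have := IHi (ltnW lt_i); rewrite Ep -[#|T| - i]prednK ?subn_gt0 // -subnS /= szi.
case: ifP => Ti; last by move/forallP/(_ v); rewrite pv.
have := Fp i; rewrite Sp Ev => /(_ lt_i Ti); rewrite /sigma szi.
case: pickP => [w /andP[_ win_w] [->] // | no_v _ /existsP[w]].
by rewrite no_v.
Qed.

End GameAnalysis.

(** * Labelled shapes as certificates of winning positions *)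

Section Certificates.

Variables (T : finType) (e : rel T) (first : player) (k : nat).

Notation turn := (dominator_turn first).
Notation dmoves := (@dominator_moves T first).
Notation dset h := [set v in dmoves h].
Notation win := (win e first k).

Lemma dominating_sub (D D' : {set T}) : D \subset D' -> dominating e D -> dominating e D'.
Proof.
move=> sDD' /forallP domD; apply/forallP=> v; apply/orP.
have /orP[Dv | /existsP[u /andP[Du uv]]] := domD v; first by left; apply: (subsetP sDD').
by right; apply/existsP; exists u; rewrite (subsetP sDD').
Qed.

(* [lab q] is the vertex claimed in slot [q]; in a slot labelled [None] the move of Dominator is
   irrelevant. *)
Definition sat (sh : shape) (lab : nat -> option T) (D : {set T}) : Prop :=
  (forall p v, p \in sh.2.1 -> lab p.1 = Some v -> lab p.2 <> Some v) /\
  (forall w, w \in sh.2.2 -> dominating e (D :|: [set v | Some v \in map lab w])).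

Lemma sat_ext sh lab lab' (D : {set T}) :
  shape_wf sh -> (forall q, q < sh.1 -> lab q = lab' q) -> sat sh lab D -> sat sh lab' D.
Proof.
move=> [HE HP _] eq_lab [satE satP]; split=> [p v Ep | w Pw].
  by have [p1 p2] := HE p Ep; rewrite -!eq_lab //; apply: satE.
have /eq_in_map <- : {in w, lab =1 lab'} by move=> q /(HP _ Pw)/eq_lab.
exact: satP.
Qed.

Lemma sat_sub sh lab (D D' : {set T}) : D \subset D' -> sat sh lab D -> sat sh lab D'.
Proof.
move=> sDD' [satE satP]; split=> // w /satP; apply: dominating_sub.
exact: setSU.
Qed.

Lemma sat_None sh (D : {set T}) : dominating e D -> sat sh (fun=> None) D.
Proof.
move=> domD; split=> // w _; apply: dominating_sub domD; exact: subsetUl.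
Qed.

(** Some complete play exists, and its labels add nothing to [D]. *)
Lemma sat_full sh lab (D : {set T}) :
  shape_wf sh -> (forall q v, q < sh.1 -> lab q = Some v -> v \in D) ->
  sat sh lab D -> dominating e D.
Proof.
case: sh => s [E [|w P]] [/= _ HP // _] HD [_ satP].
apply: dominating_sub (satP w (mem_head _ _)).
rewrite subUset subxx; apply/subsetP=> v; rewrite inE => /mapP[q wq Ev].
by apply: (HD q); rewrite ?(HP w) ?mem_head.
Qed.

Lemma sat_branching sh lab (D : {set T}) :
  sat (branching sh) lab D <->
  (forall b, b <= sh.1 -> sat sh (fun q => lab (b * sh.1 + q)) D) /\
  (forall i j v, i < sh.1 -> j < sh.1 -> lab i = Some v -> lab (i.+1 * sh.1 + j) <> Some v).
Proof.
case: sh => s [E P]; rewrite /sat /branching.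
rewrite -![(s, _).1]/s -![(s, (E, P)).2.1]/E -![(s, (E, P)).2.2]/P.
have mem_r b : (b \in iota 0 s.+1) = (b <= s) by rewrite mem_iota ltnS.
move: (iota 0 s.+1) mem_r => r mem_r; split=> /= [[satE satP] | [Hb Hc]].
  split=> [b le_b | i j v lt_i lt_j]; last first.
    apply: (satE (i, i.+1 * s + j)); rewrite mem_cat; apply/orP; right.
    by apply/allpairsP; exists (i, j); rewrite !mem_iota.
  split=> [p v Ep | w Pw].
    apply: (satE (b * s + p.1, b * s + p.2)); rewrite mem_cat; apply/orP; left.
    apply/flattenP; exists [seq (b * s + p.1, b * s + p.2) | p <- E].
      by apply/mapP; exists b; rewrite ?mem_r.
    by apply/mapP; exists p.
  have := satP [seq b * s + q | q <- w]; rewrite -map_comp; apply.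
  by apply/allpairsP; exists (b, w); rewrite mem_r.
split=> [p v | w].
  rewrite mem_cat => /orP[/flattenP[_ /mapP[b lt_b ->]] | /allpairsP[[i j] /=]].
    by rewrite mem_r in lt_b; case/mapP=> q Eq ->; apply: (Hb b lt_b).1.
  by rewrite !mem_iota !add0n => -[lt_i lt_j ->]; apply: Hc.
case/allpairsP=> -[b u] /= []; rewrite mem_r => le_b Pu ->; rewrite -map_comp.
exact: (Hb b le_b).2.
Qed.

Lemma sat_next sh lab (D : {set T}) :
  sat (next_shape sh) lab D <->
  sat (branching sh) (fun q => lab q.+1) (D :|: [set v | lab 0 == Some v]).
Proof.
have setE w : D :|: [set v | Some v \in map lab (0 :: [seq q.+1 | q <- w])] =
    D :|: [set v | lab 0 == Some v] :|: [set v | Some v \in map (fun q => lab q.+1) w].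
  by apply/setP=> v; rewrite /= !inE -map_comp eq_sym orbA.
rewrite /next_shape; case: (branching sh) => s [E P]; split=> -[/= satE satP]; split=> /=.
- by move=> p v Ep; apply: (satE (p.1.+1, p.2.+1)); rewrite map_f.
- by move=> w Pw; rewrite -setE; apply: satP; apply: map_f.
- by move=> _ v /mapP[p Ep ->]; apply: satE.
- by move=> _ /mapP[w Pw ->]; rewrite setE; apply: satP.
Qed.

Lemma dset_take h : size (dmoves h) <= k -> [set v in take k (dmoves h)] = dset h.
Proof. by move=> le_k; rewrite take_oversize. Qed.

Lemma size_dmoves_rcons h v : size (dmoves (rcons h v)) = turn (size h) + size (dmoves h).
Proof. by rewrite dmoves_rcons; case: (turn _); rewrite ?size_rcons. Qed.

Lemma dset_rcons h v : turn (size h) -> dset (rcons h v) = dset h :|: [set v].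
Proof. by move=> Th; apply/setP=> u; rewrite dmoves_rcons Th !inE mem_rcons inE orbC. Qed.

Lemma dominating_win m h : uniq h -> size h + m = #|T| ->
  dominating e [set v in take k (dmoves h)] -> win m h.
Proof.
elim: m h => //= m IHm h Uh Sh domh.
have lt_h : size h < #|T| by rewrite -Sh addnS ltnS leq_addr.
have step v : v \notin h -> win m (rcons h v).
  move=> hv; apply: IHm; first by rewrite rcons_uniq hv.
    by rewrite size_rcons addSnnS.
  apply: dominating_sub domh; apply/subsetP=> u; rewrite !inE dmoves_rcons.
  case: ifP => // _; rewrite -cats1 take_cat; case: ltnP => // le_k.
  by rewrite take_oversize // mem_cat => ->.
case: ifP => _; last by apply/forallP=> v; apply/implyP/step.
by have [v hv] := free_vertex Uh lt_h; apply/existsP; exists v; rewrite hv step.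
Qed.

(** Staller owns no label. Labels already claimed by Dominator are allowed, since her spare moves
    may hit them. *)
Definition avoids (s : nat) (lab : nat -> option T) (h : seq T) : Prop :=
  forall q v, q < s -> lab q = Some v -> v \in h -> v \in dmoves h.

Lemma avoids_full sh lab h : shape_wf sh -> uniq h -> size h = #|T| -> size (dmoves h) <= k ->
  sat sh lab (dset h) -> avoids sh.1 lab h -> dominating e [set v in take k (dmoves h)].
Proof.
move=> wf_sh Uh Sh le_k sat_h av_h; rewrite dset_take //.
apply: sat_full sat_h => // q v lt_q /av_h; rewrite inE; apply=> //.
exact: full_board.
Qed.

(** Dominator claims the root label and keeps the strategy below it. After a move of Staller she
    switches to a block without the claimed vertex, so that no label is ever lost to Staller. *)
Lemma sat_win m h r lab :
  uniq h -> size h + m = #|T| -> size (dmoves h) + r <= k ->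
  let sh := if turn (size h) then strategy_shape r else branching (strategy_shape r) in
  sat sh lab (dset h) -> avoids sh.1 lab h -> win m h.
Proof.
elim: m h r lab => [|m IHm] h r lab Uh Sh le_k sh sat_h av_h.
  have wf_sh : shape_wf sh.
    rewrite /sh; case: ifP => _; first exact: strategy_shape_wf.
    exact/branching_wf/strategy_shape_wf.
  rewrite addn0 in Sh; apply: avoids_full sat_h av_h => //.
  exact: leq_trans (leq_addr _ _) le_k.
have lt_h : size h < #|T| by rewrite -Sh addnS ltnS leq_addr.
have Sh' v : size (rcons h v) + m = #|T| by rewrite size_rcons addSnnS.
have Uh' v : v \notin h -> uniq (rcons h v) by rewrite rcons_uniq => ->.
have oddS v : turn (size (rcons h v)) = ~~ turn (size h).
  by rewrite size_rcons /dominator_turn; case: (first) => //=; rewrite negbK.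
rewrite {}/sh in sat_h av_h; rewrite /=; case: ifP => Th; rewrite Th in sat_h av_h.
  case: r le_k sat_h av_h => [|r] le_k.
    case=> _ /(_ [::]); rewrite mem_seq1 eqxx => /(_ isT) dom_h _.
    have := @dominating_win m.+1 h Uh Sh; rewrite /= Th; apply.
    rewrite addn0 in le_k; rewrite dset_take //; apply: dominating_sub dom_h.
    by rewrite subUset subxx; apply/subsetP=> v; rewrite inE.
  move=> /sat_next sat_h av_h.
  (* If the root has no label, or its label is claimed already (necessarily by Dominator), any free
     vertex will do. *)
  have [v hv Hv] : exists2 v, v \notin h & forall u, lab 0 = Some u -> (u == v) || (u \in dmoves h).
    case E0: (lab 0) => [u|]; last by have [v hv] := free_vertex Uh lt_h; exists v.
    have [hu|hu] := boolP (u \in h); last by exists u => // _ [<-]; rewrite eqxx.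
    have [v hv] := free_vertex Uh lt_h; exists v => // _ [<-].
    by rewrite (av_h 0 u) ?orbT.
  apply/existsP; exists v; rewrite hv /=.
  apply: (IHm _ r (fun q => lab q.+1)) => //; rewrite ?oddS ?Th /=.
  - exact: Uh'.
  - by rewrite size_dmoves_rcons Th; lia.
  - apply: sat_sub sat_h; rewrite dset_rcons // subUset subsetUl /=.
    apply/subsetP=> u; rewrite !inE => /eqP/Hv; by rewrite orbC.
  move=> q u lt_q Eu; rewrite mem_rcons dmoves_rcons Th mem_rcons !inE => /predU1P[-> | hu].
    by rewrite eqxx.
  by rewrite (av_h q.+1) ?orbT.
move/sat_branching: sat_h => [Hb Hc].
apply/forallP=> v; apply/implyP=> hv.
have E' : dmoves (rcons h v) = dmoves h by rewrite dmoves_rcons Th.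
set s := (strategy_shape r).1 in Hb Hc.
(* If [v] labels slot [i] of block 0, the inequalities keep it out of block [i.+1]; otherwise block
   0 itself is free of [v]. *)
have [b le_b Hbv] : exists2 b, b <= s & forall q, q < s -> lab (b * s + q) <> Some v.
  have [/existsP[i /eqP Ei] | no_i] := boolP [exists i : 'I_s, lab i == Some v].
    by exists i.+1 => // q lt_q; apply: Hc Ei.
  exists 0 => // q lt_q Eq; case/existsP: no_i; exists (Ordinal lt_q).
  by rewrite -Eq.
apply: (IHm _ r (fun q => lab (b * s + q))) => //; rewrite ?oddS ?Th /= ?E' //.
- exact: Uh'.
- exact: Hb.
move=> q u lt_q Eu; rewrite mem_rcons E' inE => /predU1P[Euv | hu].
  by case: (Hbv q lt_q); rewrite Eu Euv.
apply: (av_h (b * s + q)) => //; rewrite /= -/s.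
have : b * s <= s * s by rewrite leq_mul2r le_b orbT.
by lia.
Qed.

(** Further moves do not change the first [k] moves of Dominator, so any winning continuation shows
    that these dominate already. *)
Lemma win_exhausted m h : uniq h -> size h + m = #|T| -> k <= size (dmoves h) ->
  win m h -> dominating e [set v in take k (dmoves h)].
Proof.
elim: m h => //= m IHm h Uh Sh le_k win_h.
have lt_h : size h < #|T| by rewrite -Sh addnS ltnS leq_addr.
have [v hv win_v] : exists2 v, v \notin h & win m (rcons h v).
  move: win_h; case: ifP => _; first by move=> /existsP[v /andP[hv win_v]]; exists v.
  by have [v hv] := free_vertex Uh lt_h; move=> /forallP/(_ v); rewrite hv; exists v.
have := IHm (rcons h v); rewrite rcons_uniq hv Uh size_rcons addSnnS size_dmoves_rcons.
move=> /(_ isT Sh (leq_trans le_k (leq_addl _ _)) win_v).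
by rewrite dmoves_rcons; case: ifP => // _; rewrite -cats1 takel_cat.
Qed.

(** The labels are also kept outside [h]: for the history extended by a move of Staller, this gives
    the inequalities required by [branching]. Once [D] dominates, or no counted move is left, all
    slots stay unlabelled. *)
Lemma win_sat m h r :
  uniq h -> size h + m = #|T| -> size (dmoves h) + r = k -> win m h ->
  let sh := if turn (size h) then strategy_shape r else branching (strategy_shape r) in
  exists2 lab, sat sh lab (dset h) & forall q v, lab q = Some v -> v \notin h.
Proof.
elim: m h r => [|m IHm] h r Uh Sh Ek win_h sh.
  exists (fun=> None) => //; apply: sat_None.
  by rewrite -dset_take // -Ek leq_addr.
have lt_h : size h < #|T| by rewrite -Sh addnS ltnS leq_addr.
have Sh' v : size (rcons h v) + m = #|T| by rewrite size_rcons addSnnS.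
have Uh' v : v \notin h -> uniq (rcons h v) by rewrite rcons_uniq => ->.
have oddS v : turn (size (rcons h v)) = ~~ turn (size h).
  by rewrite size_rcons /dominator_turn; case: (first) => //=; rewrite negbK.
rewrite {}/sh; case: ifP => Th; move: (win_h); rewrite /= Th.
  case: r Ek => [|r] Ek win_v.
    exists (fun=> None) => //; apply: sat_None.
    rewrite addn0 in Ek; rewrite -dset_take ?Ek //; apply: win_exhausted win_h => //.
    by rewrite Ek.
  case/existsP: win_v => v /andP[hv win_v].
  have [|lab] := IHm (rcons h v) r (Uh' v hv) (Sh' v) _ win_v.
    by rewrite size_dmoves_rcons Th; lia.
  rewrite oddS Th /= => sat_v lab_v.
  exists (fun q => if q is q'.+1 then lab q' else Some v).
    apply/sat_next; apply: sat_sub sat_v; rewrite dset_rcons // setUS //.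
    by apply/subsetP=> u; rewrite !inE => /eqP->.
  case=> [|q] u; first by case=> <-.
  by move=> /lab_v; rewrite mem_rcons inE negb_or => /andP[].
move=> /forallP win_v.
have /fin_all_exists[lab Hlab] : forall v, exists lab, v \notin h ->
    sat (strategy_shape r) lab (dset h) /\ forall q u, lab q = Some u -> u \notin rcons h v.
  move=> v; have [hv|hv] := boolP (v \in h); first by exists (fun=> None).
  have := win_v v; rewrite hv => /= win_v'.
  have [|lab] := IHm (rcons h v) r (Uh' v hv) (Sh' v) _ win_v'.
    by rewrite size_dmoves_rcons Th.
  by rewrite oddS Th /= dmoves_rcons Th => sat_v lab_v; exists lab.
have [u0 hu0] := free_vertex Uh lt_h.
set s := (strategy_shape r).1.
(* [lab v] is a certificate for the position after Staller claims [v]. Block 0 answers an arbitrary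
   free vertex [u0]; block [i.+1] answers the label of slot [i] of block 0, or repeats block 0 if
   there is none. *)
pose pick_lab b := if b is i.+1 then (if lab u0 i is Some v then lab v else lab u0) else lab u0.
have pickP b : exists2 v, v \notin h & pick_lab b = lab v.
  case: b => [|i] /=; first by exists u0.
  case E: (lab u0 i) => [v|]; last by exists u0.
  exists v => //; have [_ /(_ i v E)] := Hlab u0 hu0.
  by rewrite mem_rcons inE negb_or => /andP[].
exists (fun q => pick_lab (q %/ s) (q %% s)); last first.
  move=> q v; have [u hu ->] := pickP (q %/ s) => Ev.
  by have [_ /(_ _ _ Ev)] := Hlab u hu; rewrite mem_rcons inE negb_or => /andP[].
have blk b q : q < s -> pick_lab ((b * s + q) %/ s) ((b * s + q) %% s) = pick_lab b q.
  move=> lt_q; have s0 : 0 < s by apply: leq_ltn_trans lt_q.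
  by rewrite divnMDl // divn_small // addn0 modnMDl modn_small.
apply/sat_branching; rewrite -/s; split=> [b le_b | i j v lt_i lt_j].
  have [v hv Ev] := pickP b; have [sat_v _] := Hlab v hv.
  apply: sat_ext sat_v; first exact: strategy_shape_wf.
  by move=> q lt_q; rewrite blk // Ev.
rewrite blk // -[i]add0n -[0](mul0n s) blk //= => Ei.
rewrite Ei => Ev; have hv : v \notin h.
  by have [_ /(_ _ _ Ei)] := Hlab u0 hu0; rewrite mem_rcons inE negb_or => /andP[].
by have [_ /(_ _ _ Ev)] := Hlab v hv; rewrite mem_rcons inE eqxx.
Qed.

Lemma wins_within_sat : dominator_wins_within e first k <->
  exists lab, sat (if first is Dominator then strategy_shape k else branching (strategy_shape k))
                  lab set0.
Proof.
have turn0 (A : Type) (x y : A) : (if turn 0 then x else y) = if first is Dominator then x else y.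
  by case: (first).
have dset0 : dset [::] = set0 by apply/setP=> v; rewrite !inE.
rewrite wins_within_win; split=> [win0 | [lab sat0]].
  have [||||lab] := @win_sat #|T| [::] k => //; rewrite /= turn0 dset0 => sat_lab _.
  by exists lab.
by apply: (@sat_win _ [::] k lab) => //; rewrite /= turn0 ?dset0.
Qed.

End Certificates.
(** * Decoding circuits *)

Definition dec_nat (x : tree) : nat := size (tree_seq x).

Definition dec_gate (x : tree) : gate :=
  if ~~ is_node (thd x) then Not (dec_nat (ttl x))
  else if ~~ is_node (ttl (thd x)) then And (map dec_nat (tree_seq (ttl x)))
  else Or (map dec_nat (tree_seq (ttl x))).

Definition dec_circuit (x : tree) : circuit :=
  Circuit (dec_nat (thd x)) (map dec_gate (tree_seq (thd (ttl x)))) (dec_nat (ttl (ttl x))).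

Lemma enc_natK : cancel enc_nat dec_nat.
Proof. by rewrite /dec_nat; elim=> //= n ->. Qed.

Lemma enc_seqK A (encA : A -> tree) decA :
  cancel encA decA -> cancel (enc_seq encA) (fun x => map decA (tree_seq x)).
Proof. by move=> AK; elim=> //= a s ->; rewrite AK. Qed.

Lemma enc_gateK : cancel enc_gate dec_gate.
Proof.
by case=> [i|s|s]; rewrite /dec_gate /= ?enc_natK // (enc_seqK enc_natK).
Qed.

Lemma enc_circuitK : cancel enc_circuit dec_circuit.
Proof.
by case=> i g o; rewrite /dec_circuit /= !enc_natK (enc_seqK enc_gateK).
Qed.

(** * Circuits of conjunctive normal forms *)

(* The literals are nodes: input [i] and its negation [I + i]. *)
Definition cnf_circuit (I : nat) (cls : seq (seq nat)) : circuit :=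
  Circuit I ([seq Not i | i <- iota 0 I] ++ [seq Or c | c <- cls]
             ++ [:: And [seq I + I + j | j <- iota 0 (size cls)]]) (I + I + size cls).

Lemma node_labels_cat A (step : seq A -> gate -> A) ins gs gs' :
  node_labels step ins (gs ++ gs') = node_labels step (node_labels step ins gs) gs'.
Proof. exact: foldl_cat. Qed.

Lemma node_labels_map A (B : eqType) (step : seq A -> gate -> A) ins (g : B -> gate) (f : B -> A) s :
  {in s, forall b ws, step (ins ++ ws) (g b) = f b} ->
  node_labels step ins (map g s) = ins ++ map f s.
Proof.
move=> step_f; rewrite -[in LHS](cats0 ins).
suff H s' ws : {subset s' <= s} ->
    node_labels step (ins ++ ws) (map g s') = ins ++ ws ++ map f s'.
  by rewrite H.
elim: s' ws => [|b s' IHs] ws sub_s /=; first by rewrite cats0.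
rewrite step_f ?sub_s ?mem_head // rcons_cat IHs ?cat_rcons //.
by move=> x s'x; rewrite sub_s // inE s'x orbT.
Qed.

Section CNF.

Variables (I : nat) (cls : seq (seq nat)).

(** Stated for any labelling, since values and path weights of the circuit are both obtained from
    it. *)
Lemma cnf_labels A (step : seq A -> gate -> A) (d : A) ins (fN : nat -> A) (fO : seq nat -> A) :
  size ins = I ->
  {in iota 0 I, forall i ws, step (ins ++ ws) (Not i) = fN i} ->
  {in cls, forall c ws, step ((ins ++ map fN (iota 0 I)) ++ ws) (Or c) = fO c} ->
  nth d (node_labels step ins (gates (cnf_circuit I cls))) (output (cnf_circuit I cls)) =
  step ((ins ++ map fN (iota 0 I)) ++ map fO cls)
       (And [seq I + I + j | j <- iota 0 (size cls)]).
Proof.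
move=> sz_ins HN HO; rewrite !node_labels_cat (node_labels_map HN) (node_labels_map HO) /=.
by rewrite nth_rcons !size_cat !size_map size_iota sz_ins ltnn eqxx.
Qed.

Lemma cnf_value a : size a = I ->
  {in cls, forall c, all (fun l => l < I + I) c} ->
  circuit_value (cnf_circuit I cls) a = all (has (nth false (a ++ map negb a))) cls.
Proof.
move=> sz_a lt_cls; rewrite /circuit_value.
have Ea : map negb a = [seq ~~ nth false a i | i <- iota 0 I].
  by rewrite -{1}[a](mkseq_nth false) sz_a /mkseq -map_comp.
rewrite (@cnf_labels _ gate_value _ _ (fun i => ~~ nth false a i)
          (has (nth false (a ++ map negb a)))) // -?Ea.
- rewrite /gate_value all_map -[in RHS](mkseq_nth [::] cls) /mkseq all_map.
  apply: eq_in_all => j; rewrite mem_iota /= add0n => lt_j /=.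
  rewrite nth_cat size_cat size_map sz_a ltnNge leq_addr /= addKn.
  by rewrite (nth_map [::]).
- by move=> i; rewrite mem_iota /= add0n => lt_i ws /=; rewrite nth_cat sz_a lt_i.
move=> c /lt_cls/allP lt_c ws /=; apply: eq_in_has => l /lt_c lt_l.
by rewrite nth_cat size_cat size_map sz_a lt_l.
Qed.

Lemma cnf_weight w wN wO : (forall i, w (Not i) <= wN) -> (forall c, w (Or c) <= wO) ->
  {in cls, forall c, all (fun l => l < I + I) c} ->
  max_path_weight w (cnf_circuit I cls) <=
    w (And [seq I + I + j | j <- iota 0 (size cls)]) + (wO + wN).
Proof.
move=> HwN HwO lt_cls; rewrite /max_path_weight.
set step := (fun vs g => _).
pose L1 := nseq I 0 ++ [seq w (Not i) | i <- iota 0 I].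
rewrite (@cnf_labels _ step _ _ (fun i => w (Not i))
          (fun c => w (Or c) + \max_(l <- c) nth 0 L1 l)).
- rewrite leq_add2l; apply/bigmax_leqP_seq => l /mapP[j]; rewrite mem_iota /= add0n => lt_j -> _.
  rewrite nth_cat size_cat size_map size_nseq size_iota ltnNge leq_addr /= addKn.
  rewrite (nth_map [::]) // leq_add //; apply/bigmax_leqP_seq => i _ _.
  rewrite nth_cat size_nseq; case: ltnP => le_i; first by rewrite nth_nseq le_i.
  have [lt_i|ge_i] := ltnP (i - I) I; last by rewrite nth_default // size_map size_iota.
  by rewrite (nth_map 0) ?size_iota.
- by rewrite size_nseq.
- move=> i; rewrite mem_iota /= add0n => lt_i ws; rewrite /step /= big_seq1.
  by rewrite nth_cat size_nseq lt_i nth_nseq lt_i addn0.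
move=> c /lt_cls/allP lt_c ws; rewrite /step /=; congr (_ + _).
apply: eq_big_seq => l /lt_c lt_l.
by rewrite nth_cat size_cat size_map size_nseq size_iota lt_l.
Qed.

Lemma cnf_wf : {in cls, forall c, all (fun l => l < I + I) c} -> circuit_wf (cnf_circuit I cls).
Proof.
move=> lt_cls; rewrite /circuit_wf /= !size_cat !size_map size_iota /= -addnA addnA.
rewrite ltn_add2l addn1 ltnSn andbT; apply/allP=> j; rewrite mem_iota /= add0n => lt_j.
rewrite nth_cat size_map size_iota; case: ltnP => [lt_jI | le_Ij].
  by rewrite (nth_map 0) ?size_iota // nth_iota //= andbT ltn_addr.
rewrite nth_cat size_map; case: ltnP => [lt_jc | le_jc].
  rewrite (nth_map [::]) //=; apply: sub_all (lt_cls _ (mem_nth _ lt_jc)) => l.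
  by move/leq_trans; apply; rewrite leq_add2l.
have -> : j - I - size cls = 0 by lia.
rewrite /= all_map; apply/allP=> i; rewrite mem_iota add0n /= => lt_i; lia.
Qed.

Lemma cnf_circuit_sat k : {in cls, forall c, all (fun l => l < I + I) c} ->
  weighted_circuit_sat 2 3 (enc_circuit (cnf_circuit I cls)) k <->
  exists a, [/\ size a = I, count id a = k & all (has (nth false (a ++ map negb a))) cls].
Proof.
move=> lt_cls; split.
  case=> C [/(can_inj enc_circuitK) <- [_ [_ [_ [a [sz_a [Ek]]]]]]].
  by rewrite cnf_value // => sat_a; exists a.
case=> a [sz_a Ek sat_a]; exists (cnf_circuit I cls); split=> //.
split; first exact: cnf_wf.
split.
  (* A negation is never large, so a path meets at most two large gates. *)
  apply: leq_trans (@cnf_weight _ 0 1 _ _ lt_cls) _ => // [c|]; first by case: (large _).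
  by rewrite addn0 addn1 !ltnS leq_b1.
split; first by apply: leq_trans (@cnf_weight _ 1 1 _ _ lt_cls) _.
by exists a; rewrite cnf_value.
Qed.

End CNF.
Lemma mem_iota0 i n : (i \in iota 0 n) = (i < n).
Proof. by rewrite mem_iota. Qed.

(** * Strategies as satisfying assignments *)

Definition adj (M : seq (seq bool)) (u v : nat) : bool := nth false (nth [::] M u) v.

(* Slot [q] is labelled [v] iff input [q * N + v] is set, where [n < N]; the label [n] stands
   for [None]. *)
Definition strategy_clauses (n N : nat) (M : seq (seq bool)) (sh : shape) : seq (seq nat) :=
  [seq [seq q * N + v | v <- iota 0 N] | q <- iota 0 sh.1] ++
  [seq [:: sh.1 * N + (q * N + x.1); sh.1 * N + (q * N + x.2)]
     | q <- iota 0 sh.1,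
       x <- [seq x <- [seq (v, w) | v <- iota 0 N, w <- iota 0 N] | x.1 != x.2]] ++
  [seq [:: sh.1 * N + (p.1 * N + v); sh.1 * N + (p.2 * N + v)]
     | p <- sh.2.1, v <- iota 0 n] ++
  [seq [seq q * N + u | q <- w, u <- [seq u <- iota 0 n | (u == v) || adj M u v]]
     | w <- sh.2.2, v <- iota 0 n].

Section StrategyClauses.

Variables (n N : nat) (M : seq (seq bool)) (sh : shape).
Hypothesis lt_nN : n < N.
Hypothesis sh_wf : shape_wf sh.

Let I := sh.1 * N.

Let var_lt q v : q < sh.1 -> v < N -> q * N + v < I.
Proof.
move=> lt_q lt_v; apply: (@leq_trans (q.+1 * N)); last by rewrite leq_mul2r lt_q orbT.
by rewrite mulSn addnC ltn_add2r.
Qed.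

Lemma strategy_clauses_lt : {in strategy_clauses n N M sh, forall c, all (fun l => l < I + I) c}.
Proof.
have [HE HP _] := sh_wf; have ltI x : x < I -> x < I + I by apply: ltn_addr.
move=> c; rewrite !mem_cat => /or4P[] => [/mapP[q]|/allpairsP[[q x] /= []]|
   /allpairsP[[p v] /= []]|/allpairsP[[w v] /= []]].
- rewrite mem_iota0 => lt_q ->; rewrite all_map; apply/allP=> v.
  by rewrite mem_iota0 => lt_v; apply/ltI/var_lt.
- rewrite mem_iota0 mem_filter => lt_q /andP[_ /allpairsP[[v w] /= []]].
  rewrite !mem_iota0 => lt_v lt_w -> -> /=.
  by rewrite -/I !ltn_add2l !var_lt.
- move=> /HE[p1 p2]; rewrite mem_iota0 => lt_v ->.
  by rewrite /= -/I !ltn_add2l !var_lt // (ltn_trans lt_v).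
move=> /HP Hw; rewrite mem_iota0 => lt_v ->; apply/allP=> l.
case/allpairsP=> -[q u] /= [/Hw lt_q]; rewrite mem_filter mem_iota0 => /andP[_ lt_u] ->.
by apply/ltI/var_lt => //; apply: ltn_trans lt_nN.
Qed.

Section Assignment.

Variable a : seq bool.
Hypothesis sz_a : size a = I.

Let tr q v := nth false a (q * N + v).
Let val l := nth false (a ++ map negb a) l.

Let val_pos q v : q < sh.1 -> v < N -> val (q * N + v) = tr q v.
Proof. by move=> lt_q lt_v; rewrite /val nth_cat sz_a var_lt. Qed.

Let val_neg q v : q < sh.1 -> v < N -> val (I + (q * N + v)) = ~~ tr q v.
Proof.
move=> lt_q lt_v; rewrite /val nth_cat sz_a ltnNge leq_addr addKn.
by rewrite (nth_map false) // sz_a var_lt.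
Qed.

(** The first two conditions make the label of a slot a function. The other two range over labels
    below [n], so the label [n] neither conflicts nor dominates, as befits [None]. *)
Lemma strategy_clausesP :
  all (has val) (strategy_clauses n N M sh) <->
  [/\ forall q, q < sh.1 -> exists2 v, v < N & tr q v,
      forall q v w, q < sh.1 -> v < N -> w < N -> tr q v -> tr q w -> v = w,
      forall p v, p \in sh.2.1 -> v < n -> tr p.1 v -> ~~ tr p.2 v &
      forall w v, w \in sh.2.2 -> v < n ->
        exists q u, [/\ q \in w, u < n, (u == v) || adj M u v & tr q u]].
Proof.
have [HE HP _] := sh_wf.
rewrite !all_cat; split.
  case/and4P=> /allP H1 /allP H2 /allP H3 /allP H4; split.
  - move=> q lt_q; have /H1/hasP[l /mapP[v]] :
      [seq q * N + v | v <- iota 0 N] \in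
      [seq [seq q * N + v | v <- iota 0 N] | q <- iota 0 sh.1].
      by apply: map_f; rewrite mem_iota0.
    by rewrite mem_iota0 => lt_v ->; rewrite val_pos //; exists v.
  - move=> q v w lt_q lt_v lt_w tv tw; apply/eqP/negPn/negP => neq_vw.
    have /H2 : [:: I + (q * N + v); I + (q * N + w)] \in
      [seq [:: sh.1 * N + (q * N + x.1); sh.1 * N + (q * N + x.2)]
     | q <- iota 0 sh.1,
       x <- [seq x <- [seq (v, w) | v <- iota 0 N, w <- iota 0 N] | x.1 != x.2]].
      apply/allpairsP; exists (q, (v, w)) => /=; split=> //; first by rewrite mem_iota0.
      rewrite mem_filter /= neq_vw; apply/allpairsP; exists (v, w).
      by rewrite !mem_iota0.
    by rewrite /= !val_neg // tv tw.
  - move=> p v Ep lt_v tv; have [p1 p2] := HE p Ep.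
    have /H3 : [:: I + (p.1 * N + v); I + (p.2 * N + v)] \in
      [seq [:: sh.1 * N + (p.1 * N + v); sh.1 * N + (p.2 * N + v)]
     | p <- sh.2.1, v <- iota 0 n].
      by apply/allpairsP; exists (p, v); rewrite mem_iota0.
    by rewrite /= !val_neg ?(ltn_trans lt_v lt_nN) // tv orbF.
  move=> w v Pw lt_v; set c := [seq q * N + u | q <- w,
     u <- [seq u <- iota 0 n | (u == v) || adj M u v]].
  have /H4/hasP[l /allpairsP[[q u] /= [wq]]] : c \in
    [seq [seq q * N + u | q <- w, u <- [seq u <- iota 0 n | (u == v) || adj M u v]]
     | w <- sh.2.2, v <- iota 0 n].
    by apply/allpairsP; exists (w, v); rewrite mem_iota0.
  rewrite mem_filter mem_iota0 => /andP[Huv lt_u] -> tu; exists q, u; split=> //.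
  by rewrite -val_pos // ?(HP w) // (ltn_trans lt_u).
case=> H1 H2 H3 H4; apply/and4P; split; apply/allP=> c.
- case/mapP=> q; rewrite mem_iota0 => lt_q ->; rewrite has_map.
  have [v lt_v tv] := H1 q lt_q; apply/hasP; exists v; first by rewrite mem_iota0.
  by rewrite /= val_pos.
- case/allpairsP=> -[q x] /= []; rewrite mem_iota0 mem_filter => lt_q.
  move=> /andP[neq_x /allpairsP[[v w] /= []]]; rewrite !mem_iota0 => lt_v lt_w.
  move=> Ex -> /=; rewrite {x}Ex /= in neq_x *; rewrite !val_neg // orbF -negb_and.
  by apply: contra neq_x => /andP[tv tw]; apply/eqP/(H2 q).
- case/allpairsP=> -[p v] /= [Ep]; rewrite mem_iota0 => lt_v ->.
  have [p1 p2] := HE p Ep; rewrite /= !val_neg ?(ltn_trans lt_v lt_nN) // orbF -implybE.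
  exact/implyP/H3.
case/allpairsP=> -[w v] /= [Pw]; rewrite mem_iota0 => lt_v ->.
have [q [u [wq lt_u Huv tu]]] := H4 w v Pw lt_v; apply/hasP.
exists (q * N + u); last by rewrite val_pos ?(HP w) // (ltn_trans lt_u).
by apply/allpairsP; exists (q, u); rewrite mem_filter mem_iota0 Huv.
Qed.

End Assignment.

(** Each block of [N] consecutive inputs contains exactly one true input. *)
Lemma count_slots (lv : nat -> nat) s : (forall q, lv q < N) ->
  count id (mkseq (fun x => x %% N == lv (x %/ N)) (s * N)) = s.
Proof.
move=> lt_lv; rewrite /mkseq count_map; elim: s => [|s IHs]; first by rewrite mul0n.
rewrite mulSnr iotaD count_cat IHs add0n -[in RHS]addn1; congr (_ + _).
rewrite -(addn0 (s * _)) iotaDl count_map.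
rewrite (@eq_in_count _ _ (pred1 (lv s))) => [|x]; last first.
  rewrite mem_iota0 => lt_x /=.
  have N0 : 0 < N by apply: leq_trans lt_nN.
  by rewrite modnMDl divnMDl // divn_small // addn0 modn_small.
by rewrite count_uniq_mem ?iota_uniq // mem_iota0 lt_lv.
Qed.

Lemma strategy_clauses_sat (e : rel 'I_n) :
  (forall u v : 'I_n, adj M u v = e u v) ->
  (exists a, [/\ size a = I, count id a = sh.1 &
     all (has (nth false (a ++ map negb a))) (strategy_clauses n N M sh)]) <->
  (exists lab, sat e sh lab set0).
Proof.
move=> Me; have [HE HP _] := sh_wf; split.
  case=> a [sz_a _ /(strategy_clausesP sz_a)[H1 H2 H3 H4]].
  (* The choice ranges over ['I_n], so a slot whose true input is number [n] becomes [None]. *)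
  pose lab q := [pick v : 'I_n | nth false a (q * N + v)].
  have labP q v : lab q = Some v -> nth false a (q * N + v).
    by rewrite /lab; case: pickP => // u tu [<-].
  exists lab; split=> [p v Ep /labP tv /labP | w Pw].
    by apply/negP; apply: H3 tv.
  rewrite set0U; apply/forallP=> v; have [q [u [wq lt_u Huv tu]]] := H4 w v Pw (ltn_ord v).
  have Eu : lab q = Some (Ordinal lt_u).
    rewrite /lab; case: pickP => [u' tu' | /(_ (Ordinal lt_u))]; last by rewrite /= tu.
    congr Some; apply/val_inj/(H2 q) => //; rewrite ?(HP w) //.
      exact: ltn_trans (ltn_ord u') lt_nN.
    exact: ltn_trans lt_u lt_nN.
  have labu : Some (Ordinal lt_u) \in map lab w by rewrite -Eu map_f.
  case/orP: Huv => [/eqP Euv | uv]; apply/orP.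
    by left; rewrite inE (_ : v = Ordinal lt_u) //; apply: val_inj.
  by right; apply/existsP; exists (Ordinal lt_u); rewrite inE labu -Me.
case=> lab [satE satP].
pose lv q := if lab q is Some v then val v else n.
have lt_lv q : lv q < N by rewrite /lv; case: (lab q) => // v; apply: ltn_trans (ltn_ord v) lt_nN.
pose a := mkseq (fun x => x %% N == lv (x %/ N)) I.
have sz_a : size a = I by rewrite size_mkseq.
have trE q v : q < sh.1 -> v < N -> nth false a (q * N + v) = (v == lv q).
  have N0 : 0 < N by apply: leq_trans lt_nN.
  move=> lt_q lt_v; rewrite nth_mkseq ?var_lt //.
  by rewrite modnMDl divnMDl // divn_small // addn0 modn_small.
exists a; split=> //; first exact: count_slots.
have lvP q v : v < n -> v = lv q -> exists2 v', lab q = Some v' & val v' = v.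
  move=> lt_v; rewrite /lv; case: (lab q) => [v' ->|Ev]; first by exists v'.
  by rewrite Ev ltnn in lt_v.
apply/(strategy_clausesP sz_a); split.
- by move=> q lt_q; exists (lv q); rewrite ?trE.
- by move=> q v w lt_q lt_v lt_w; rewrite !trE // => /eqP-> /eqP->.
- move=> p v Ep lt_v; have [p1 p2] := HE p Ep; rewrite !trE // ?(ltn_trans lt_v lt_nN) //.
  move=> /eqP/(lvP _ _ lt_v)[v1 E1 Ev1]; apply/eqP => /(lvP _ _ lt_v)[v2 E2 Ev2].
  by apply: (satE p v1 Ep E1); rewrite E2; congr Some; apply: val_inj; rewrite Ev1.
move=> w v Pw lt_v; have := satP w Pw; rewrite set0U => /forallP/(_ (Ordinal lt_v)).
have Hlab (u : 'I_n) : Some u \in map lab w ->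
    exists q, q \in w /\ nth false a (q * N + u).
  case/mapP=> q wq Eq; exists q; split=> //; rewrite trE ?(HP w) //.
    by rewrite /lv -Eq.
  exact: ltn_trans (ltn_ord u) lt_nN.
case/orP=> [|/existsP[u /andP[]]]; rewrite inE => /Hlab[q [wq tq]].
  by exists q, v; rewrite eqxx.
by rewrite -Me => uv; exists q, u; rewrite uv orbT.
Qed.

End StrategyClauses.
(** * Membership in W[2] *)

Definition is_bool (x : tree) : bool :=
  if is_node x then ~~ is_node (thd x) && ~~ is_node (ttl x) else true.

Definition matrix_of (x : tree) : seq (seq bool) :=
  [seq [seq is_node b | b <- tree_seq r] | r <- tree_seq x].

(** Instances are arbitrary trees, so the reduction has to recognise those that encode a graph. *)
Definition valid_graph (x : tree) : bool :=
  all (fun r => (size (tree_seq r) == size (tree_seq x)) && all is_bool (tree_seq r)) (tree_seq x)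
  && all (fun u => ~~ adj (matrix_of x) u u &&
        all (fun v => adj (matrix_of x) u v == adj (matrix_of x) v u)
            (iota 0 (size (tree_seq x)))) (iota 0 (size (tree_seq x))).

Lemma enc_seq_map A (encA : A -> tree) (s : seq A) : enc_seq encA s = enc_seq id (map encA s).
Proof. by elim: s => //= a s ->. Qed.

Lemma tree_seq_enc A (encA : A -> tree) (s : seq A) : tree_seq (enc_seq encA s) = map encA s.
Proof. by elim: s => //= a s ->. Qed.

Lemma is_boolK x : is_bool x -> enc_bool (is_node x) = x.
Proof. by case: x => [|[|? ?] [|? ?]]. Qed.

Lemma enc_boolK : cancel enc_bool is_node.
Proof. by case. Qed.

Lemma matrix_of_graph n (e : rel 'I_n) :
  matrix_of (enc_graph e) = [seq [seq e i j | j <- enum 'I_n] | i <- enum 'I_n].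
Proof. exact: (enc_seqK (enc_seqK enc_boolK)). Qed.

Lemma adj_graph n (e : rel 'I_n) (u v : 'I_n) : adj (matrix_of (enc_graph e)) u v = e u v.
Proof.
rewrite /adj matrix_of_graph (nth_map u) ?size_enum_ord // nth_ord_enum.
by rewrite (nth_map u) ?size_enum_ord // nth_ord_enum.
Qed.

Lemma size_graph n (e : rel 'I_n) : size (tree_seq (enc_graph e)) = n.
Proof.
have := congr1 size (matrix_of_graph e).
by rewrite /matrix_of 2!size_map size_enum_ord.
Qed.

Lemma valid_graph_enc n (e : rel 'I_n) :
  symmetric e -> irreflexive e -> valid_graph (enc_graph e).
Proof.
move=> e_sym e_irr; rewrite /valid_graph size_graph; apply/andP; split.
  rewrite /enc_graph tree_seq_enc !all_map; apply/allP=> i _ /=.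
  rewrite tree_seq_enc size_map size_map size_enum_ord eqxx /= !all_map; apply/allP=> j _ /=.
  by case: (e i j).
apply/allP=> u; rewrite mem_iota0 => lt_u; rewrite (adj_graph e (Ordinal lt_u) (Ordinal lt_u)).
rewrite e_irr; apply/allP=> v; rewrite mem_iota0 => lt_v.
by rewrite (adj_graph e (Ordinal lt_u) (Ordinal lt_v)) (adj_graph e (Ordinal lt_v) (Ordinal lt_u))
  e_sym.
Qed.

Lemma valid_graphP x : valid_graph x ->
  exists n (e : rel 'I_n), [/\ symmetric e, irreflexive e & x = enc_graph e].
Proof.
case/andP=> /(all_nthP Leaf) Hrow /allP Hadj; set n := size (tree_seq x) in Hrow Hadj.
exists n, (fun u v => adj (matrix_of x) u v); split.
- move=> u v; have /Hadj/andP[_ /allP/(_ (val v))] : val u \in iota 0 n by rewrite mem_iota0 ltn_ord.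
  by rewrite mem_iota0 ltn_ord => /(_ isT)/eqP.
- move=> u; have /Hadj/andP[Huu _] : val u \in iota 0 n by rewrite mem_iota0 ltn_ord.
  exact: negbTE.
have nth_row i : i < n -> size (tree_seq (nth Leaf (tree_seq x) i)) = n /\
    all is_bool (tree_seq (nth Leaf (tree_seq x) i)).
  by move=> lt_i; have /andP[/eqP] := Hrow i lt_i.
rewrite /enc_graph -[LHS]tree_seqK enc_seq_map -map_comp; congr (enc_seq id _).
apply: (@eq_from_nth _ Leaf) => [|i lt_i]; first by rewrite size_map size_enum_ord.
have [sz_i bool_i] := nth_row i lt_i.
rewrite (nth_map (Ordinal lt_i)) ?size_enum_ord //.
rewrite -[LHS]tree_seqK /= enc_seq_map -map_comp; congr (enc_seq id _).
apply: (@eq_from_nth _ Leaf) => [|j lt_j]; first by rewrite size_map size_enum_ord.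
rewrite sz_i in lt_j; rewrite (nth_map (Ordinal lt_j)) ?size_enum_ord //= /adj /matrix_of.
rewrite (nth_map Leaf) ?(nth_map Leaf) ?nth_enum_ord ?sz_i // is_boolK //.
by apply: (all_nthP Leaf bool_i); rewrite sz_i.
Qed.

(** Trees that are not instances go to [Leaf], which encodes no circuit and is therefore a
    no-instance. There are [n.+1] labels because of [None], and a satisfying assignment has one true
    input per slot. *)
Definition strategy_circuit (z : tree * nat * shape) : tree * nat :=
  let g := thd z.1.1 in
  let n := size (tree_seq g) in
  let sh := if is_node (ttl z.1.1) then z.2 else branching z.2 in
  if [&& is_node z.1.1, is_bool (ttl z.1.1) & valid_graph g]
  then (enc_circuit (cnf_circuit (sh.1 * n.+1) (strategy_clauses n n.+1 (matrix_of g) sh)), sh.1)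
  else (Leaf, 0).

Lemma strategy_circuitP x k :
  short_dominator_mb_dom_game x k <->
  weighted_circuit_sat 2 3 (strategy_circuit (x, k, strategy_shape k)).1
                           (strategy_circuit (x, k, strategy_shape k)).2.
Proof.
have wf_k a : shape_wf (if is_node (enc_player a) then strategy_shape k
                        else branching (strategy_shape k)).
  by case: a => /=; do ?apply: branching_wf; apply: strategy_shape_wf.
have main n (e : rel 'I_n) a : symmetric e -> irreflexive e ->
    dominator_wins_within e a k <->
    weighted_circuit_sat 2 3
      (strategy_circuit (Node (enc_graph e) (enc_player a), k, strategy_shape k)).1
      (strategy_circuit (Node (enc_graph e) (enc_player a), k, strategy_shape k)).2.
  move=> e_sym e_irr; rewrite /strategy_circuit /= valid_graph_enc // size_graph.
  have -> : is_bool (enc_player a) by case: (a).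
  have := wf_k a; set sh := if _ then _ else _ => wf_sh /=.
  rewrite cnf_circuit_sat; last exact: strategy_clauses_lt.
  rewrite (strategy_clauses_sat _ _ (e := e)) //; last exact: adj_graph.
  by rewrite wins_within_sat /sh; case: (a).
split=> [[n [e [a [e_sym [e_irr [-> Hwin]]]]]] | sat_x]; first exact/main.
suff [n [e [a [e_sym e_irr Ex]]]] : exists n (e : rel 'I_n) (a : player),
    [/\ symmetric e, irreflexive e & x = Node (enc_graph e) (enc_player a)].
  by exists n, e, a; split=> //; split=> //; split=> //; apply/main; rewrite -?Ex.
move: sat_x; rewrite /strategy_circuit /=; case: ifP => [|_ [C [//]]].
case: x => //= g b /andP[bool_b /valid_graphP[n [e [e_sym e_irr ->]]]] _.
exists n, e, (if is_node b then Dominator else Staller); split=> //.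
by rewrite -{1}[b]is_boolK //; case: (is_node b).
Qed.

(** * Polynomial time of the membership reduction *)

Lemma pt_circuit E {eE : encodable E} (i o : E -> nat) (g : E -> seq gate) :
  polytime i -> polytime g -> polytime o -> polytime (fun e => Circuit (i e) (g e) (o e)).
Proof.
move=> Pi Pg Po; apply: (pt_conv (g := fun e => (i e, (g e, o e)))) => //; pt.
Qed.

Lemma pt_enc_circuit E {eE : encodable E} (C : E -> circuit) :
  polytime C -> polytime (fun e => enc_circuit (C e)).
Proof. by move=> PC; apply: pt_conv PC. Qed.

Lemma pt_Not E {eE : encodable E} (i : E -> nat) : polytime i -> polytime (fun e => Not (i e)).
Proof. by move=> Pi; apply: (pt_conv (g := fun e => (0, i e))) => //; pt. Qed.

Lemma pt_And E {eE : encodable E} (s : E -> seq nat) : polytime s -> polytime (fun e => And (s e)).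
Proof. by move=> Ps; apply: (pt_conv (g := fun e => (1, s e))) => //; pt. Qed.

Lemma pt_Or E {eE : encodable E} (s : E -> seq nat) : polytime s -> polytime (fun e => Or (s e)).
Proof. by move=> Ps; apply: (pt_conv (g := fun e => (2, s e))) => //; pt. Qed.

Ltac pt_circuits :=
  lazymatch goal with
  | |- polytime (fun e => Circuit (@?i e) (@?g e) (@?o e)) => apply (pt_circuit (i := i) (g := g) (o := o))
  | |- polytime (fun e => enc_circuit (@?i e)) => apply (pt_enc_circuit (C := i))
  | |- polytime (fun e => Not (@?i e)) => apply (pt_Not (i := i))
  | |- polytime (fun e => And (@?i e)) => apply (pt_And (s := i))
  | |- polytime (fun e => Or (@?i e)) => apply (pt_Or (s := i))
  end.

Ltac pt_user ::= first [pt_eqs | pt_circuits].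

Lemma pt_branching E {eE : encodable E} (sh : E -> shape) :
  polytime sh -> polytime (fun e => branching (sh e)).
Proof. by move=> Ps; rewrite /branching; pt. Qed.

Lemma pt_next_shape : polytime next_shape.
Proof. by rewrite /next_shape; have Pb := pt_branching (pt_id (A := shape)); pt. Qed.

Lemma pt_cnf_circuit E {eE : encodable E} (I : E -> nat) (cls : E -> seq (seq nat)) :
  polytime I -> polytime cls -> polytime (fun e => cnf_circuit (I e) (cls e)).
Proof. by move=> PI Pc; rewrite /cnf_circuit; pt. Qed.

Lemma pt_adj E {eE : encodable E} (M : E -> seq (seq bool)) (u v : E -> nat) :
  polytime M -> polytime u -> polytime v -> polytime (fun e => adj (M e) (u e) (v e)).
Proof. by move=> PM Pu Pv; rewrite /adj; pt. Qed.

Ltac pt_graphs :=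
  lazymatch goal with
  | |- polytime (fun e => branching (@?sh e)) => apply (pt_branching (sh := sh))
  | |- polytime (fun e => cnf_circuit (@?i e) (@?c e)) => apply (pt_cnf_circuit (I := i) (cls := c))
  | |- polytime (fun e => adj (@?M e) (@?u e) (@?v e)) => apply (pt_adj (M := M) (u := u) (v := v))
  end.

Ltac pt_user ::= first [pt_eqs | pt_circuits | pt_graphs].

Lemma pt_matrix_of E {eE : encodable E} (x : E -> tree) : polytime x -> polytime (fun e => matrix_of (x e)).
Proof. by move=> Px; rewrite /matrix_of; pt. Qed.

Ltac pt_matrix :=
  lazymatch goal with
  | |- polytime (fun e => matrix_of (@?x e)) => apply (pt_matrix_of (x := x))
  end.

Ltac pt_user ::= first [pt_eqs | pt_circuits | pt_graphs | pt_matrix].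

Lemma pt_valid_graph E {eE : encodable E} (x : E -> tree) :
  polytime x -> polytime (fun e => valid_graph (x e)).
Proof. by move=> Px; rewrite /valid_graph /is_bool; pt. Qed.

Lemma pt_strategy_clauses E {eE : encodable E} (n N : E -> nat) (M : E -> seq (seq bool))
    (sh : E -> shape) :
  polytime n -> polytime N -> polytime M -> polytime sh -> polytime (fun e => strategy_clauses (n e) (N e) (M e) (sh e)).
Proof. by move=> Pn PN PM Psh; rewrite /strategy_clauses; pt. Qed.

Lemma pt_strategy_circuit : polytime strategy_circuit.
Proof.
rewrite /strategy_circuit /is_bool; pt.
  by apply: pt_valid_graph; pt.
by apply: pt_strategy_clauses; pt.
Qed.

Lemma game_in_W2 : in_W 2 short_dominator_mb_dom_game.
Proof.
(* [m] counts the slots of the larger shape, the one used when Staller begins. *)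
exists 3; apply: (fpt_reduces_iter (st := next_shape) (a0 := empty_shape)
  (R := strategy_circuit) (m := fun sh => sh.1 + sh.1 * sh.1)).
- exact: pt_next_shape.
- exact: pt_strategy_circuit.
- have B : poly_bounded esize (fun sh : shape => sh.1).
    by exists 1 => -[s p]; rewrite esize_pair esize_nat /= expn1; lia.
  by apply: pbd_add => //; apply: pbd_mul.
- move=> z; rewrite /strategy_circuit /=; case: ifP => // _; case: ifP => // _.
  exact: leq_addr.
- exact: strategy_circuitP.
Qed.
(** * Normal forms of circuits of weft two *)

Definition is_nat (x : tree) : bool := all (fun y => ~~ is_node y) (tree_seq x).

Definition valid_gate (x : tree) : bool :=
  [&& is_node x, is_nat (thd x), size (tree_seq (thd x)) <= 2
    & if ~~ is_node (thd x) then is_nat (ttl x) else all is_nat (tree_seq (ttl x))].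

Definition valid_circuit (x : tree) : bool :=
  [&& is_node x, is_node (ttl x), is_nat (thd x), is_nat (ttl (ttl x))
    & all valid_gate (tree_seq (thd (ttl x)))].

Lemma dec_natK x : is_nat x -> enc_nat (dec_nat x) = x.
Proof.
rewrite /is_nat /dec_nat; elim: x => //= a _ b IHb /andP[a0 /IHb {2}<-].
by case: a a0.
Qed.

Lemma dec_seqK A (encA : A -> tree) (decA : tree -> A) (p : pred tree) x :
  (forall y, p y -> encA (decA y) = y) -> all p (tree_seq x) ->
  enc_seq encA (map decA (tree_seq x)) = x.
Proof. by move=> pK; elim: x => //= a _ b IHb /andP[/pK-> /IHb->]. Qed.

Lemma dec_gateK x : valid_gate x -> enc_gate (dec_gate x) = x.
Proof.
case: x => // t p /and4P[_ /dec_natK]; rewrite /= -/(dec_nat t); move: (dec_nat t) => m <- {t}.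
case: m => [|[|[|m]]] //= _ Hp; rewrite /dec_gate /=.
- by rewrite dec_natK.
- by rewrite (dec_seqK dec_natK).
- by rewrite (dec_seqK dec_natK).
Qed.

Lemma dec_circuitK x : valid_circuit x -> enc_circuit (dec_circuit x) = x.
Proof.
case: x => // i [|g o] // /and5P[_ _ nat_i nat_o Hg].
by rewrite /dec_circuit /enc_circuit /= !dec_natK // (dec_seqK dec_gateK).
Qed.

Lemma is_nat_enc n : is_nat (enc_nat n).
Proof. by rewrite /is_nat; elim: n. Qed.

Lemma valid_circuit_enc C : valid_circuit (enc_circuit C).
Proof.
case: C => i g o; rewrite /valid_circuit /= !is_nat_enc /= tree_seq_enc all_map.
apply/(all_nthP (Not 0)) => j _ /=; case: (nth _ _ _) => [k|s|s];
  rewrite /valid_gate /= ?is_nat_enc //= tree_seq_enc all_map; apply/allP=> k _;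
  exact: is_nat_enc.
Qed.

Lemma size_node_labels A (step : seq A -> gate -> A) ins gs :
  size (node_labels step ins gs) = size ins + size gs.
Proof.
by elim/last_ind: gs => [|gs g IHgs]; rewrite ?addn0 // -cats1 node_labels_cat size_rcons IHgs
  size_cat addn1 addnS.
Qed.

Lemma node_labels_nth A (d : A) (step : seq A -> gate -> A) ins gs j :
  j < size gs ->
  nth d (node_labels step ins gs) (size ins + j) =
  step (take (size ins + j) (node_labels step ins gs)) (nth (Not 0) gs j).
Proof.
elim/last_ind: gs j => // gs g IHgs j; rewrite size_rcons ltnS leq_eqVlt -cats1 node_labels_cat.
rewrite [node_labels _ (node_labels _ _ _) _]/= nth_rcons size_node_labels ltn_add2l.
case/predU1P=> [->|lt_j].
  rewrite ltnn eqxx nth_cat ltnn subnn /= -cats1 take_size_cat //.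
  by rewrite size_node_labels.
rewrite lt_j IHgs // nth_cat lt_j -cats1 takel_cat // size_node_labels leq_add2l ltnW //.
Qed.

Lemma node_labels_ins A (d : A) (step : seq A -> gate -> A) ins gs v :
  v < size ins -> nth d (node_labels step ins gs) v = nth d ins v.
Proof.
elim/last_ind: gs => // gs g IHgs lt_v; rewrite -cats1 node_labels_cat /= nth_rcons.
by rewrite size_node_labels ltn_addr // IHgs.
Qed.

Lemma all_flatten A (p : pred A) ss : all p (flatten ss) = all (all p) ss.
Proof. by elim: ss => //= s ss IHss; rewrite all_cat IHss. Qed.

Lemma all_pairs A B D (p : pred D) (f : A -> B -> D) s t :
  all p [seq f a b | a <- s, b <- t] = all (fun a => all (fun b => p (f a b)) t) s.
Proof. by elim: s => //= a s IHs; rewrite all_cat all_map IHs. Qed.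

Lemma has_pairs A B D (p : pred D) (f : A -> B -> D) s t :
  has p [seq f a b | a <- s, b <- t] = has (fun a => has (fun b => p (f a b)) t) s.
Proof. by elim: s => //= a s IHs; rewrite has_cat has_map IHs. Qed.

(** With the quantifier as a parameter, each argument covers disjunctive and conjunctive forms at
    once. *)
Definition quant (disj : bool) A (p : pred A) (s : seq A) : bool :=
  if disj then has p s else all p s.

Lemma quant_map disj A B (p : pred B) (f : A -> B) s :
  quant disj p (map f s) = quant disj (fun a => p (f a)) s.
Proof. by rewrite /quant has_map all_map. Qed.

Lemma quant_flatten disj A (p : pred A) ss :
  quant disj p (flatten ss) = quant disj (quant disj p) ss.
Proof.
rewrite /quant; case: disj; elim: ss => //= s ss IHss; first by rewrite has_cat IHss.
by rewrite all_cat IHss.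
Qed.

Lemma eq_in_quant disj (A : eqType) (p q : pred A) s :
  {in s, p =1 q} -> quant disj p s = quant disj q s.
Proof.
by move=> pq; rewrite /quant (eq_in_has pq) (eq_in_all pq).
Qed.

(** The distributive law for at most two normal forms, as many as a gate that is not large has
    predecessors. Entries beyond the second are dropped. *)
Definition product2 X (l : seq (seq (seq X))) : seq (seq X) :=
  if size l == 0 then [:: [::]]
  else if size l == 1 then nth [::] l 0
  else [seq s ++ t | s <- nth [::] l 0, t <- nth [::] l 1].

Lemma quant_product2 disj X (p : pred X) (l : seq (seq (seq X))) : size l <= 2 ->
  quant disj (quant (~~ disj) p) (product2 l) =
  quant (~~ disj) (quant disj (quant (~~ disj) p)) l.
Proof.
rewrite /product2; case: l => [|F [|G [|//]]] _ /=.
- by rewrite /quant; case: disj.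
- by rewrite {3}/quant /=; case: disj; rewrite ?andbT ?orbF.
have hasE (s : seq X) : has (fun t => all p (s ++ t)) G = all p s && has (all p) G.
  by elim: G => [|t G IHG] /=; rewrite ?andbF // IHG all_cat andb_orr.
have allE (s : seq X) : all (fun t => has p (s ++ t)) G = has p s || all (has p) G.
  by elim: G {hasE} => [|t G IHG] /=; rewrite ?orbT // IHG has_cat orb_andr.
rewrite /quant has_pairs all_pairs; case: disj => /=; rewrite ?andbT ?orbF.
  by elim: F => //= s F ->; rewrite hasE andb_orl.
by elim: F => //= s F ->; rewrite allE orb_andl.
Qed.

Lemma all_product2 (X : Type) (p : pred X) (l : seq (seq (seq X))) :
  all (all (all p)) l -> all (all p) (product2 l).
Proof.
rewrite /product2; case: l => [|F [|G l]] //=; first by rewrite andbT.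
case/and3P=> allF allG _; rewrite all_pairs; apply: sub_all allF => s all_s.
by apply: sub_all allG => t all_t; rewrite all_cat all_s.
Qed.

Definition lit := (nat * bool)%type.

Definition gate_at (C : circuit) (v : nat) : gate := nth (Not 0) (gates C) (v - inputs C).

(* Node [v] has depth at most [h] and is reached by paths of weft at most [w]. *)
Fixpoint within (C : circuit) (h w v : nat) : bool :=
  (v < inputs C) ||
  (if h is h'.+1 then
     if large (gate_at C v) then (0 < w) && all (fun i => within C h' w.-1 i) (preds (gate_at C v))
     else all (fun i => within C h' w i) (preds (gate_at C v))
   else false).

Definition flips (g : gate) : bool := if g is Not _ then true else false.

Definition conj (g : gate) : bool := if g is And _ then true else false.

(* A disjunction of conjunctions, or a conjunction of disjunctions, according to [disj], that
   holds iff node [v] has value [b]; only a large gate calls [lower]. *)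
Fixpoint level (X : Type) (disj : bool) (inp : nat -> bool -> seq (seq X))
    (lower : circuit -> nat -> bool -> seq X) (h : nat) (C : circuit) (v : nat) (b : bool) :
    seq (seq X) :=
  if v < inputs C then inp v b
  else if h is h'.+1 then
    if large (gate_at C v) then
      if (conj (gate_at C v) (+) b) == disj
      then [seq lower C i (flips (gate_at C v) (+) b) | i <- preds (gate_at C v)]
      else [:: flatten [seq lower C i (flips (gate_at C v) (+) b) | i <- preds (gate_at C v)]]
    else
      if (conj (gate_at C v) (+) b) == disj
      then flatten [seq level disj inp lower h' C i (flips (gate_at C v) (+) b)
                      | i <- preds (gate_at C v)]
      else product2 [seq level disj inp lower h' C i (flips (gate_at C v) (+) b)
                      | i <- preds (gate_at C v)]
  else [::].

Section Circuits.

Variable C : circuit.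
Hypothesis C_wf : circuit_wf C.

Let is_node_of v := v < inputs C + size (gates C).

Lemma preds_lt v i : inputs C <= v -> is_node_of v -> i \in preds (gate_at C v) -> i < v.
Proof.
move=> ge_v lt_v; case/andP: C_wf => /allP H _.
have lt_j : v - inputs C < size (gates C) by rewrite ltn_subLR.
have /H/allP H' : v - inputs C \in iota 0 (size (gates C)) by rewrite mem_iota.
by move/H'; rewrite subnKC.
Qed.

(** Predecessors come earlier, so a step that looks only at them gives the same result on the whole
    list of labels as on the prefix. *)
Lemma node_labels_gate A (d : A) (step : seq A -> gate -> A) ins v :
  (forall vs vs' g, (forall i, i \in preds g -> nth d vs i = nth d vs' i) ->
     step vs g = step vs' g) ->
  size ins = inputs C -> inputs C <= v -> is_node_of v ->
  nth d (node_labels step ins (gates C)) v =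
  step (node_labels step ins (gates C)) (gate_at C v).
Proof.
move=> step_ext sz_ins ge_v lt_v; have lt_j : v - inputs C < size (gates C) by rewrite ltn_subLR.
have := node_labels_nth d step ins lt_j; rewrite sz_ins subnKC // => ->.
by apply: step_ext => i /(preds_lt ge_v lt_v) lt_i; rewrite nth_take.
Qed.

Definition weight_at (w : gate -> nat) (v : nat) : nat :=
  nth 0 (node_labels (fun vs g => w g + \max_(i <- preds g) nth 0 vs i)
                     (nseq (inputs C) 0) (gates C)) v.

Lemma weight_at_gate w v : inputs C <= v -> is_node_of v ->
  weight_at w v = w (gate_at C v) + \max_(i <- preds (gate_at C v)) weight_at w i.
Proof.
move=> ge_v lt_v; apply: node_labels_gate; rewrite ?size_nseq // => vs vs' g E.
by congr (_ + _); apply: eq_big_seq.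
Qed.

Lemma weight_at_input w v : v < inputs C -> weight_at w v = 0.
Proof. by move=> lt_v; rewrite /weight_at node_labels_ins ?size_nseq // nth_nseq lt_v. Qed.

(** Replaces the path weights by a recursion of bounded height, which follows the construction of
    the normal form and can be run as a test. *)
Lemma withinP h w v : is_node_of v ->
  within C h w v =
  (weight_at (fun=> 1) v <= h) && (weight_at (fun g => large g : nat) v <= w).
Proof.
elim: h w v => [|h IHh] w v lt_v /=; case: ltnP => [lt_vi | ge_vi] /=.
- by rewrite !weight_at_input.
- by rewrite weight_at_gate.
- by rewrite !weight_at_input.
rewrite !weight_at_gate // add1n ltnS.
have max_le u n : (\max_(i <- preds (gate_at C v)) weight_at u i <= n) =
    all (fun i => weight_at u i <= n) (preds (gate_at C v)).
  by apply/bigmax_leqP_seq/allP => H i *; apply: H.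
have IH n : all (fun i => within C h n i) (preds (gate_at C v)) =
    (\max_(i <- preds (gate_at C v)) weight_at (fun=> 1) i <= h) &&
    (\max_(i <- preds (gate_at C v)) weight_at (fun g => large g : nat) i <= n).
  rewrite !max_le -all_predI; apply: eq_in_all => i /(preds_lt ge_vi lt_v) lt_i.
  by apply: IHh; apply: ltn_trans lt_v.
case: (large _) => /=; rewrite ?add0n ?IH //.
by case: w => [|w] /=; rewrite ?add1n ?andbF.
Qed.

Variable a : seq bool.
Hypothesis sz_a : size a = inputs C.

Definition value_at (v : nat) : bool := nth false (node_labels gate_value a (gates C)) v.

(** De Morgan: requiring a conjunction to be true, or a disjunction to be false, is a universal
    condition on the predecessors, and the other two cases are existential. A negation has one
    predecessor, so either quantifier fits. *)
Lemma value_at_gate v b : inputs C <= v -> is_node_of v ->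
  (value_at v == b) =
  quant (conj (gate_at C v) (+) b) (fun i => value_at i == (flips (gate_at C v) (+) b))
        (preds (gate_at C v)).
Proof.
move=> ge_v lt_v; rewrite {1}/value_at node_labels_gate //; last first.
  move=> vs vs' [i|s|s] E /=; [congr (~~ _) | apply: eq_in_all | apply: eq_in_has] => *;
  exact/E/mem_head || exact: E.
rewrite -/(value_at); case: (gate_at C v) => [i|s|s] /=.
- by rewrite /quant /= /value_at; case: b; case: (nth _ _ _).
- rewrite /quant; case: b => /=; first by rewrite eqb_id; apply: eq_all => i; rewrite eqb_id.
  by rewrite eqbF_neg -has_predC; apply: eq_has => i; rewrite eqbF_neg.
rewrite /quant; case: b => /=; first by rewrite eqb_id; apply: eq_has => i; rewrite eqb_id.
by rewrite eqbF_neg -all_predC; apply: eq_all => i; rewrite eqbF_neg.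
Qed.

(** At a large gate of the outer connective, the lower forms become the terms. At a large gate of
    the other connective, they are merged into a single term, as they share its connective.
    Distribution thus happens at small gates only, at most once per level, which keeps the size
    polynomial for fixed [h]. *)
Lemma levelP X disj (inp : nat -> bool -> seq (seq X)) lower (p : pred X) h w v b :
  (forall u c, u < inputs C -> quant disj (quant (~~ disj) p) (inp u c) = (value_at u == c)) ->
  (forall h' u c, h' <= h -> 0 < w -> within C h' w.-1 u -> is_node_of u ->
     quant (~~ disj) p (lower C u c) = (value_at u == c)) ->
  is_node_of v -> within C h w v ->
  quant disj (quant (~~ disj) p) (level disj inp lower h C v b) = (value_at v == b).
Proof.
move=> Hinp; elim: h v b => [|h IHh] v b Hlow lt_v /=; case: ltnP => [/Hinp-> // | ge_v] //=.
rewrite value_at_gate //; set g := gate_at C v; set b' := flips g (+) b; set dj := conj g (+) b.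
have lt_i i : i \in preds g -> is_node_of i.
  by move=> /(preds_lt ge_v lt_v) lt_i; apply: ltn_trans lt_v.
have E1 : dj != disj -> dj = ~~ disj by move: (dj) (disj) => [] [].
case: ifP => lg.
  case/andP=> w0 /allP Hw.
  have E : quant dj (fun i => quant (~~ disj) p (lower C i b')) (preds g) =
           quant dj (fun i => value_at i == b') (preds g).
    by apply: eq_in_quant => i gi; apply: (Hlow h); rewrite ?leqnSn // ?lt_i // Hw.
  rewrite -E; case: eqP => [<- | /eqP/E1 Edj]; first by rewrite quant_map.
  rewrite {1}/quant /= orbF andbT if_same quant_flatten quant_map -Edj //.
move/allP=> Hw.
have E : quant dj (fun i => quant disj (quant (~~ disj) p) (level disj inp lower h C i b')) (preds g)
       = quant dj (fun i => value_at i == b') (preds g).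
  apply: eq_in_quant => i gi; apply: IHh; [|exact: lt_i|exact: Hw].
  by move=> h' u c le_h; apply: Hlow; apply: leqW.
rewrite -E; case: eqP => [<- | /eqP/E1 Edj]; first by rewrite quant_flatten quant_map.
have sz2 : size (preds g) <= 2 by rewrite leqNgt; apply/negbT.
by rewrite quant_product2 ?size_map // quant_map -Edj.
Qed.

End Circuits.

Lemma level_all X disj (inp : nat -> bool -> seq (seq X)) lower C (p : pred X) h v b :
  (forall u c, u < inputs C -> all (all p) (inp u c)) ->
  (forall u c, all p (lower C u c)) -> all (all p) (level disj inp lower h C v b).
Proof.
move=> Pi Pl; elim: h v b => [|h IHh] v b /=; case: ifP => [/Pi // | _] //.
have all_map_lower s c : all (all p) [seq lower C i c | i <- s].
  by rewrite all_map; elim: s => //= i s ->; rewrite Pl.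
have all_map_level s c : all (all (all p)) [seq level disj inp lower h C i c | i <- s].
  by rewrite all_map; elim: s => //= i s ->; rewrite IHh.
case: ifP => _; case: ifP => _ //.
- by rewrite /= andbT all_flatten.
- by rewrite all_flatten.
exact: all_product2.
Qed.

(** * The normal form with four alternating levels *)

Section NormalForm.

Variable d : nat.

(** Each large gate on a path costs one more alternation: [nf2] is correct for nodes of weft 0,
    [nf3] for weft 1 and [nf4] for weft 2. *)
Definition nf2 (C : circuit) (v : nat) (b : bool) : seq (seq lit) :=
  level true (fun v b => [:: [:: (v, b)]]) (fun _ _ _ => [::]) d C v b.

Definition nf3 (C : circuit) (v : nat) (b : bool) : seq (seq (seq lit)) :=
  level false (fun v b => [:: [:: [:: (v, b)]]]) nf2 d C v b.

Definition nf4 (C : circuit) (v : nat) (b : bool) : seq (seq (seq (seq lit))) :=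
  level true (fun v b => [:: [:: [:: [:: (v, b)]]]]) nf3 d C v b.

Definition normal_form (C : circuit) := nf4 C (output C) true.

Lemma within_le C h h' w v : h <= h' -> within C h w v -> within C h' w v.
Proof.
elim: h h' w v => [|h IHh] [|h'] w v //= le_h; case: ltnP => //= _.
have sub_w u : subpred (fun i => within C h u i) (fun i => within C h' u i).
  by move=> i; apply: IHh.
by case: ifP => _; [case/andP=> ->|]; apply: sub_all.
Qed.

Lemma normal_formP C a : circuit_wf C -> weft C <= 2 -> depth C <= d -> size a = inputs C ->
  circuit_value C a =
  has (all (has (all (fun l => nth false a l.1 == l.2)))) (normal_form C).
Proof.
move=> C_wf wC dC sz_a; pose p (l : lit) := nth false a l.1 == l.2.
pose is_node_of v := v < inputs C + size (gates C).
have value_input v : v < inputs C -> value_at C a v = nth false a v.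
  by move=> lt_v; rewrite /value_at node_labels_ins // sz_a.
have P2 v b : is_node_of v -> within C d 0 v ->
    has (all p) (nf2 C v b) = (value_at C a v == b).
  apply: (levelP C_wf sz_a (disj := true) (p := p)) => // u c lt_u.
  by rewrite /quant /= !orbF andbT /p value_input.
have P3 v b : is_node_of v -> within C d 1 v ->
    all (has (all p)) (nf3 C v b) = (value_at C a v == b).
  apply: (levelP C_wf sz_a (disj := false) (p := all p)) => [u c lt_u | h' u c le_h _ wu lt_u].
    by rewrite /quant /= !orbF !andbT /p value_input.
  by apply: P2 => //; apply: within_le wu.
have lt_out : is_node_of (output C) by case/andP: C_wf.
have P4 : has (all (has (all p))) (nf4 C (output C) true) = (value_at C a (output C) == true).
  apply: (levelP C_wf sz_a (disj := true) (p := has (all p)) (w := 2))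
      => // [u c lt_u | h' u c le_h _ wu lt_u |].
  - by rewrite /quant /= !orbF !andbT /p value_input.
  - by apply: P3 => //; apply: within_le wu.
  by rewrite withinP //; apply/andP.
by rewrite /normal_form P4 eqb_id.
Qed.

Definition small_clause C (c : seq lit) : bool :=
  all (fun l => l.1 < inputs C) c && (size c <= 2 ^ d).

(** A small gate concatenates at most two conjunctions, so their length at most doubles per
    level. *)
Lemma nf2_small C v b : all (small_clause C) (nf2 C v b).
Proof.
rewrite all_predI; apply/andP; split.
  by apply: level_all => // u c lt_u; rewrite /= lt_u.
rewrite /nf2; elim: d v b => [|h IHh] v b /=; case: ifP => [_ | _] //=; first by rewrite expn_gt0.
have le_exp : 2 ^ h <= 2 ^ h.+1 by rewrite leq_exp2l.
set c := flips _ (+) b.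
pose l i := level true (fun v b => [:: [:: (v, b)]]) (fun _ _ _ => [::]) h C i c.
have Hl i : all (fun c => size c <= 2 ^ h) (l i) by apply: IHh.
have Hl' i : all (fun c => size c <= 2 ^ h.+1) (l i).
  by apply: sub_all (Hl i) => s; move/leq_trans; apply.
case: ifP => _; case: ifP => _.
- by elim: (preds _).
- by rewrite /= andbT; elim: (preds _).
- by elim: (preds _) => //= i s IHs; rewrite all_cat IHs andbT; apply: Hl'.
case: (preds _) => [|i [|j s]] //=; first exact: Hl'.
rewrite /product2 /= all_pairs; apply: sub_all (Hl i) => s1 /= le_s1.
by apply: sub_all (Hl j) => s2 /= le_s2; rewrite size_cat expnS mul2n -addnn leq_add.
Qed.

Lemma normal_form_small C : all (all (all (small_clause C))) (normal_form C).
Proof.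
have sc u c : u < inputs C -> small_clause C [:: (u, c)].
  by move=> lt_u; rewrite /small_clause /= lt_u expn_gt0.
apply: level_all => [u c lt_u | u c]; first by rewrite /= sc.
apply: level_all => [u' c' lt_u | u' c'].
  by rewrite /= sc.
exact: nf2_small.
Qed.

End NormalForm.

(** * Polynomial time of the normal form *)

Section GateTime.

Context (E : Type) {eE : encodable E}.

Lemma pt_inputs (C : E -> circuit) : polytime C -> polytime (fun e => inputs (C e)).
Proof.
move=> PC; apply: (pt_fst (f := fun e => (inputs (C e), (gates (C e), output (C e))))).
exact: pt_conv PC.
Qed.

Lemma pt_gates (C : E -> circuit) : polytime C -> polytime (fun e => gates (C e)).
Proof.
move=> PC; apply: (pt_fst (f := fun e => (gates (C e), output (C e)))).
apply: (pt_snd (f := fun e => (inputs (C e), (gates (C e), output (C e))))).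
exact: pt_conv PC.
Qed.

Lemma pt_output (C : E -> circuit) : polytime C -> polytime (fun e => output (C e)).
Proof.
move=> PC; apply: (pt_snd (f := fun e => (gates (C e), output (C e)))).
apply: (pt_snd (f := fun e => (inputs (C e), (gates (C e), output (C e))))).
exact: pt_conv PC.
Qed.

Lemma pt_dec_nat (x : E -> tree) : polytime x -> polytime (fun e => dec_nat (x e)).
Proof. by move=> Px; rewrite /dec_nat; pt. Qed.

Lemma pt_gate_code (g : E -> gate) : polytime g -> polytime (fun e => enc_gate (g e)).
Proof. by move=> Pg; apply: pt_conv Pg. Qed.

Lemma pt_conj (g : E -> gate) : polytime g -> polytime (fun e => conj (g e)).
Proof.
move=> /pt_gate_code Pg; apply: (pt_ext (g := fun e => size (tree_seq (thd (enc_gate (g e)))) == 1)).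
  by move=> e; case: (g e).
by pt.
Qed.

Lemma pt_flips (g : E -> gate) : polytime g -> polytime (fun e => flips (g e)).
Proof.
move=> /pt_gate_code Pg; apply: (pt_ext (g := fun e => ~~ is_node (thd (enc_gate (g e))))).
  by move=> e; case: (g e).
by pt.
Qed.

Lemma pt_preds (g : E -> gate) : polytime g -> polytime (fun e => preds (g e)).
Proof.
move=> /pt_gate_code Pg.
apply: (pt_ext (g := fun e => if ~~ is_node (thd (enc_gate (g e)))
  then [:: dec_nat (ttl (enc_gate (g e)))]
  else map dec_nat (tree_seq (ttl (enc_gate (g e)))))).
  by move=> e; case: (g e) => [i|s|s] /=; rewrite ?enc_natK // (enc_seqK enc_natK).
by rewrite /dec_nat; pt.
Qed.

Lemma pt_addb (b c : E -> bool) : polytime b -> polytime c -> polytime (fun e => b e (+) c e).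
Proof.
by move=> Pb Pc; apply: pt_ext (pt_if Pb (pt_negb Pc) Pc) => e; case: (b e).
Qed.

End GateTime.

Ltac pt_gate :=
  lazymatch goal with
  | |- polytime (fun e => inputs (@?C e)) => apply (pt_inputs (C := C))
  | |- polytime (fun e => gates (@?C e)) => apply (pt_gates (C := C))
  | |- polytime (fun e => output (@?C e)) => apply (pt_output (C := C))
  | |- polytime (fun e => conj (@?g e)) => apply (pt_conj (g := g))
  | |- polytime (fun e => flips (@?g e)) => apply (pt_flips (g := g))
  | |- polytime (fun e => preds (@?g e)) => apply (pt_preds (g := g))
  | |- polytime (fun e => dec_nat (@?g e)) => apply (pt_dec_nat (x := g))
  | |- polytime (fun e => addb (@?b e) (@?c e)) => apply (pt_addb (b := b) (c := c))
  end.

Ltac pt_user ::= first [pt_eqs | pt_circuits | pt_graphs | pt_matrix | pt_gate].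

Lemma pt_gate_at E {eE : encodable E} (C : E -> circuit) (v : E -> nat) :
  polytime C -> polytime v -> polytime (fun e => gate_at (C e) (v e)).
Proof. by move=> PC Pv; rewrite /gate_at; pt. Qed.

Ltac pt_gate_nodes :=
  lazymatch goal with
  | |- polytime (fun e => gate_at (@?C e) (@?v e)) => apply (pt_gate_at (C := C) (v := v))
  end.

Ltac pt_user ::= first [pt_eqs | pt_circuits | pt_graphs | pt_matrix | pt_gate | pt_gate_nodes].

Lemma pt_within h w E {eE : encodable E} (C : E -> circuit) (v : E -> nat) :
  polytime C -> polytime v -> polytime (fun e => within (C e) h w (v e)).
Proof.
elim: h w E eE C v => [|h IHh] w E eE C v PC Pv /=; first by pt.
by rewrite /large; pt; apply: IHh; pt.
Qed.

Lemma pt_product2 E X {eE : encodable E} {eX : encodable X} (l : E -> seq (seq (seq X))) :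
  polytime l -> polytime (fun e => product2 (l e)).
Proof. by move=> Pl; rewrite /product2; pt. Qed.

(** The recursion has fixed height [h], so it unfolds into a composition of boundedly many
    polynomial-time functions. *)
Lemma pt_level X {eX : encodable X} disj (inp : nat -> bool -> seq (seq X)) lower h :
  polytime (fun x : nat * bool => inp x.1 x.2) ->
  (forall E (eE : encodable E) (C : E -> circuit) (v : E -> nat) (b : E -> bool),
    polytime C -> polytime v -> polytime b -> polytime (fun e => lower (C e) (v e) (b e))) ->
  forall E (eE : encodable E) (C : E -> circuit) (v : E -> nat) (b : E -> bool),
    polytime C -> polytime v -> polytime b -> polytime (fun e => level disj inp lower h (C e) (v e) (b e)).
Proof.
move=> Pi Pl; elim: h => [|h IHh] E eE C v b PC Pv Pb /=; pt.
- by apply: (pt_comp (g := fun e => (v e, b e)) _ Pi); pt.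
- by apply: (pt_comp (g := fun e => (v e, b e)) _ Pi); pt.
- by rewrite /large; pt.
- by apply: Pl; pt.
- by apply: Pl; pt.
- by apply: IHh; pt.
by apply: pt_product2; pt; apply: IHh; pt.
Qed.

Lemma pt_nf2 d E (eE : encodable E) (C : E -> circuit) (v : E -> nat) (b : E -> bool) :
  polytime C -> polytime v -> polytime b -> polytime (fun e => nf2 d (C e) (v e) (b e)).
Proof.
by apply: pt_level => [|E' eE' C' v' b' *]; [pt | exact: pt_const].
Qed.

Lemma pt_nf3 d E (eE : encodable E) (C : E -> circuit) (v : E -> nat) (b : E -> bool) :
  polytime C -> polytime v -> polytime b -> polytime (fun e => nf3 d (C e) (v e) (b e)).
Proof. by apply: pt_level; [pt | exact: pt_nf2]. Qed.

Lemma pt_normal_form d E {eE : encodable E} (C : E -> circuit) :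
  polytime C -> polytime (fun e => normal_form d (C e)).
Proof.
move=> PC; rewrite /normal_form /nf4; apply: pt_level; [pt | exact: pt_nf3 | exact: PC | pt | pt].
Qed.
(** * Increasing sequences of positions *)

Section Positions.

Variables (n k : nat).

(* [pos 1 < ... < pos k] are the positions, counted from 1, of the ones in a word of length [n];
   [pos 0 = 0] and [pos k.+1 = n.+1] are sentinels. *)
Definition positions (pos : nat -> nat) : Prop :=
  [/\ pos 0 = 0, pos k.+1 = n.+1 & forall i, i <= k -> pos i < pos i.+1].

(** For [positions], the sentinel [pos 0 = 0] equals no [v.+1], so index 0 contributes no one. *)
Definition word_of (pos : nat -> nat) : seq bool :=
  mkseq (fun v => has (fun i => pos i == v.+1) (iota 0 k.+1)) n.

Lemma positions_lt pos i j : positions pos -> i < j -> j <= k.+1 -> pos i < pos j.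
Proof.
case=> _ _ lt_pos; elim: j => // j IHj; rewrite ltnS leq_eqVlt => /predU1P[-> | lt_ij] lt_j.
  exact: lt_pos.
by apply: ltn_trans (IHj lt_ij (ltnW lt_j)) (lt_pos j lt_j).
Qed.

Lemma positions_inj pos i j : positions pos -> i <= k.+1 -> j <= k.+1 -> pos i = pos j -> i = j.
Proof.
move=> pos_ok le_i le_j Eij; case: (ltngtP i j) => // lt_ij.
  by have := positions_lt pos_ok lt_ij le_j; rewrite Eij ltnn.
by have := positions_lt pos_ok lt_ij le_i; rewrite Eij ltnn.
Qed.

Lemma positions_locate pos v : positions pos -> v <= n ->
  exists2 i, i <= k & pos i <= v < pos i.+1.
Proof.
case=> pos0 posk _ le_v.
have: v < pos k.+1 by rewrite posk ltnS.
elim: (k) => [|m IHm] lt_v; first by exists 0; rewrite ?pos0.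
have [lt_vm | le_vm] := ltnP v (pos m.+1); last by exists m.+1; rewrite ?le_vm.
by have [i le_i Hi] := IHm lt_vm; exists i; first exact: leqW.
Qed.

(** No position lies strictly between two consecutive ones, so the segment around [v.+1] alone
    decides the bit. This is what lets one segment certify a literal of either sign. *)
Lemma nth_word_of pos v i : positions pos -> v < n -> i <= k -> pos i <= v.+1 < pos i.+1 ->
  nth false (word_of pos) v = (pos i == v.+1).
Proof.
move=> pos_ok lt_v le_i /andP[le_iv lt_vi]; rewrite nth_mkseq //.
apply/hasP/eqP => [[j] | Ei]; last by exists i; rewrite ?mem_iota0 ?Ei.
rewrite mem_iota0 ltnS => le_j /eqP Ej; rewrite -Ej; congr pos.
apply/eqP; rewrite eqn_leq; apply/andP; split; rewrite leqNgt; apply/negP => lt_ij.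
  by have := positions_lt pos_ok lt_ij (leqW le_i); rewrite Ej ltnNge le_iv.
have : pos i.+1 <= pos j.
  move: lt_ij; rewrite leq_eqVlt => /predU1P[-> // | lt_ij].
  by apply: ltnW; apply: positions_lt => //; apply: leqW.
by rewrite Ej leqNgt lt_vi.
Qed.

Lemma count_word_of pos : positions pos -> count id (word_of pos) = k.
Proof.
move=> pos_ok; rewrite /word_of /mkseq count_map -size_filter.
rewrite -[LHS](size_map S) -[RHS](size_iota 1) -[RHS](size_map pos); apply/perm_size/uniq_perm.
- by rewrite (map_inj_uniq succn_inj) filter_uniq // iota_uniq.
- rewrite map_inj_in_uniq ?iota_uniq // => i j; rewrite !mem_iota add1n !ltnS.
  by move=> /andP[_ le_i] /andP[_ le_j]; apply: positions_inj => //; apply: leqW.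
have [pos0 posk lt_pos] := pos_ok.
move=> x; apply/mapP/mapP => [[v] | [i]].
  rewrite mem_filter => /andP[Hv _] ->.
  have /hasP[i] : has (fun i => pos i == v.+1) (iota 0 k.+1) := Hv.
  rewrite mem_iota0 ltnS => le_i /eqP Ei.
  exists i; rewrite ?Ei // mem_iota add1n ltnS le_i andbT.
  by case: i Ei {le_i} => //; rewrite pos0.
rewrite mem_iota add1n ltnS => /andP[i0 le_i] ->.
have lt_0i : 0 < pos i by rewrite -[in X in X < _]pos0; apply: positions_lt => //; apply: leqW.
have lt_in : pos i < n.+1 by rewrite -posk; apply: positions_lt.
exists (pos i).-1; last by rewrite prednK.
rewrite mem_filter mem_iota0 -ltnS prednK // lt_in andbT.
have : has (fun j => pos j == (pos i).-1.+1) (iota 0 k.+1).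
  by apply/hasP; exists i; rewrite ?mem_iota0 // prednK.
by [].
Qed.

Lemma exists_positions (a : seq bool) : size a = n -> count id a = k ->
  exists2 pos, positions pos & a = word_of pos.
Proof.
move=> sz_a Ek; pose ones := [seq v.+1 | v <- iota 0 n & nth false a v].
have sz_ones : size ones = k.
  by rewrite size_map size_filter -Ek -[in RHS](mkseq_nth false a) sz_a count_map.
have ones_lt : all (fun x => 0 < x < n.+1) ones.
  by rewrite all_map; apply/allP=> v; rewrite mem_filter mem_iota0 => /andP[_].
have s_sorted : sorted ltn (0 :: rcons ones n.+1).
  rewrite (sorted_pairwise ltn_trans) -rcons_cons pairwise_rcons pairwise_cons.
  apply/and3P; split.
  - by rewrite /=; apply: sub_all ones_lt => x /andP[].
  - by apply: sub_all ones_lt => x /andP[].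
  rewrite -sorted_pairwise; last exact: ltn_trans.
  rewrite sorted_map; apply: sorted_filter; first by move=> x y z; apply: ltn_trans.
  exact: iota_ltn_sorted.
pose pos i := nth 0 (0 :: rcons ones n.+1) i.
have pos_ok : positions pos.
  split=> //; first by rewrite /pos /= nth_rcons sz_ones ltnn eqxx.
  move=> i le_i; apply: (sorted_ltn_nth ltn_trans 0 s_sorted) => //;
    by rewrite inE /= size_rcons sz_ones ltnS // leqW.
exists pos => //; apply: (@eq_from_nth _ false); rewrite ?size_mkseq // sz_a => v lt_v.
rewrite nth_mkseq //; apply/idP/hasP => [av | [i]].
  have v1 : v.+1 \in ones by apply: map_f; rewrite mem_filter av mem_iota0.
  exists (index v.+1 ones).+1; first by rewrite mem_iota0 ltnS -sz_ones index_mem.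
  by rewrite /pos /= nth_rcons index_mem v1 nth_index.
rewrite mem_iota0 ltnS => le_i /eqP; rewrite /pos; case: i le_i => // i lt_i.
rewrite /= nth_rcons sz_ones lt_i => Ei.
have : v.+1 \in ones by rewrite -Ei mem_nth // sz_ones.
by case/mapP=> u; rewrite mem_filter => /andP[au _] [->].
Qed.

End Positions.
(** * Hitting sets *)

(* Column indices beyond the width of [M] hit no row. *)
Definition hitting_columns (M : seq (seq bool)) (cs : seq nat) : bool :=
  all (fun r => has (nth false r) cs) M.

Section HittingSet.

Variables (c n k : nat).

(* A segment [(i, (a, b))] with [i <= k] says that the [i]-th and [i.+1]-st ones are at the positions
   [a] and [b] (see [positions]); a segment [(k.+1, (j, 0))] selects the [j]-th disjunct. *)
Definition segments (A : nat) : seq seg :=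
  [seq s <- [seq (i, ab) | i <- iota 0 k.+1,
                           ab <- [seq (a, b) | a <- iota 0 n.+1, b <- iota 0 n.+2]]
     | [&& s.2.1 < s.2.2, (s.1 == 0) ==> (s.2.1 == 0) & (s.1 == k) ==> (s.2.2 == n.+1)]]
  ++ [seq (k.+1, (j, 0)) | j <- iota 0 A].

(** Segments with the same index coincide, and consecutive ones meet. Index [k.+1], the choice of a
    disjunct, is exempt from meeting its neighbour. *)
Definition compatible (s t : seg) : bool :=
  ((s.1 == t.1) ==> (s == t)) && ((s.1.+1 == t.1) && (t.1 <= k) ==> (s.2.2 == t.2.1)).

Definition elements (A : nat) : seq (seq seg) :=
  [seq y <- words c (segments A) | all (fun s => all (compatible s) y) y].

(** Variables are counted from 0 and positions from 1, hence [l.1.+1]; the variable is a one iff it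
    is the left end of its segment. *)
Definition certifies (y : seq seg) (g : seq lit) : bool :=
  all (fun l => has (fun s => [&& s.1 <= k, s.2.1 <= l.1.+1, l.1.+1 < s.2.2
                                & (s.2.1 == l.1.+1) == l.2]) y) g.

(** An element that selects another disjunct hits every row of disjunct [j]. So the truth of the
    selected disjunct can be stated by rows for all disjuncts. *)
Definition guesses_other (j : nat) (y : seq seg) : bool :=
  has (fun s => (s.1 == k.+1) && (s.2.1 != j)) y.

(* The first rows force one element per word, the next ones make all elements agree on the segment
   with a given index, and the last ones say that the selected disjunct is true. *)
Definition hitting_matrix (F : seq (seq (seq (seq lit)))) : seq (seq bool) :=
  [seq [seq unzip1 y == w | y <- elements (size F)] | w <- words c (iota 0 k.+2)] ++
  [seq [seq (unzip1 y == w) && ~~ (s \in y) || (unzip1 y == nseq c s.1) && (s \in y)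
          | y <- elements (size F)]
     | w <- words c (iota 0 k.+2), s <- segments (size F)] ++
  [seq [seq guesses_other j y || has (certifies y) D | y <- elements (size F)]
     | j <- iota 0 (size F), D <- nth [::] F j].

Lemma mem_words (A : eqType) m (s : seq A) w :
  (w \in words m s) = (size w == m) && all (mem s) w.
Proof.
elim: m w => [|m IHm] w /=; first by rewrite mem_seq1; case: w.
apply/allpairsP/andP => [[[a u] /= [sa]] | ].
  by rewrite IHm => /andP[/eqP <- us] ->; rewrite /= eqxx sa.
case: w => [|a u] [] //=; rewrite eqSS => sz_u /andP[sa us].
by exists (a, u); rewrite /= IHm sz_u.
Qed.

Lemma size_words (A : Type) m (s : seq A) : size (words m s) = size s ^ m.
Proof. by elim: m => //= m IHm; rewrite size_allpairs IHm expnS. Qed.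

Lemma words_uniq (A : eqType) m (s : seq A) : uniq s -> uniq (words m s).
Proof.
move=> Us; elim: m => //= m IHm; apply: allpairs_uniq => //.
by move=> [a u] [b v] _ _ /= [-> ->].
Qed.

Variable F : seq (seq (seq (seq lit))).

Let W := words c (iota 0 k.+2).
Let U := elements (size F).

Definition hits (H : seq (seq seg)) : Prop :=
  [/\ {subset H <= U},
      forall w, w \in W -> has (fun y => unzip1 y == w) H,
      forall w s, w \in W -> s \in segments (size F) ->
        has (fun y => (unzip1 y == w) && ~~ (s \in y) || (unzip1 y == nseq c s.1) && (s \in y)) H &
      forall j D, j < size F -> D \in nth [::] F j ->
        has (fun y => guesses_other j y || has (certifies y) D) H].

Lemma hitting_matrixP K :
  (exists2 cs, size cs <= K & hitting_columns (hitting_matrix F) cs) <->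
  (exists2 H, size H <= K & hits H).
Proof.
(* Column indices out of range hit nothing and may be dropped. *)
have rowE (p : pred (seq seg)) cs :
    has (nth false [seq p y | y <- U]) cs = has p [seq nth [::] U i | i <- cs & i < size U].
  elim: cs => //= i cs ->; case: ltnP => lt_i /=; first by rewrite (nth_map [::]).
  by rewrite nth_default ?size_map.
rewrite /hitting_columns /hitting_matrix; split=> [[cs le_cs] | [H le_H [HU H1 H2 H3]]].
  rewrite !all_cat => /and3P[H1 H2 H3].
  exists [seq nth [::] U i | i <- cs & i < size U].
    by rewrite size_map size_filter (leq_trans (count_size _ _)).
  split.
  - move=> y /mapP[i]; rewrite mem_filter => /andP[lt_i _] ->; exact: mem_nth.
  - by move=> w Ww; rewrite -rowE; apply: (allP H1); apply: map_f.
  - move=> w s Ww Ss; rewrite -rowE; apply: (allP H2); apply/allpairsP.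
    by exists (w, s).
  move=> j D lt_j FD; rewrite -rowE; apply: (allP H3); apply/allpairsPdep.
  by exists j, D; rewrite mem_iota0.
exists [seq index y U | y <- H]; first by rewrite size_map.
have EH : [seq nth [::] U i | i <- [seq index y U | y <- H] & i < size U] = H.
  elim: H HU {le_H H1 H2 H3} => //= y H IHH HU.
  by rewrite index_mem HU ?mem_head //= nth_index ?HU ?mem_head // IHH // => z Hz;
     apply: HU; rewrite inE Hz orbT.
rewrite !all_cat; apply/and3P; split; apply/allP.
- by move=> _ /mapP[w Ww ->]; rewrite rowE EH; apply: H1.
- by move=> _ /allpairsP[[w s] /= [Ww Ss ->]]; rewrite rowE EH; apply: H2.
move=> _ /allpairsPdep[j [D [lt_j FD ->]]]; rewrite rowE EH; apply: H3 => //.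
by rewrite -mem_iota0.
Qed.

Hypothesis c_ge2 : 2 <= c.

Lemma mem_W w : (w \in W) = (size w == c) && all (fun i => i < k.+2) w.
Proof.
rewrite mem_words; congr (_ && _); apply: eq_all => i.
by rewrite [LHS]mem_iota0.
Qed.

Lemma mem_segments A s : (s \in segments A) =
  (if s.1 <= k then [&& s.2.1 < s.2.2, s.2.2 <= n.+1, (s.1 == 0) ==> (s.2.1 == 0)
                    & (s.1 == k) ==> (s.2.2 == n.+1)]
   else [&& s.1 == k.+1, s.2.1 < A & s.2.2 == 0]).
Proof.
case: s => i [a b]; rewrite mem_cat mem_filter /=.
have -> : ((i, (a, b)) \in [seq (i, ab) | i <- iota 0 k.+1,
     ab <- [seq (a, b) | a <- iota 0 n.+1, b <- iota 0 n.+2]]) =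
     [&& i <= k, a <= n & b <= n.+1].
  apply/allpairsP/and3P => [[[i' ab] []] | [le_i le_a le_b]].
    rewrite mem_iota0 ltnS => le_i /allpairsP[[a' b'] []].
    by rewrite !mem_iota0 !ltnS => le_a le_b -> [-> -> ->].
  exists (i, (a, b)); rewrite mem_iota0 ltnS le_i; split=> //; apply/allpairsP.
  by exists (a, b); rewrite !mem_iota0 !ltnS.
have -> : ((i, (a, b)) \in [seq (k.+1, (j, 0)) | j <- iota 0 A]) =
    [&& i == k.+1, a < A & b == 0].
  apply/mapP/and3P => [[j] | [/eqP-> lt_a /eqP->]].
    by rewrite mem_iota0 => lt_j [-> -> ->]; rewrite !eqxx.
  by exists a; rewrite ?mem_iota0.
case: (leqP i k) => [le_i | lt_i] /=; last by rewrite !andbF.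
rewrite (ltn_eqF (le_i : i < k.+1)) orbF.
have [lt_ab|] := ltnP a b => //=; rewrite andbC -!andbA.
have [le_b|] := leqP b n.+1; last by rewrite andbF.
by rewrite -ltnS (leq_trans lt_ab le_b).
Qed.

Lemma nseq_W i : i < k.+2 -> nseq c i \in W.
Proof. by move=> lt_i; rewrite mem_W size_nseq eqxx; apply/allP=> j /nseqP[->]. Qed.

Lemma c_gt0 : 0 < c.
Proof. exact: ltnW. Qed.

Section FromAssignment.

Variables (pos : nat -> nat) (j0 : nat).
Hypotheses (pos_ok : positions n k pos) (lt_j0 : j0 < size F).

Definition segment_at (i : nat) : seg :=
  if i <= k then (i, (pos i, pos i.+1)) else (k.+1, (j0, 0)).

Lemma segment_at_index i : i < k.+2 -> (segment_at i).1 = i.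
Proof.
rewrite /segment_at; case: (leqP i k) => //= lt_k; rewrite ltnS => le_i.
by apply/eqP; rewrite eqn_leq lt_k.
Qed.

Lemma unzip1_segments w : w \in W -> unzip1 (map segment_at w) = w.
Proof.
rewrite mem_W => /andP[_ /allP Hw]; rewrite /unzip1 -map_comp.
by apply: map_id_in => i /Hw/segment_at_index.
Qed.

Lemma segments_in_U w : w \in W -> map segment_at w \in U.
Proof.
rewrite mem_W => /andP[/eqP sz_w /allP Hw]; rewrite mem_filter; apply/andP; split.
  apply/allP=> _ /mapP[i wi ->]; apply/allP=> _ /mapP[j wj ->].
  rewrite /compatible !segment_at_index ?Hw //; apply/andP; split.
    by apply/implyP=> /eqP->.
  apply/implyP=> /andP[/eqP Eij le_j]; rewrite /segment_at le_j -Eij.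
  by rewrite (leq_trans (leqnSn i)) ?Eij //= Eij.
rewrite mem_words size_map sz_w eqxx; apply/allP=> _ /mapP[i wi ->].
rewrite inE mem_segments segment_at_index ?Hw // /segment_at.
have := Hw i wi; case: (leqP i k) => [le_i _ | lt_i lt_i'] /=.
  have [pos0 posk lt_pos] := pos_ok.
  rewrite lt_pos //= -posk; apply/and3P; split.
  - move: (le_i : i.+1 <= k.+1); rewrite leq_eqVlt => /predU1P[-> // | lt_ik].
    by apply: ltnW; apply: positions_lt pos_ok _ _.
  - by apply/implyP=> /eqP->; rewrite pos0.
  by apply/implyP=> /eqP->.
by rewrite eqn_leq lt_i -ltnS lt_i' lt_j0 eqxx.
Qed.

Lemma certifies_segments g : size g <= c -> all (fun l => l.1 < n) g ->
  all (fun l => nth false (word_of n k pos) l.1 == l.2) g ->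
  exists2 w, w \in W & certifies (map segment_at w) g.
Proof.
move=> le_g /allP g_lt /allP g_true.
have loc v : v < n -> exists i, (i <= k) && (pos i <= v.+1 < pos i.+1).
  by move=> lt_v; have [i le_i Hi] := positions_locate pos_ok (lt_v : v.+1 <= n); exists i;
     rewrite le_i.
pose f (l : lit) := if boolP (l.1 < n) is AltTrue lt_l then xchoose (loc l.1 lt_l) else 0.
have fP (l : lit) : l \in g -> (f l <= k) && (pos (f l) <= l.1.+1 < pos (f l).+1).
  move=> /g_lt lt_l; rewrite /f; case: {-}_ / boolP => [lt_l' | ]; last by rewrite lt_l.
  exact: (xchooseP (loc l.1 lt_l')).
(* One segment index per literal, padded with 0 to length [c]. *)
exists (map f g ++ nseq (c - size g) 0).
  rewrite mem_W size_cat size_map size_nseq subnKC // eqxx all_cat /=; apply/andP; split.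
    by apply/allP=> _ /mapP[l /fP/andP[le_l _] ->]; rewrite ltnS leqW.
  by apply/allP=> i /nseqP[->].
apply/allP=> l gl; have /andP[le_l Hl] := fP l gl; apply/hasP; exists (segment_at (f l)).
  by rewrite map_f // mem_cat map_f.
rewrite /segment_at le_l /= le_l /=; have /andP[-> ->] := Hl => /=.
by rewrite -(nth_word_of pos_ok (g_lt _ gl) le_l Hl) -(eqP (g_true l gl)).
Qed.

Hypothesis F_small : all (all (all (fun g => all (fun l => l.1 < n) g && (size g <= c)))) F.
Hypothesis F_true :
  all (has (all (fun l => nth false (word_of n k pos) l.1 == l.2))) (nth [::] F j0).

(** For each index tuple, the tuple of true segments is chosen; the index [k.+1] stands for the true
    disjunct [j0]. *)
Lemma assignment_hits : exists2 H, size H <= k.+2 ^ c & hits H.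
Proof.
exists [seq map segment_at w | w <- W]; first by rewrite size_map size_words size_iota.
have const_in i : i < k.+2 -> map segment_at (nseq c i) \in [seq map segment_at w | w <- W].
  by move=> lt_i; apply/map_f/nseq_W.
split.
- by move=> _ /mapP[w Ww ->]; apply: segments_in_U.
- move=> w Ww; apply/hasP; exists (map segment_at w); first exact: map_f.
  by rewrite unzip1_segments.
(* If the element for [w] contains [s], then so does the element for the constant word at the index
   of [s]. *)
- move=> w s Ww Ss; have [ws | nws] := boolP (s \in map segment_at w); last first.
    by apply/hasP; exists (map segment_at w); rewrite ?map_f // unzip1_segments // eqxx nws.
  case/mapP: ws => i wi Es.
  have lt_i : i < k.+2 by move: Ww; rewrite mem_W => /andP[_ /allP/(_ i wi)].
  apply/hasP; exists (map segment_at (nseq c i)); first exact: const_in.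
  rewrite unzip1_segments ?nseq_W // Es segment_at_index // eqxx map_nseq.
  by rewrite mem_nseq c_gt0 eqxx orbT.
move=> j D lt_j FD; have [Ej | neq_j] := eqVneq j0 j; last first.
  apply/hasP; exists (map segment_at (nseq c k.+1)); first exact: const_in.
  apply/orP; left; apply/hasP; exists (segment_at k.+1).
    by rewrite map_nseq mem_nseq c_gt0 eqxx.
  by rewrite /segment_at ltnn /= eqxx.
move: FD; rewrite -Ej => FD; have /hasP[g Dg g_true] := allP F_true D FD.
have /allP/(_ g Dg)/andP[g_lt le_g] := allP (allP F_small _ (mem_nth [::] lt_j0)) D FD.
have [w Ww cert_w] := certifies_segments le_g g_lt g_true.
apply/hasP; exists (map segment_at w); first exact: map_f.
by apply/orP; right; apply/hasP; exists g.
Qed.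

End FromAssignment.

Section FromHittingSet.

Variable H : seq (seq seg).
Hypotheses (le_H : size H <= k.+2 ^ c) (H_hits : hits H).

Let HU := let: And4 H0 _ _ _ := H_hits in H0.

Lemma U_W y : y \in U -> unzip1 y \in W.
Proof.
rewrite mem_filter mem_words => /andP[_ /andP[/eqP sz_y /allP Hy]].
rewrite mem_W size_map sz_y eqxx; apply/allP=> _ /mapP[s /Hy Hs ->].
move: Hs; rewrite inE mem_segments; case: (leqP s.1 k) => [le_s _ | _ /and3P[/eqP-> _ _]] //.
by rewrite ltnS leqW.
Qed.

(** Pigeonhole: all (k + 2)^c words occur among at most that many elements, so each occurs once. *)
Lemma unzip1_H_inj : {in H &, injective unzip1}.
Proof.
have [_ H1 _ _] := H_hits.
have : uniq (map unzip1 H).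
  apply: (@leq_size_uniq _ W); first by apply/words_uniq/iota_uniq.
    by move=> w /H1/hasP[y Hy /eqP <-]; apply: map_f.
  by rewrite size_map size_words size_iota.
elim: (H) => //= y s IHs /andP[ny Us] u v; rewrite !inE.
case/predU1P=> [->|su] /predU1P[->|sv] E //.
- by case/negP: ny; rewrite E map_f.
- by case/negP: ny; rewrite -E map_f.
exact: IHs.
Qed.

Lemma choice_for w : w \in W -> exists2 y, y \in H & unzip1 y = w.
Proof. by have [_ H1 _ _] := H_hits => /H1/hasP[y Hy /eqP]; exists y. Qed.

Lemma H_compatible y s t : y \in H -> s \in y -> t \in y -> compatible s t.
Proof. by move=> /HU; rewrite mem_filter => /andP[/allP Hy _] /Hy/allP/(_ t). Qed.

Definition segment (i : nat) : seg :=
  head (0, (0, 0)) (nth [::] H (find (fun y => unzip1 y == nseq c i) H)).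

Lemma segmentP i : i < k.+2 ->
  (segment i).1 = i /\ exists2 y, y \in H & unzip1 y = nseq c i /\ segment i \in y.
Proof.
move=> /nseq_W Wi; have [_ H1 _ _] := H_hits; have Hi := H1 _ Wi.
have := nth_find [::] Hi; rewrite /segment; set y := nth _ _ _ => /eqP Ey.
have Hy : y \in H by rewrite mem_nth // -has_find.
case: y Ey Hy => [|s y] Ey Hy /=; first by move: c_gt0; rewrite -(size_nseq c i) -Ey.
have [-> _] : s.1 = i /\ unzip1 y = nseq c.-1 i.
  by move: Ey; rewrite -{1}(prednK c_gt0) => -[].
by split=> //; exists (s :: y); rewrite ?mem_head.
Qed.

(** The row for the word of [y] and the segment [s] cannot be hit by an element with that word but
    without [s], since this would be [y]. So the element of the constant word contains [s], and
    compatibility identifies [s] with the segment read off there. *)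
Lemma segment_unique y s : y \in H -> s \in y -> s = segment s.1.
Proof.
move=> Hy ys; have [_ _ H2 _] := H_hits.
have Ss : s \in segments (size F).
  by move: (HU Hy); rewrite mem_filter mem_words => /and3P[_ _ /allP/(_ s ys)].
have Wy := U_W (HU Hy).
have lt_s : s.1 < k.+2.
  by move: Wy; rewrite mem_W => /andP[_ /allP/(_ s.1)]; apply; apply: map_f.
have /hasP[y' Hy' /orP[/andP[/eqP/(unzip1_H_inj Hy' Hy)-> ]|/andP[/eqP Ey' ys']]] := H2 _ s Wy Ss.
  by rewrite ys.
have [E1 [z Hz [Ez zs]]] := segmentP lt_s.
have Eyz : y' = z by apply: unzip1_H_inj; rewrite ?Ey'.
rewrite {}Eyz in ys'; have /andP[/implyP H1 _] := H_compatible Hz ys' zs.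
by apply/eqP/H1; rewrite E1.
Qed.

Lemma segment_in w i : w \in W -> i \in w -> exists y, [/\ y \in H, unzip1 y = w & segment i \in y].
Proof.
move=> /choice_for[y Hy Ey]; rewrite -{1}Ey => /mapP[s ys Ei].
by exists y; split=> //; rewrite Ei -(segment_unique Hy ys).
Qed.

Lemma segment_mem i : i < k.+2 -> segment i \in segments (size F).
Proof.
move=> /segmentP[_ [y Hy [_ ys]]].
by move: (HU Hy); rewrite mem_filter mem_words => /and3P[_ _ /allP/(_ _ ys)].
Qed.

Lemma segment_index i : i < k.+2 -> (segment i).1 = i.
Proof. by case/segmentP. Qed.

Lemma segment_link i : i < k -> (segment i).2.2 = (segment i.+1).2.1.
Proof.
(* A word containing both indices, possible because [c >= 2]; compatibility inside its element links
   the two segments. *)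
move=> lt_i; pose w := i :: nseq c.-1 i.+1.
have lt_i1 : i.+1 < k.+2 by rewrite ltnS ltnW.
have Ww : w \in W.
  rewrite mem_W /= size_nseq prednK ?c_gt0 // eqxx (leq_trans lt_i) ?leqW //=.
  by apply/allP=> j /nseqP[->].
have [y [Hy Ey y1]] := segment_in Ww (mem_head _ _).
have [|y' [Hy' Ey' y2]] := segment_in (i := i.+1) Ww.
  by rewrite inE mem_nseq eqxx andbT -ltnS prednK ?c_gt0 // c_ge2 orbT.
have Eyy : y' = y by apply: unzip1_H_inj; rewrite ?Ey.
rewrite {}Eyy in y2; have /andP[_] := H_compatible Hy y1 y2.
rewrite !segment_index ?eqxx ?lt_i //; first by move/eqP.
exact: ltnW.
Qed.

Definition pos_of (i : nat) : nat := if i <= k then (segment i).2.1 else n.+1.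

Lemma segment_at_pos i : i <= k -> segment i = (i, (pos_of i, pos_of i.+1)).
Proof.
move=> le_i; rewrite /pos_of le_i; have lt_i : i < k.+2 by rewrite ltnS leqW.
have := segment_mem lt_i; rewrite mem_segments segment_index // le_i => /and4P[_ _ _ /implyP Hk].
have := segment_index lt_i; case: ltnP => [lt_ik | ge_ik].
  by rewrite -segment_link //; case: (segment i) => ? [? ?] /= ->.
have /Hk/eqP : i == k by rewrite eqn_leq le_i.
by case: (segment i) => ? [? ?] /= -> ->.
Qed.

Lemma pos_of_ok : positions n k pos_of.
Proof.
split=> [||i le_i].
- have := segment_mem (ltn0Sn k.+1); rewrite mem_segments segment_index //= => /and3P[_ _].
  by rewrite /pos_of /= => /andP[/eqP].
- by rewrite /pos_of ltnn.
have lt_i : i < k.+2 by rewrite ltnS leqW.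
have := segment_mem lt_i; rewrite mem_segments segment_index // le_i => /and4P[+ _ _ _].
by rewrite (segment_at_pos le_i).
Qed.

Lemma hits_assignment :
  all (all (all (fun g => all (fun l => l.1 < n) g && (size g <= c)))) F ->
  has (all (has (all (fun l => nth false (word_of n k pos_of) l.1 == l.2)))) F.
Proof.
move=> F_small; have lt_k : k.+1 < k.+2 by [].
have [_ _ _ H3] := H_hits.
have := segment_mem lt_k; rewrite mem_segments segment_index // ltnn => /and3P[_ lt_j _].
set j := (segment k.+1).2.1 in lt_j.
apply/hasP; exists (nth [::] F j); first exact: mem_nth.
(* All elements agree on the segment of index [k.+1], so none selects a disjunct other than [j]. *)
apply/allP=> D FD; have /hasP[y Hy /orP[/hasP[s ys /andP[/eqP Es]]|]] := H3 j D lt_j FD.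
  by rewrite (segment_unique Hy ys) Es eqxx.
case/hasP=> g Dg /allP cert_g; apply/hasP; exists g => //; apply/allP=> l gl.
have /allP/(_ g Dg)/andP[/allP g_lt _] := allP (allP F_small _ (mem_nth [::] lt_j)) D FD.
have /hasP[s ys /and4P[le_s]] := cert_g l gl.
rewrite (segment_unique Hy ys) (segment_at_pos le_s) /= => le_l lt_l /eqP <-.
by rewrite (nth_word_of pos_of_ok (g_lt l gl) le_s) ?le_l.
Qed.

End FromHittingSet.

Lemma hitting_setP :
  all (all (all (fun g => all (fun l => l.1 < n) g && (size g <= c)))) F ->
  (exists2 H, size H <= k.+2 ^ c & hits H) <->
  (exists a, [/\ size a = n, count id a = k &
     has (all (has (all (fun l => nth false a l.1 == l.2)))) F]).
Proof.
move=> F_small; split=> [[H le_H H_hits] | [a [sz_a Ek F_true]]].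
  exists (word_of n k (pos_of H)); split; first exact: size_mkseq.
    exact/count_word_of/pos_of_ok.
  exact: hits_assignment.
have [pos pos_ok Ea] := exists_positions sz_a Ek; rewrite Ea in F_true.
case/hasP: F_true => D FD D_true.
apply: (assignment_hits (j0 := index D F) pos_ok) => //; first by rewrite index_mem.
by rewrite nth_index.
Qed.

End HittingSet.
(** * From hitting sets to the game *)

(** In rows of length N, column [x] is a copy of column x mod N. *)
Definition copies (q : nat) (M : seq (seq bool)) : seq (seq bool) :=
  [seq flatten (nseq q r) | r <- M].

(* The first [m] vertices are columns and form a clique; the others are rows, joined to the
   columns that hit them. *)
Definition incidence (m : nat) (M : seq (seq bool)) (i j : nat) : bool :=
  if i < m then if j < m then i != j else adj M (j - m) i
  else if j < m then adj M (i - m) j else false.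

Lemma nth_copies q N (r : seq bool) x : size r = N -> x < q * N ->
  nth false (flatten (nseq q r)) x = nth false r (x %% N).
Proof.
move=> sz_r; elim: q x => [|q IHq] x; first by rewrite mul0n.
rewrite mulSn /= nth_cat sz_r; case: (ltnP x N) => [lt_x _ | le_x lt_x]; first by rewrite modn_small.
by rewrite IHq ?ltn_subLR // -[in RHS](subnK le_x) modnDr.
Qed.

Section HittingGame.

Variables (K N : nat) (M : seq (seq bool)).
Hypotheses (K_gt0 : 0 < K) (M_rows : all (fun r => (size r == N) && has id r) M).
Hypothesis M_neq0 : M != [::].

Let m := 2 * K * N.
Let M' := copies (2 * K) M.
Let n := m + size M.
Let e (i j : 'I_n) : bool := incidence m M' i j.

Lemma incidence_sym : symmetric e.
Proof.
move=> i j; rewrite /e /incidence; case: (ltnP i m) => _; case: (ltnP j m) => _ //.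
by rewrite eq_sym.
Qed.

Lemma incidence_irr : irreflexive e.
Proof. by move=> i; rewrite /e /incidence; case: ltnP => _ //; rewrite eqxx. Qed.

Let row r := nth [::] M r.

Lemma row_size r : r < size M -> size (row r) = N.
Proof. by move=> lt_r; have /andP[/eqP] := allP M_rows _ (mem_nth [::] lt_r). Qed.

Lemma adj_copies r x : r < size M -> x < m -> adj M' r x = nth false (row r) (x %% N).
Proof.
by move=> lt_r lt_x; rewrite /adj (nth_map [::]) // (nth_copies _ lt_x) // row_size.
Qed.

Lemma N_gt0 : 0 < N.
Proof.
case: M M_neq0 M_rows => // r s _ /= /andP[/andP[/eqP <-] ].
by case: r.
Qed.

Lemma hit_row cs r : hitting_columns M cs -> r < size M ->
  exists2 j, j \in cs & (j < N) && nth false (row r) j.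
Proof.
move=> /allP Hcs lt_r; have /hasP[j csj rj] := Hcs _ (mem_nth [::] lt_r); exists j => //.
rewrite rj andbT -(row_size lt_r) ltnNge; apply: contraL rj => le_j.
by rewrite nth_default.
Qed.

Lemma size_dominator_moves (h : seq 'I_n) : size (dominator_moves Dominator h) = uphalf (size h).
Proof.
elim/last_ind: h => // h v IHh; rewrite size_dmoves_rcons IHh size_rcons /dominator_turn /=.
by rewrite uphalf_half; case: (odd _).
Qed.

Lemma free_copy (h : seq 'I_n) j : size h < 2 * K -> j < N ->
  exists v : 'I_n, [/\ v \notin h, v < m & v %% N = j].
Proof.
move=> lt_h lt_j; have lt_m (i : 'I_(2 * K)) : i * N + j < m.
  apply: (@leq_trans (i.+1 * N)); last by rewrite leq_mul2r ltn_ord orbT.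
  by rewrite (mulSnr i) ltn_add2l.
have lt_n (i : 'I_(2 * K)) : i * N + j < n by apply: ltn_addr.
pose f i := Ordinal (lt_n i).
have f_inj : injective f.
  move=> i1 i2 /(congr1 val) /= /addIn/eqP; rewrite eqn_mul2r.
  by case/orP=> [/eqP N0|/eqP/val_inj //]; have := N_gt0; rewrite N0.
have /existsP[i hi] : [exists i, f i \notin h].
  rewrite -negb_forall; apply: contraTN lt_h => /forallP Hf; rewrite -leqNgt.
  rewrite -(card_ord (2 * K)) -(card_codom f_inj); apply: leq_trans (card_size h).
  by apply/subset_leq_card/subsetP => _ /codomP[i ->].
by exists (f i); split=> //=; rewrite modnMDl modn_small.
Qed.

Lemma hitting_game :
  dominator_wins_within e Dominator K <-> (exists2 cs, size cs <= K & hitting_columns M cs).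
Proof.
rewrite wins_within_win; split=> [win0 | [cs le_cs Hcs]].
  (* For this direction a single play won by Dominator suffices, whatever Staller does in it. *)
  have [h dom_h] : exists h : seq 'I_n, dominating e [set v in take K (dominator_moves Dominator h)].
    suff play p h : win e Dominator K p h -> size h + p = #|'I_n| -> uniq h ->
        exists h', dominating e [set v in take K (dominator_moves Dominator h')].
      exact: play win0 _ _.
    elim: p h => [|p IHp] h win_h Sh Uh; first by exists h.
    have lt_h : size h < #|'I_n| by rewrite -Sh addnS ltnS leq_addr.
    have [v hv win_v] : exists2 v, v \notin h & win e Dominator K p (rcons h v).
      move: win_h => /=; case: ifP => _; first by move=> /existsP[v /andP[hv win_v]]; exists v.
      by have [v hv] := free_vertex Uh lt_h; move=> /forallP/(_ v); rewrite hv; exists v.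
    by apply: IHp win_v _ _; rewrite ?size_rcons ?addSnnS // rcons_uniq hv.
  set D := take K _ in dom_h.
  (* A claimed row vertex may dominate only itself among the rows; it is traded for a column that
     hits this row. *)
  exists [seq (if v < m then v %% N else find id (row (v - m))) | v : 'I_n <- D].
    by rewrite size_map size_take; case: ltnP.
  apply/(all_nthP [::]) => r lt_r; have lt_v : m + r < n by rewrite ltn_add2l.
  have := forallP dom_h (Ordinal lt_v); rewrite inE has_map.
  case/orP=> [Dv | /existsP[u /andP[]]].
    apply/hasP; exists (Ordinal lt_v) => //=; rewrite ltnNge leq_addr /= addKn.
    apply: (@nth_find _ false id); by have /andP[] := allP M_rows _ (mem_nth [::] lt_r).
  rewrite inE => Du; rewrite /e /incidence /= [m + r < m]ltnNge leq_addr /= addKn.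
  case: ltnP => // lt_u; rewrite adj_copies // => ru; apply/hasP; exists u => //=.
  by rewrite lt_u.
(* Invariant: the move number [t] of Dominator is a copy of column [nth 0 cs t], if that is a column
   at all. Before this move 2 t < 2 K vertices are claimed, so a copy is free. *)
have inv p h : uniq h -> size h + p = #|'I_n| ->
    (forall t, t < size (dominator_moves Dominator h) -> t < size cs -> nth 0 cs t < N ->
       exists2 v : 'I_n, v \in take K (dominator_moves Dominator h) &
         (v < m) && (v %% N == nth 0 cs t)) ->
    win e Dominator K p h.
  elim: p h => [|p IHp] h Uh Sh Hh /=.
    have le_K : size cs <= size (dominator_moves Dominator h).
      rewrite addn0 card_ord in Sh.
      apply: (leq_trans le_cs); rewrite size_dominator_moves Sh.
      (* The board has at least 2 K vertices, so Dominator gets at least K moves. *)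
      have : 2 * K <= n by apply: leq_trans (leq_addr _ _); rewrite leq_pmulr ?N_gt0.
      by rewrite uphalf_half; have := odd_double_half n; lia.
    have chosen j : j \in cs -> j < N ->
        exists2 v : 'I_n, v \in take K (dominator_moves Dominator h) & (v < m) && (v %% N == j).
      move=> csj lt_j; have lt_i : index j cs < size cs by rewrite index_mem.
      have [] := Hh (index j cs); rewrite ?nth_index ?(leq_trans lt_i) //.
      by move=> v; exists v.
    apply/forallP=> v; have [lt_v | le_v] := ltnP v m.
      have lt_0 : 0 < size M by case: M M_neq0.
      have [j csj /andP[lt_j _]] := hit_row Hcs lt_0.
      have [u Du /andP[lt_u _]] := chosen j csj lt_j.
      have [-> | neq_uv] := eqVneq v u; first by rewrite inE Du.
      apply/orP; right; apply/existsP; exists u; rewrite inE Du /e /incidence lt_u lt_v /=.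
      by rewrite eq_sym.
    have lt_r : v - m < size M by rewrite ltn_subLR.
    have [j csj /andP[lt_j rj]] := hit_row Hcs lt_r.
    have [u Du /andP[lt_u /eqP Eu]] := chosen j csj lt_j.
    apply/orP; right; apply/existsP; exists u; rewrite inE Du /e /incidence lt_u ltnNge le_v /=.
    by rewrite adj_copies // Eu.
  have lt_h : size h < #|'I_n| by rewrite -Sh addnS ltnS leq_addr.
  have Sh' v : size (rcons h v) + p = #|'I_n| by rewrite size_rcons addSnnS.
  have Uh' v : v \notin h -> uniq (rcons h v) by rewrite rcons_uniq => ->.
  have [even_h | odd_h] := boolP (~~ odd (size h)); last first.
    apply/forallP=> v; apply/implyP=> hv; apply: IHp => //; first exact: Uh'.
    by rewrite dmoves_rcons /dominator_turn (negbTE odd_h).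
  set t0 := size (dominator_moves Dominator h).
  have [v hv Hv] : exists2 v : 'I_n, v \notin h &
      t0 < size cs -> nth 0 cs t0 < N -> (v < m) && (v %% N == nth 0 cs t0).
    have [/andP[lt_t lt_N] | not_t] := boolP ((t0 < size cs) && (nth 0 cs t0 < N)); last first.
      have [v hv] := free_vertex Uh lt_h; exists v => // lt_t lt_N.
      by rewrite lt_t lt_N in not_t.
    have [|v [hv lt_v Ev]] := free_copy (h := h) _ lt_N; last by exists v; rewrite ?lt_v ?Ev ?eqxx.
    have := leq_trans lt_t le_cs; rewrite /t0 size_dominator_moves uphalf_half (negbTE even_h).
    have := odd_double_half (size h); rewrite (negbTE even_h) !add0n => E lt_K.
    by rewrite -E mul2n ltn_double.
  apply/existsP; exists v; rewrite hv /=; apply: IHp => //; first exact: Uh'.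
  rewrite dmoves_rcons /dominator_turn even_h size_rcons => t.
  rewrite ltnS leq_eqVlt => /predU1P[-> | lt_t] lt_cs lt_N.
    exists v; last exact: Hv.
    by rewrite take_oversize ?mem_rcons ?mem_head // size_rcons (leq_trans lt_cs).
  have [u Du Hu] := Hh t lt_t lt_cs lt_N; exists u => //.
  rewrite -cats1 take_cat; case: ltnP => // le_K; rewrite mem_cat.
  by rewrite take_oversize // in Du; rewrite Du.
by apply: inv.
Qed.

End HittingGame.
(** * Hardness *)

Section Hardness.

Variable d : nat.

Let c := (2 ^ d).+2.

Definition game_matrix (K : nat) (M : seq (seq bool)) : seq (seq bool) :=
  let m := 2 * K * size (nth [::] M 0) in
  [seq [seq incidence m (copies (2 * K) M) i j | j <- iota 0 (m + size M)]
     | i <- iota 0 (m + size M)].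

Definition good_circuit (x : tree) : bool :=
  [&& valid_circuit x, circuit_wf (dec_circuit x)
    & within (dec_circuit x) d 2 (output (dec_circuit x))].

Definition circuit_matrix (x : tree) (k : nat) : seq (seq bool) :=
  hitting_matrix c (inputs (dec_circuit x)) k (normal_form d (dec_circuit x)).

(** A zero row cannot be hit, whereas Dominator could claim its vertex; such matrices, like bad
    circuits, go to [Leaf], which encodes no game. *)
Definition game_of_circuit (z : tree * nat) : tree * nat :=
  if good_circuit z.1 && all (has id) (circuit_matrix z.1 z.2)
  then (enc (game_matrix (z.2.+2 ^ c) (circuit_matrix z.1 z.2), true), z.2.+2 ^ c)
  else (Leaf, 0).

Lemma good_circuitP x k :
  weighted_circuit_sat 2 d x k <->
  good_circuit x /\ exists a, [/\ size a = inputs (dec_circuit x), count id a = k &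
    has (all (has (all (fun l => nth false a l.1 == l.2)))) (normal_form d (dec_circuit x))].
Proof.
split=> [[C [-> [C_wf [wC [dC [a [sz_a [Ek sat_a]]]]]]]] | [/and3P[x_ok C_wf out_ok]]].
  rewrite /good_circuit enc_circuitK valid_circuit_enc C_wf withinP //; last by case/andP: C_wf.
  split; first by rewrite /=; apply/andP.
  by exists a; rewrite -(normal_formP C_wf wC dC sz_a).
case=> a [sz_a Ek F_true]; exists (dec_circuit x); rewrite dec_circuitK //.
move: out_ok; rewrite withinP //; last by case/andP: C_wf.
move=> /andP[dC wC]; do 4?split => //.
by exists a; rewrite (normal_formP (d := d)).
Qed.

Lemma circuit_matrixP x k :
  (exists a, [/\ size a = inputs (dec_circuit x), count id a = k &
    has (all (has (all (fun l => nth false a l.1 == l.2)))) (normal_form d (dec_circuit x))]) <->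
  (exists2 cs, size cs <= k.+2 ^ c & hitting_columns (circuit_matrix x k) cs).
Proof.
have c2 : 2 <= c by [].
rewrite hitting_matrixP hitting_setP //.
apply: sub_all (normal_form_small d (dec_circuit x)) => F; apply: sub_all => D; apply: sub_all => g.
by case/andP=> -> le_g; rewrite ltnW // ltnW.
Qed.

Lemma game_matrixE K M N : M != [::] -> all (fun r => size r == N) M ->
  enc (game_matrix K M, true) =
  Node (enc_graph (fun i j : 'I_(2 * K * N + size M) => incidence (2 * K * N) (copies (2 * K) M) i j))
       (enc_player Dominator).
Proof.
move=> M0 /allP HM; have EN : size (nth [::] M 0) = N.
  by apply/eqP/HM/mem_nth; case: M M0 {HM}.
rewrite /game_matrix EN /enc_graph; congr Node.
rewrite -[enc _]/(enc_seq (enc_seq enc_bool) _); congr enc_seq.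
rewrite -val_enum_ord -map_comp; apply: eq_map => i /=.
by rewrite -map_comp.
Qed.

Lemma eq_wins (T : finType) (e e' : rel T) a K :
  e =2 e' -> dominator_wins_within e a K -> dominator_wins_within e' a K.
Proof.
move=> ee' [sigma [L_sigma Hsigma]]; exists sigma; split=> // p play_p follows_p.
have := Hsigma p play_p follows_p; rewrite /dominating; congr is_true; apply: eq_forallb => v.
by congr (_ || _); apply: eq_existsb => u; rewrite ee'.
Qed.

Lemma game_of_circuitP x k : weighted_circuit_sat 2 d x k <->
  short_dominator_mb_dom_game (game_of_circuit (x, k)).1 (game_of_circuit (x, k)).2.
Proof.
rewrite good_circuitP circuit_matrixP /game_of_circuit /=.
have [x_ok | _] := boolP (good_circuit x); last first.
  by split=> [[] // | [n [e [a [_ [_ []]]]]]].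
have M0 : circuit_matrix x k != [::].
  rewrite -size_eq0 size_cat size_map size_words size_iota -lt0n.
  by apply: leq_trans (leq_addr _ _); rewrite expn_gt0.
set M := circuit_matrix x k in M0 *.
have sz_M : all (fun r => size r == size (elements c (inputs (dec_circuit x)) k
    (size (normal_form d (dec_circuit x))))) M.
  rewrite /M /circuit_matrix /hitting_matrix !all_cat; apply/and3P; split; apply/allP.
  - by move=> _ /mapP[w _ ->]; rewrite size_map.
  - by move=> _ /allpairsP[z [_ _ ->]]; rewrite size_map.
  by move=> _ /allpairsPdep[j [D [_ _ ->]]]; rewrite size_map.
have [M_ok | M_empty] := boolP (all (has id) M); last first.
  split=> [[_ [cs _ /allP Hcs]] | [n [e [a [_ [_ []]]]]]] //.
  case/allPn: M_empty => r /Hcs/hasP[j _ rj] /negP[]; apply/hasP; exists (nth false r j) => //.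
  by rewrite mem_nth // ltnNge; apply: contraL rj => le_j; rewrite nth_default.
have K0 : 0 < k.+2 ^ c by rewrite expn_gt0.
set K := k.+2 ^ c in K0 *; set N := size (elements _ _ _ _) in sz_M.
have M_rows : all (fun r => (size r == N) && has id r) M by rewrite all_predI sz_M.
rewrite /= (game_matrixE _ M0 sz_M).
split=> [[_ Hcs] | [n [e [a [_ [_ [E win_e]]]]]]].
  exists (2 * K * N + size M), (fun i j => incidence (2 * K * N) (copies (2 * K) M) i j), Dominator.
  split; first exact: incidence_sym.
  split; first exact: incidence_irr.
  by split=> //; apply/(hitting_game K0 M_rows M0).
split=> //; apply/(hitting_game K0 M_rows M0).
case: E => E; case: a win_e => // win_e _.
(* The code determines the number of vertices and the adjacencies, so [e] is the constructed
   graph. *)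
have En := size_graph e; rewrite -E size_graph in En; subst n.
apply: eq_wins win_e => i j; rewrite -(adj_graph e) -E; exact: adj_graph.
Qed.

(** * Polynomial time of the hardness reduction *)

Lemma pt_valid_circuit E {eE : encodable E} (x : E -> tree) :
  polytime x -> polytime (fun e => valid_circuit (x e)).
Proof. by move=> Px; rewrite /valid_circuit /valid_gate /is_nat; pt. Qed.

Lemma pt_dec_circuit E {eE : encodable E} (x : E -> tree) :
  polytime x -> polytime (fun e => dec_circuit (x e)).
Proof. by move=> Px; rewrite /dec_circuit /dec_gate; pt. Qed.

Ltac pt_dec :=
  lazymatch goal with
  | |- polytime (fun e => dec_circuit (@?x e)) => apply (pt_dec_circuit (x := x))
  end.

Ltac pt_user ::=
  first [pt_eqs | pt_circuits | pt_graphs | pt_matrix | pt_gate | pt_gate_nodes | pt_dec].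

Lemma pt_good_circuit E {eE : encodable E} (x : E -> tree) :
  polytime x -> polytime (fun e => good_circuit (x e)).
Proof.
move=> Px; rewrite /good_circuit /circuit_wf; pt; first exact: pt_valid_circuit.
by apply: pt_within; pt.
Qed.

Lemma pt_segments E {eE : encodable E} (n k A : E -> nat) :
  polytime n -> polytime k -> polytime A -> polytime (fun e => segments (n e) (k e) (A e)).
Proof. by move=> Pn Pk PA; rewrite /segments; pt. Qed.

Ltac pt_segs :=
  lazymatch goal with
  | |- polytime (fun e => segments (@?n e) (@?k e) (@?A e)) =>
      apply (pt_segments (n := n) (k := k) (A := A))
  end.

Ltac pt_user ::=
  first [pt_eqs | pt_circuits | pt_graphs | pt_matrix | pt_gate | pt_gate_nodes | pt_dec | pt_segs].

Lemma pt_elements E {eE : encodable E} (n k A : E -> nat) :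
  polytime n -> polytime k -> polytime A -> polytime (fun e => elements c (n e) (k e) (A e)).
Proof. by move=> Pn Pk PA; rewrite /elements /compatible; pt. Qed.

Lemma pt_hitting_matrix E {eE : encodable E} (n k : E -> nat)
    (F : E -> seq (seq (seq (seq lit)))) :
  polytime n -> polytime k -> polytime F -> polytime (fun e => hitting_matrix c (n e) (k e) (F e)).
Proof.
move=> Pn Pk PF; rewrite /hitting_matrix /guesses_other /certifies /unzip1.
by pt; apply: pt_elements; pt.
Qed.

Lemma pt_circuit_matrix E {eE : encodable E} (x : E -> tree) (k : E -> nat) :
  polytime x -> polytime k -> polytime (fun e => circuit_matrix (x e) (k e)).
Proof.
move=> Px Pk; rewrite /circuit_matrix; apply: pt_hitting_matrix; pt.
by apply: pt_normal_form; pt.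
Qed.

Lemma pt_game_matrix E {eE : encodable E} (K : E -> nat) (M : E -> seq (seq bool)) :
  polytime K -> polytime M -> polytime (fun e => game_matrix (K e) (M e)).
Proof. by move=> PK PM; rewrite /game_matrix /incidence /copies; pt. Qed.

Lemma pt_game_of_circuit : polytime game_of_circuit.
Proof.
have PM : polytime (fun z : tree * nat => circuit_matrix z.1 z.2) by apply: pt_circuit_matrix; pt.
have PK : polytime (fun z : tree * nat => z.2.+2 ^ c) by apply: pt_expn; pt.
rewrite /game_of_circuit; pt; first by apply: pt_good_circuit; pt.
apply: (pt_conv (g := fun z : tree * nat =>
  (game_matrix (z.2.+2 ^ c) (circuit_matrix z.1 z.2), true))) => //.
by pt; apply: pt_game_matrix.
Qed.

End Hardness.

Lemma game_W2_hard : W_hard 2 short_dominator_mb_dom_game.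
Proof.
apply: W_hard_pt => d; exists (game_of_circuit d), (fun k => k.+2 ^ (2 ^ d).+2); split.
- exact: pt_game_of_circuit.
- by apply: pt_expn; pt.
- by move=> k l le_kl; rewrite leq_exp2r // !ltnS.
- by move=> x k; rewrite /game_of_circuit; case: ifP.
- exact: game_of_circuitP.
Qed.

Theorem theorem3p10 : W_complete 2 short_dominator_mb_dom_game.
Proof. split; [exact: game_in_W2 | exact: game_W2_hard]. Qed.
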